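(* Let $0\le q\le N$ be fixed integers and let $h^*$ be an interior point of $\mathbb{R}_+^{q+1}$. Let $U^j=(U_{0j},\dots,U_{Nj})^\top$, $j=1,2,\dots$, be an i.i.d. sequence of random vectors with nonnegative components, and let $\delta_{ij}$ ($i=0,\dots,N$, $j\ge1$) be i.i.d. nonnegative random variables, independent of all $U_{ij}$, with $\mathbb{E}\,\delta_{ij}=1$. Let $Y_{ij}=(T(h^* )U^j)_i\,\delta_{ij}$ and $Y^j=(Y_{0j},\dots,Y_{Nj})^\top$. Let $\mathbb{P}(U_{0j}>0)>0$ and $\mathbb{E}\,U_{ij}^2<\infty$ for all $i,j$. Then the estimators $\hat h^m$, defined as the minimizers over $h\in\mathbb{R}_+^{q+1}$ of the objective function $\sum_{j=1}^m\mathcal{I}(Y^j\|T(h)U^j)$, are consistent for $h^*$ as $m\to\infty$. Moreover, this sequence is asymptotically normal: for some positive definite $\Sigma\in\mathbb{R}^{(q+1)\times(q+1)}$, $\sqrt m\,(\hat h^m-h^* )$ converges in distribution to $N(0,\Sigma)$.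
   Context: For $h=(h_0,\dots,h_q)^\top\in\mathbb{R}_+^{q+1}$ and $N\ge q$, $T(h)\in\mathbb{R}^{(N+1)\times(N+1)}$ is the lower triangular banded Toeplitz matrix with $T(h)_{i,l}=h_{i-l}$ if $0\le i-l\le q$ and $0$ otherwise (indices $0,\dots,N$), so $(T(h)u)_i=\sum_{k=0}^{\min(i,q)}h_ku_{i-k}$. For nonnegative vectors $A,B$ of the same size, $\mathcal{I}(A\|B)=\sum_\alpha\left(A_\alpha\log\frac{A_\alpha}{B_\alpha}-A_\alpha+B_\alpha\right)\in[0,\infty]$, with the conventions $\frac00=0$, $0\log 0=0$, $\frac p0=\infty$ for $p>0$.
   Formalization: Asymptotic normality is stated under the added assumption that the variance of δ_ij is positive and finite; without it the claim is false (e.g. δ_ij = 1 gives ĥ^m = h* when q = N = 0, U = 1). Consistency is stated without this assumption. *)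

(* Defs.v *)
From HB Require Import structures.
From mathcomp Require Import all_boot all_order all_algebra finmap.
From mathcomp Require Import all_classical all_reals all_analysis.

Set Implicit Arguments.
Unset Strict Implicit.
Unset Printing Implicit Defensive.

Import Order.TTheory GRing.Theory Num.Theory.
Import numFieldNormedType.Exports.

Local Open Scope classical_set_scope.
Local Open Scope ring_scope.

(* Real matrices carry the product sigma-algebra (the one generated by the
   entries, i.e. the Borel sigma-algebra), so that random vectors are
   [{RV P >-> 'cV[R]_n}]. *)
Definition matrix_display : measure_display.
Proof. exact: default_measure_display. Qed.

Section measurable_matrix.
Variables (R : realType) (m n : nat).

Definition matrix_cylinders : set (set 'M[R]_(m, n)) :=
  \bigcup_(p in [set: 'I_m * 'I_n])
    preimage_set_system setT (fun M : 'M[R]_(m, n) => M p.1 p.2) measurable.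

HB.instance Definition _ := @isMeasurable.Build matrix_display 'M[R]_(m, n)
  <<s matrix_cylinders >>
  (@sigma_algebra0 _ setT matrix_cylinders)
  (@sigma_algebraC _ matrix_cylinders)
  (@sigma_algebra_bigcup _ setT matrix_cylinders).

End measurable_matrix.

Section probability_notions.
Context (d d' : measure_display) (T : measurableType d) (T' : measurableType d')
  (R : realType) (P : probability T R).

Definition identically_distributed (X Y : {RV P >-> T'}) : Prop :=
  forall A : set T', measurable A -> distribution P X A = distribution P Y A.

Definition mutually_independent (I : choiceType) (X : I -> {RV P >-> T'}) : Prop :=
  forall (J : {fset I}) (A : I -> set T'), (forall i, measurable (A i)) ->
    P (\bigcap_(i in [set` J]) (X i @^-1` A i)) =
    \big[*%E/1%E]_(i <- J) P (X i @^-1` A i).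

Definition generated_events (I : Type) (X : I -> {RV P >-> T'}) : set (set T) :=
  <<s \bigcup_(i in [set: I]) preimage_set_system setT (X i) measurable >>.

End probability_notions.

Definition independent_families (d d1 d2 : measure_display)
    (T : measurableType d) (T1 : measurableType d1) (T2 : measurableType d2)
    (R : realType) (P : probability T R) (I1 I2 : Type)
    (X : I1 -> {RV P >-> T1}) (Y : I2 -> {RV P >-> T2}) : Prop :=
  forall A B : set T, generated_events X A -> generated_events Y B ->
    P (A `&` B) = (P A * P B)%E.

(* [normal_prob] takes the standard deviation as parameter, and is the uniform
   law when that parameter is 0. *)
Definition normal_law (R : realType) (mean variance : R) (B : set R) : \bar R :=
  if variance == 0 then \d_mean B else normal_prob mean (Num.sqrt variance) B.

(* Z ~ N(mu, S): every linear combination a^T Z is N(a^T mu, a^T S a). *)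
Definition multivariate_normal (d : measure_display) (T : measurableType d)
    (R : realType) (P : probability T R) (n : nat)
    (Z : {RV P >-> 'cV[R]_n}) (mu : 'cV[R]_n) (S : 'M[R]_n) : Prop :=
  forall (a : 'cV[R]_n) (B : set R), measurable B ->
    P [set w | B ((a^T *m Z w) 0 0)] =
    normal_law ((a^T *m mu) 0 0) ((a^T *m S *m a) 0 0) B.

Definition positive_definite (R : realType) (n : nat) (S : 'M[R]_n) : Prop :=
  S^T = S /\ forall a : 'cV[R]_n, a != 0 -> 0 < (a^T *m S *m a) 0 0.

Definition cvg_in_probability (d : measure_display) (T : measurableType d)
    (R : realType) (P : probability T R) (n : nat)
    (X : nat -> T -> 'cV[R]_n.+1) (x : 'cV[R]_n.+1) : Prop :=
  forall eps : R, 0 < eps ->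
    P [set w | eps <= `|X m w - x|] @[m --> \oo] --> 0%E.

Definition cvg_in_distribution (d d' : measure_display) (T : measurableType d)
    (T' : measurableType d') (R : realType) (P : probability T R)
    (Q : probability T' R) (n : nat)
    (X : nat -> T -> 'cV[R]_n) (Z : T' -> 'cV[R]_n) : Prop :=
  forall f : 'cV[R]_n -> R, continuous f ->
    (exists M : R, forall x, `|f x| <= M) ->
    ('E_P[f \o X m] @[m --> \oo] --> 'E_Q[f \o Z])%E.

Definition nonneg_orthant (R : realType) (n : nat) : set 'cV[R]_n :=
  [set h | forall k, 0 <= h k 0].

Definition toeplitz (R : realType) (q N : nat) (h : 'cV[R]_q.+1) : 'M[R]_N.+1 :=
  \matrix_(i, l) if (l <= i)%N && (i - l <= q)%N then h (inord (i - l)) 0 else 0.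

(* Since [0 * x = 0], the last branch also covers a = 0, where it equals b. *)
Definition idiv_term (R : realType) (a b : R) : \bar R :=
  if (0 < a) && (b == 0) then +oo%E else (a * ln (a / b) - a + b)%:E.

Definition idiv (R : realType) (n : nat) (A B : 'cV[R]_n) : \bar R :=
  (\sum_(i < n) idiv_term (A i 0%R) (B i 0%R))%E.

Definition idiv_objective (R : realType) (q N m : nat)
    (Y U : nat -> 'cV[R]_N.+1) (h : 'cV[R]_q.+1) : \bar R :=
  (\sum_(j < m) idiv (Y j) (toeplitz N h *m U j)%R)%E.

Definition minimizer_on (T : Type) (R : realType) (D : set T) (f : T -> \bar R)
    (x : T) : Prop :=
  D x /\ forall y, D y -> (f x <= f y)%E.

(* Main.v *)
(* Let [x] range over the rows of the Toeplitz design, so that [(T(h) U)_i = h.x],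
   and let [Psi_m] be the objective. It is convex in [h]; at [hstar] its gradient is
   the score [sum (1 - delta) x], which is centred, and its Hessian is [m J_m],
   where [J_m -> J = E sum_i x x^T / (hstar.x)] by the weak law of large numbers. The
   matrix [J] is positive definite because on the event [U_0 > 0] the triangular
   design is injective. Let [t_m = - J^-1 score / m] be the Newton step. By Taylor
   expansion, with high probability [Psi_m] is larger on the sphere of radius [rho]
   around [hstar + t_m] than at its centre, so by convexity the minimizer lies in that
   ball. A constant [rho] gives consistency; [rho = eps / sqrt m] gives
   [sqrt m (hhat - hstar) - sqrt m t_m -> 0] in probability.

   The vector [sqrt m t_m] is a normalized sum of i.i.d. centred square-integrable
   vectors with covariance [var(delta) J^-1 K J^-1], [K = E sum_i x x^T]. Its
   characteristic function converges to the Gaussian one, and it is tight by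
   Chebyshev's inequality. Bounded continuous test functions are approximated on
   compact sets by trigonometric sums (Bernstein polynomials in sines), which
   turns convergence of characteristic functions into convergence in distribution. *)
Require Import Defs.
From HB Require Import structures.
From mathcomp Require Import all_boot all_order all_algebra finmap.
From mathcomp Require Import all_classical all_reals all_analysis.
From mathcomp Require Import measurable_realfun ring lra.

Set Implicit Arguments.
Unset Strict Implicit.
Unset Printing Implicit Defensive.

Import Order.TTheory GRing.Theory Num.Theory.
Import numFieldNormedType.Exports.

Local Open Scope classical_set_scope.
Local Open Scope ring_scope.

(** * The divergence objective and its Taylor expansion *)

(** The data are only square integrable, and for consistency the noise has only a mean, so a
    remainder estimate through third moments is out of reach. The interior position of [hstar]
    resolves this: if all its entries are at least [kappa], a perturbation [s] changes every fitted
    value [hstar.x] by a relative amount at most [|s| / kappa], whatever the data. The cubic Taylor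
    remainder is then at most a multiple of [|s| / kappa] times the Hessian form itself, so that
    controlling the single matrix [J_m] controls the whole expansion. The localization of the
    minimizer is thus a deterministic statement, valid outcome by outcome; probability enters only
    through the size of [J_m - J] and of the Newton step. That step is built with the limit [J]
    instead of [J_m], which makes it an exact i.i.d. sum. Infinite values of the objective are
    handled by [admissible], which describes where it is finite. The Gaussian limit has to be
    exhibited on some probability space: it is a finite combination of independent standard normal
    variables along vectors whose squares sum to the covariance form. *)

Section dot.
Variable R : realType.

Definition dot n (a x : 'cV[R]_n) : R := \sum_k a k 0 * x k 0.

Lemma dotE n (a x : 'cV[R]_n) : (a^T *m x) 0 0 = dot a x.
Proof. by rewrite mxE; apply: eq_bigr => k _; rewrite mxE. Qed.

Lemma dotC n (a x : 'cV[R]_n) : dot a x = dot x a.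
Proof. by apply: eq_bigr => k _; rewrite mulrC. Qed.

Lemma dotDl n (a b x : 'cV[R]_n) : dot (a + b) x = dot a x + dot b x.
Proof. by rewrite -big_split; apply: eq_bigr => k _; rewrite mxE mulrDl. Qed.

Lemma dotDr n (a b x : 'cV[R]_n) : dot x (a + b) = dot x a + dot x b.
Proof. by rewrite dotC dotDl !(dotC x). Qed.

Lemma dotZl n c (a x : 'cV[R]_n) : dot (c *: a) x = c * dot a x.
Proof. by rewrite mulr_sumr; apply: eq_bigr => k _; rewrite mxE mulrA. Qed.

Lemma dotZr n c (a x : 'cV[R]_n) : dot a (c *: x) = c * dot a x.
Proof. by rewrite dotC dotZl dotC. Qed.

Lemma dotNl n (a x : 'cV[R]_n) : dot (- a) x = - dot a x.
Proof. by rewrite -scaleN1r dotZl mulN1r. Qed.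

Lemma dotNr n (a x : 'cV[R]_n) : dot a (- x) = - dot a x.
Proof. by rewrite dotC dotNl dotC. Qed.

Lemma dot0l n (x : 'cV[R]_n) : dot 0 x = 0.
Proof. by rewrite -(scale0r 0) dotZl mul0r. Qed.

Lemma dot0r n (x : 'cV[R]_n) : dot x 0 = 0.
Proof. by rewrite dotC dot0l. Qed.

Lemma dot_sumr n (I : Type) (r : seq I) (p : pred I) (F : I -> 'cV[R]_n) a :
  dot a (\sum_(i <- r | p i) F i) = \sum_(i <- r | p i) dot a (F i).
Proof.
by elim/big_rec2: _ => [|i y1 y2 _ <-]; rewrite ?dot0r// dotDr.
Qed.

Lemma ler_mx_coord m n (x : 'M[R]_(m.+1, n.+1)) i j : `|x i j| <= `|x|.
Proof.
rewrite [leRHS]mx_normrE; apply: (@le_trans _ _ `|x (i, j).1 (i, j).2|) => //.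
exact: (le_bigmax _ (fun p : 'I_m.+1 * 'I_n.+1 => `|x p.1 p.2|)).
Qed.

Lemma mx_norm_coord m n (x : 'M[R]_(m.+1, n.+1)) : exists i j, `|x| = `|x i j|.
Proof.
have [/eqP x0|x0] := boolP (`|x| == 0).
  exists 0, 0; rewrite x0; apply/esym/eqP.
  by rewrite normr_eq0; move/eqP : x0; rewrite normr_eq0 => /eqP ->; rewrite mxE.
by have [[i j] /= ij] := mx_norm_neq0 x0; exists i, j.
Qed.

Lemma ler_norm_dot n (a x : 'cV[R]_n.+1) : `|dot a x| <= n.+1%:R * (`|a| * `|x|).
Proof.
apply: le_trans (ler_norm_sum _ _ _) _.
have -> : n.+1%:R * (`|a| * `|x|) = \sum_(i < n.+1) (`|a| * `|x|).
  by rewrite sumr_const card_ord mulr_natl.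
by apply: ler_sum => i _; rewrite normrM ler_pM ?ler_mx_coord.
Qed.

End dot.

Section mean_value.
Variable R : realType.

(** Applied repeatedly, this replaces Taylor's formula: each remainder estimate for the logarithm,
    sine and cosine below bounds a derivative by an earlier estimate. The ball [|x| <= |r|] treats
    both signs of [r] at once. *)
Lemma mvt_bound (f f' : R -> R) (r C : R) :
  (forall x : R, `|x| <= `|r| -> is_derive x 1 f (f' x)) ->
  (forall x : R, `|x| <= `|r| -> `|f' x| <= C) ->
  `|f r - f 0| <= C * `|r|.
Proof.
move=> df f'C.
have bndp (c : R) : c \in `[0, r] -> `|c| <= `|r|.
  rewrite in_itv/= => /andP[c0 cr].
  by rewrite !ger0_norm// (le_trans c0).
have bndn (c : R) : c \in `[r, 0] -> `|c| <= `|r|.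
  rewrite in_itv/= => /andP[cr c0].
  by rewrite !ler0_norm ?lerN2// (le_trans cr).
have [r0|r0|->] := ltgtP r 0; last by rewrite subrr normr0 mulr0.
  have [x xr||c cr] := @MVT_segment R f f' r 0 (ltW r0).
  - by apply/df/bndn; move: xr; rewrite !in_itv/= => /andP[/ltW -> /ltW ->].
  - by apply: derivable_within_continuous => x xr; have [] := df x (bndn _ xr).
  rewrite distrC => ->.
  by rewrite sub0r normrM normrN ler_wpM2r// f'C// bndn.
have [x xr||c cr] := @MVT_segment R f f' 0 r (ltW r0).
- by apply/df/bndp; move: xr; rewrite !in_itv/= => /andP[/ltW -> /ltW ->].
- by apply: derivable_within_continuous => x xr; have [] := df x (bndp _ xr).
by rewrite subr0 => ->; rewrite normrM ler_wpM2r// f'C// bndp.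
Qed.

End mean_value.

Section divergence.
Variable R : realType.
Implicit Types (a b v r t : R).

(** A total real-valued version of [idiv_term], open to calculus. Where [a > 0] and [b = 0] its
    value is meaningless, and the hypotheses of the form [0 < a -> b != 0] exclude that case. *)
Definition ridiv a b : R := a * ln (a / b) - a + b.

Lemma idiv_term_fin a b : (0 < a -> b != 0) -> idiv_term a b = (ridiv a b)%:E.
Proof.
rewrite /idiv_term => ab; case: ifP => // /andP[/ab /negbTE -> //].
Qed.

Lemma ridiv_convex a b c t : 0 <= a -> 0 <= b -> 0 <= c -> 0 < t < 1 ->
  (0 < a -> b != 0) -> (0 < a -> c != 0) ->
  ridiv a (c + t * (b - c)) <= t * ridiv a b + (1 - t) * ridiv a c.
Proof.
move=> a0 b0 c0 /andP[t0 t1] ab ac; rewrite /ridiv.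
have [->|a_neq0] := eqVneq a 0; first by rewrite !mul0r; lra.
have agt0 : 0 < a by rewrite lt0r a_neq0.
have bgt0 : 0 < b by rewrite lt0r ab.
have cgt0 : 0 < c by rewrite lt0r ac.
have bc : 0 < c + t * (b - c).
  have -> : c + t * (b - c) = t * b + (1 - t) * c by ring.
  by rewrite addr_gt0// mulr_gt0// subr_gt0.
rewrite !ln_div ?posrE//.
suff H : t * ln b + (1 - t) * ln c <= ln (c + t * (b - c)).
  rewrite -subr_ge0.
  have -> : t * (a * (ln a - ln b) - a + b) + (1 - t) * (a * (ln a - ln c) - a + c)
    - (a * (ln a - ln (c + t * (b - c))) - a + (c + t * (b - c))) =
    a * (ln (c + t * (b - c)) - (t * ln b + (1 - t) * ln c)) by ring.
  by rewrite mulr_ge0// subr_ge0.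
(* The tangent to [ln] at the intermediate point lies above the graph. Averaging it at [b] and [c]
   with weights [t] and [1 - t] cancels the linear terms, which is concavity. *)
have tangent y : 0 < y ->
    ln y <= ln (c + t * (b - c)) + (y / (c + t * (b - c)) - 1).
  move=> y0; rewrite -lerBlDl -ln_div ?posrE//.
  have := @le_ln1Dx R (y / (c + t * (b - c)) - 1).
  by rewrite (addrC 1) subrK; apply; rewrite ltrBDl subrr divr_gt0.
have := tangent _ bgt0; have := tangent _ cgt0.
set z := c + t * (b - c) in bc *.
move=> /(ler_wpM2l (_ : 0 <= 1 - t)); rewrite subr_ge0 => /(_ (ltW t1)) H1.
move=> /(ler_wpM2l (ltW t0)) H2.
apply: le_trans (lerD H2 H1) _.
rewrite le_eqVlt; apply/orP; left; apply/eqP.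
transitivity (ln z + ((c + t * (b - c)) / z - 1)); first by field; exact: lt0r_neq0.
by rewrite -/z divff ?subrr ?addr0// lt0r_neq0.
Qed.

(** The derivative of the remainder is exactly [x ^+ 2 / (1 + x)], and [1 + x >= 1/2] on the range
    considered; hence the constant 2. *)
Lemma ln1D_taylor2 r : `|r| <= 2^-1 -> `|ln (1 + r) - r + r ^+ 2 / 2| <= 2 * `|r| ^+ 3.
Proof.
move=> r2.
pose f x : R := ln (1 + x) - x + x ^+ 2 / 2.
pose f' x : R := (1 + x)^-1 - 1 + x.
have gt0 (x : R) : `|x| <= 2^-1 -> 0 < 1 + x.
  by rewrite ler_norml => /andP[]; lra.
have df (x : R) : `|x| <= 2^-1 -> is_derive x 1 f (f' x).
  move=> /gt0 x0; rewrite /f /f'.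
  have dln : is_derive (1 + x) 1 (@ln R) (1 + x)^-1 by exact: is_derive1_ln.
  apply: is_derive_eq; rewrite !scaler1 !add0r !mulr1/= /GRing.scale/=.
  by rewrite !mulr0 add0r; congr (_ + _); lra.
have f'b (x : R) : `|x| <= `|r| -> `|f' x| <= 2 * `|r| ^+ 2.
  move=> xr; have x2 := le_trans xr r2; have := gt0 _ x2 => x0.
  have -> : f' x = x ^+ 2 / (1 + x) by rewrite /f'; field; exact: lt0r_neq0.
  rewrite normrM normfV normrX (gtr0_norm x0) ler_pdivrMr//.
  apply: (@le_trans _ _ (`|r| ^+ 2)); first by rewrite lerXn2r ?nnegrE.
  rewrite mulrAC ler_peMl ?exprn_ge0//; move: x2; rewrite ler_norml => /andP[]; lra.
have f0 : f 0 = 0 by rewrite /f addr0 ln1 expr0n/=; lra.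
rewrite -/(f r) -[f r]subr0 -[X in _ - X]f0 exprSr mulrA.
by apply: (@mvt_bound _ f f') => // x xr; apply: df; apply: le_trans r2.
Qed.

End divergence.

Section design.
Variables (R : realType) (q N : nat).

Definition design (u : 'cV[R]_N.+1) (i : 'I_N.+1) : 'cV[R]_q.+1 :=
  \col_k if (k <= i)%N then u (inord (i - k)) 0 else 0.

Lemma toeplitz_dot (h : 'cV[R]_q.+1) u i :
  (toeplitz N h *m u) i 0 = dot h (design u i).
Proof.
rewrite mxE /dot.
under eq_bigr do rewrite mxE.
under [RHS]eq_bigr do rewrite mxE.
rewrite [RHS](eq_bigr (fun k : 'I_q.+1 =>
  if (k <= i)%N then h k 0 * u (inord (i - k)) 0 else 0)); last first.
  by move=> k _; case: ifP => //; rewrite mulr0.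
rewrite (eq_bigr (fun l : 'I_N.+1 =>
  if (l <= i)%N && (i - l <= q)%N then h (inord (i - l)) 0 * u l 0 else 0)); last first.
  by move=> l _; case: ifP => //; rewrite mul0r.
rewrite -!big_mkcond/=.
rewrite (reindex_onto (fun k : 'I_q.+1 => inord (i - k) : 'I_N.+1)
  (fun l : 'I_N.+1 => inord (i - l) : 'I_q.+1))/=; last first.
  move=> l /andP[li ilq].
  have -> : (inord (i - l) : 'I_q.+1) = (i - l)%N :> nat by rewrite inordK.
  by rewrite subKn// inord_val.
apply: eq_big => [k|k].
  have iN : (i - k < N.+1)%N by rewrite (leq_ltn_trans (leq_subr _ _)).
  rewrite inordK// leq_subr/=.
  have [ki|ik] := leqP k i; first by rewrite subKn// -ltnS ltn_ord inord_val eqxx.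
  (* For [k > i] truncated subtraction sends [k] to 0, and the way back gives [i], not [k]. The
     round-trip condition of the reindexing therefore drops exactly these indices. *)
  have /eqP -> : (i - k == 0)%N by rewrite subn_eq0 ltnW.
  rewrite subn0; apply/negP => /andP[iq /eqP/(congr1 val)/=].
  by rewrite inordK// => ki; rewrite ki ltnn in ik.
have iN : (i - k < N.+1)%N by rewrite (leq_ltn_trans (leq_subr _ _)).
by case/andP => _ /eqP ->.
Qed.

Lemma design_ge0 u i k : nonneg_orthant u -> 0 <= design u i k 0.
Proof. by move=> u0; rewrite mxE; case: ifP. Qed.

End design.

Section objective.
Variables (R : realType) (n : nat) (I : finType).
Variables (a : I -> R) (x : I -> 'cV[R]_n.+1).
Implicit Types h c : 'cV[R]_n.+1.

Definition robjective h := \sum_l ridiv (a l) (dot h (x l)).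

(** The domain of finiteness of the extended-valued objective, as the next two lemmas show; on it
    the objective equals [robjective]. *)
Definition admissible h := forall l, 0 < a l -> dot h (x l) != 0.

Lemma eobjective_fin h : admissible h ->
  (\sum_l idiv_term (a l) (dot h (x l)))%E = (robjective h)%:E.
Proof.
by move=> ah; rewrite -sumEFin; apply: eq_bigr => l _; rewrite idiv_term_fin//; exact: ah.
Qed.

Lemma eobjective_admissible h :
  (\sum_l idiv_term (a l) (dot h (x l)) < +oo)%E -> admissible h.
Proof.
move=> fin l al; apply/negP => hl; move: fin; rewrite ltey => /eqP; apply.
apply/eqP; rewrite esum_eqy; last first.
  by move=> i _; rewrite /idiv_term; case: ifP.
by apply/existsP; exists l; rewrite /idiv_term al hl /=.
Qed.

Hypotheses (a_ge0 : forall l, 0 <= a l) (x_ge0 : forall l k, 0 <= x l k 0).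

Lemma dot_orthant_ge0 h l : nonneg_orthant h -> 0 <= dot h (x l).
Proof. by move=> h0; apply: sumr_ge0 => k _; rewrite mulr_ge0. Qed.

(** If [h] lay beyond the sphere, the segment from [c] to [h] would cross it at a point where
    convexity keeps the value at most that of [c], against the hypothesis on the sphere. *)
Lemma robjective_localize h c (e : R) : 0 < e ->
  nonneg_orthant h -> nonneg_orthant c -> admissible h -> admissible c ->
  robjective h <= robjective c ->
  (forall h', `|h' - c| = e -> robjective c < robjective h') ->
  `|h - c| <= e.
Proof.
move=> e0 h0 c0 ah ac hc sphere; rewrite leNgt; apply/negP => eh.
have hc0 : 0 < `|h - c| by apply: lt_trans eh.
pose t := e / `|h - c|.
have t01 : 0 < t < 1 by rewrite divr_gt0//= ltr_pdivrMr// mul1r.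
have := sphere (c + t *: (h - c)); rewrite addrC addKr.
rewrite normrZ gtr0_norm ?(andP t01).1// divfK ?gt_eqF// => /(_ erefl).
apply/negP; rewrite -leNgt.
apply: (@le_trans _ _ (t * robjective h + (1 - t) * robjective c)).
  rewrite /robjective !mulr_sumr -big_split/=; apply: ler_sum => l _.
  rewrite dotDl dotZl dotDl dotNl.
  by apply: ridiv_convex => //; [exact: dot_orthant_ge0|exact: dot_orthant_ge0|
    exact: ah|exact: ac].
rewrite -subr_ge0.
have -> : robjective c - (t * robjective h + (1 - t) * robjective c) =
  t * (robjective c - robjective h) by ring.
by rewrite mulr_ge0 ?subr_ge0// ltW// (andP t01).1.
Qed.

(** Both sides compare with the sum of the entries of [x l], which are nonnegative. This is where a
    positive lower bound on [hs] yields a relative bound on [dot s (x l)] uniform over all data. *)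
Lemma dot_bounds (hs s : 'cV[R]_n.+1) (k : R) l : 0 < k ->
  (forall i, k <= hs i 0) -> k * `|dot s (x l)| <= `|s| * dot hs (x l).
Proof.
move=> k0 khs; apply: (@le_trans _ _ (k * (`|s| * \sum_i x l i 0))).
  rewrite ler_wpM2l ?(ltW k0)//; apply: le_trans (ler_norm_sum _ _ _) _.
  rewrite mulr_sumr; apply: ler_sum => i _.
  by rewrite normrM (ger0_norm (x_ge0 _ _)) ler_wpM2r// ler_mx_coord.
rewrite mulrCA ler_wpM2l//.
by rewrite mulr_sumr; apply: ler_sum => i _; rewrite ler_wpM2r.
Qed.

End objective.

Section taylor.
Variables (R : realType) (n : nat) (I : finType).
Variables (d : I -> R) (x : I -> 'cV[R]_n.+1) (hs : 'cV[R]_n.+1) (k : R).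
Hypotheses (d_ge0 : forall l, 0 <= d l) (x_ge0 : forall l i, 0 <= x l i 0).
Hypotheses (k_gt0 : 0 < k) (khs : forall i, k <= hs i 0).

Let hs_ge0 : nonneg_orthant hs.
Proof. by move=> i; apply: le_trans (khs i); exact: ltW. Qed.

Let v l := dot hs (x l).

(* When [v l = 0] also [x l = 0], and the junk value [0 / 0 = 0] is the right one. *)
Definition score := \sum_l (1 - d l) *: x l.
Definition curvature (s t : 'cV[R]_n.+1) :=
  \sum_l d l * (dot s (x l) * dot t (x l)) / v l.

(** The radius [k / 2] keeps the relative change of each fitted value at most one half, so a
    positive one stays positive. *)
Lemma admissible_near (s : 'cV[R]_n.+1) : `|s| <= k / 2 ->
  admissible (fun l => d l * v l) x (hs + s).
Proof.
move=> sk l dv; have vl : 0 < v l.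
  rewrite lt0r; have [v0|_] := eqVneq (v l) 0; first by rewrite v0 mulr0 ltxx in dv.
  exact: dot_orthant_ge0.
have := dot_bounds x_ge0 s l k_gt0 khs; rewrite -/(v l) => H.
have : k * `|dot s (x l)| <= k / 2 * v l by apply: le_trans H _; rewrite ler_pM2r.
rewrite -mulrA ler_pM2l// => H2.
rewrite dotDl -/(v l) gt_eqF//; move: H2; rewrite ler_norml => /andP[]; lra.
Qed.

(** With the relative change [r = w / v l], one summand errs by exactly [d l * v l] times the
    remainder of [ln (1 + r)]. One factor of [|r| ^+ 3] is traded for [|s| / k], and the other two
    rebuild the curvature term. *)
Lemma robjective_taylor (s : 'cV[R]_n.+1) : `|s| <= k / 2 ->
  `|robjective (fun l => d l * v l) x (hs + s) - robjective (fun l => d l * v l) x hs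
    - (dot s score + curvature s s / 2)| <= 2 * `|s| / k * curvature s s.
Proof.
move=> sk; rewrite /robjective /score /curvature dot_sumr !mulr_suml.
rewrite -!sumrB -big_split -sumrB mulr_sumr/=.
apply: le_trans (ler_norm_sum _ _ _) _; apply: ler_sum => l _.
rewrite dotZr dotDl -/(v l).
have B := dot_bounds x_ge0 s l k_gt0 khs; rewrite -/(v l) in B.
set w := dot s (x l) in B *.
have [v0|v_neq0] := eqVneq (v l) 0.
  rewrite v0 mulr0 pmulr_rle0// normr_le0 in B; rewrite v0 (eqP B).
  by rewrite /ridiv !(mulr0, mul0r, addr0, subr0) normr0.
have vl : 0 < v l by rewrite lt0r v_neq0 dot_orthant_ge0.
pose r := w / v l.
have rk : `|r| <= `|s| / k.
  by rewrite normrM normfV (gtr0_norm vl) ler_pdivrMr// mulrAC ler_pdivlMr// mulrC.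
have r2 : `|r| <= 2^-1.
  by apply: le_trans rk _; rewrite ler_pdivrMr// mulrC.
have r1 : 0 < 1 + r by move: r2; rewrite ler_norml => /andP[]; lra.
have wE : w = v l * r by rewrite /r mulrC divfK.
have T := ln1D_taylor2 r2.
have -> : ridiv (d l * v l) (v l + w) - ridiv (d l * v l) (v l)
   - ((1 - d l) * w + d l * (w * w) / v l / 2) =
   - (d l * v l * (ln (1 + r) - r + r ^+ 2 / 2)).
  rewrite /ridiv; have [d0|d_neq0] := eqVneq (d l) 0.
    by rewrite d0 !mul0r; ring.
  have dl : 0 < d l by rewrite lt0r d_neq0 d_ge0.
  have -> : v l + w = v l * (1 + r) by rewrite wE; ring.
  rewrite !ln_div ?posrE ?mulr_gt0// (@lnM _ (v l)) ?posrE//.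
  have -> : d l * (w * w) / v l / 2 = d l * v l * (r ^+ 2 / 2).
    by rewrite wE; field.
  by rewrite wE; ring.
rewrite normrN normrM ger0_norm ?mulr_ge0 ?(ltW vl)//.
apply: (@le_trans _ _ (d l * v l * (2 * `|r| ^+ 3))).
  by rewrite ler_wpM2l// mulr_ge0// ltW.
have -> : d l * (w * w) / v l = d l * v l * `|r| ^+ 2.
  by rewrite real_normK ?num_real// wE; field.
rewrite exprSr.
have -> : d l * v l * (2 * (`|r| ^+ 2 * `|r|)) = (d l * v l * `|r| ^+ 2 * 2) * `|r| by ring.
have -> : 2 * `|s| / k * (d l * v l * `|r| ^+ 2) = (d l * v l * `|r| ^+ 2 * 2) * (`|s| / k) by ring.
by rewrite ler_wpM2l// !mulr_ge0 ?exprn_ge0// ltW.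
Qed.

End taylor.

(** * Approximation of continuous functions by trigonometric sums *)

Section bernstein.
Variable R : realType.
Implicit Types (u : R) (r j : nat).

(** The binomial probability of [j] successes in [r] trials, that is the Bernstein basis polynomial,
    through Pascal's recursion. The recursion yields the moments by induction and shows later that
    [bern] of a trigonometric sum is again one. *)
Fixpoint bern u r j : R :=
  if r is r'.+1 then
    (if j is j'.+1 then u * bern u r' j' else 0) + (1 - u) * bern u r' j
  else (j == 0)%:R.

Lemma bern_gt u r j : (r < j)%N -> bern u r j = 0.
Proof.
elim: r j => [|r IH] [|j]//= rj.
by rewrite !IH ?mulr0 ?addr0// (ltn_trans _ rj).
Qed.

Lemma bern_ge0 u r j : 0 <= u <= 1 -> 0 <= bern u r j.
Proof.
move=> /andP[u0 u1]; elim: r j => [|r IH] j /=; first by rewrite ler0n.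
by rewrite addr_ge0 ?mulr_ge0 ?subr_ge0//; case: j => // j; rewrite mulr_ge0.
Qed.

(** Conditioning on the outcome of one trial. *)
Lemma bern_rec u r (f : nat -> R) :
  \sum_(j < r.+2) bern u r.+1 j * f j =
  u * (\sum_(j < r.+1) bern u r j * f j.+1) +
  (1 - u) * \sum_(j < r.+1) bern u r j * f j.
Proof.
rewrite /= (eq_bigr (fun j : 'I_r.+2 =>
  (if nat_of_ord j is j'.+1 then u * bern u r j' else 0) * f j +
  (1 - u) * (bern u r j * f j))); last by move=> j _; rewrite mulrDl mulrA.
rewrite big_split/=; congr (_ + _).
  rewrite big_ord_recl/= mul0r add0r mulr_sumr.
  by apply: eq_bigr => j _; rewrite mulrA.
by rewrite -mulr_sumr big_ord_recr/= bern_gt// mul0r addr0.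
Qed.

Lemma bern_sum u r : \sum_(j < r.+1) bern u r j = 1.
Proof.
elim: r => [|r IH]; first by rewrite big_ord1.
rewrite (eq_bigr (fun j : 'I_r.+2 => bern u r.+1 j * 1)); last by move=> j _; rewrite mulr1.
rewrite (bern_rec u r (fun=> 1)) (eq_bigr (fun j : 'I_r.+1 => bern u r j)); last by move=> j _; rewrite mulr1.
by rewrite IH; ring.
Qed.

Lemma bern_mean u r : \sum_(j < r.+1) bern u r j * j%:R = r%:R * u.
Proof.
elim: r => [|r IH]; first by rewrite big_ord1 mulr0 mul0r.
rewrite (bern_rec u r (fun j => j%:R)) IH.
rewrite (eq_bigr (fun j : 'I_r.+1 => bern u r j * j%:R + bern u r j)); last first.
  by move=> j _; rewrite -natr1; ring.
by rewrite big_split/= IH bern_sum -natr1; ring.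
Qed.

Lemma bern_mean2 u r : \sum_(j < r.+1) bern u r j * j%:R ^+ 2 =
  r%:R * u * (1 - u) + r%:R ^+ 2 * u ^+ 2.
Proof.
elim: r => [|r IH]; first by rewrite big_ord1/= expr0n/=; ring.
rewrite (bern_rec u r (fun j => j%:R ^+ 2)) IH.
rewrite (eq_bigr (fun j : 'I_r.+1 => bern u r j * j%:R ^+ 2 +
   (2 * (bern u r j * j%:R) + bern u r j))); last first.
  by move=> j _; rewrite -natr1; ring.
by rewrite !big_split/= -mulr_sumr IH bern_mean bern_sum -natr1; ring.
Qed.

(** The left side is the variance of a binomial frequency, [u * (1 - u) / r]. *)
Lemma bern_var u r : 0 <= u <= 1 -> (0 < r)%N ->
  \sum_(j < r.+1) bern u r j * (j%:R / r%:R - u) ^+ 2 <= r%:R^-1.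
Proof.
move=> /andP[u0 u1] r0; have rR : r%:R != 0 :> R by rewrite pnatr_eq0 -lt0n.
rewrite (eq_bigr (fun j : 'I_r.+1 => r%:R ^- 2 * (bern u r j * j%:R ^+ 2) +
   ((- 2 * u / r%:R) * (bern u r j * j%:R) + u ^+ 2 * bern u r j))); last first.
  by move=> j _; field.
rewrite !big_split/= -!mulr_sumr bern_mean bern_mean2 bern_sum.
have -> : r%:R ^- 2 * (r%:R * u * (1 - u) + r%:R ^+ 2 * u ^+ 2) +
  (-2 * u / r%:R * (r%:R * u) + u ^+ 2 * 1) = u * (1 - u) * r%:R^-1 by field.
by rewrite ler_piMl ?invr_ge0// mulr_ile1 ?subr_ge0// lerBlDr lerDl.
Qed.

End bernstein.

(** * Multivariate Bernstein approximation by products of binomial laws *)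

Section multi_bernstein.
Variables (R : realType) (n r : nat).
Hypothesis r_gt0 : (0 < r)%N.
Implicit Types u : 'cV[R]_n.

Definition mbern u (j : {ffun 'I_n -> 'I_r.+1}) : R := \prod_k bern (u k 0) r (j k).

Definition in_cube u := forall k, 0 <= u k 0 <= 1.

Definition node (j : {ffun 'I_n -> 'I_r.+1}) : 'cV[R]_n := \col_k ((j k)%:R / r%:R).

Lemma mbern_ge0 u j : in_cube u -> 0 <= mbern u j.
Proof. by move=> cu; apply: prodr_ge0 => k _; exact: bern_ge0. Qed.

Lemma mbern_sum u : \sum_j mbern u j = 1.
Proof.
rewrite /mbern -(bigA_distr_bigA (fun k (i : 'I_r.+1) => bern (u k 0) r i)).
by apply: big1 => k _; exact: bern_sum.
Qed.

(** The summand depends on coordinate [k] only, so by distributivity every other factor sums to 1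
    and the one-dimensional variance remains. *)
Lemma mbern_var u k : in_cube u ->
  \sum_j mbern u j * (node j k 0 - u k 0) ^+ 2 <= r%:R^-1.
Proof.
move=> cu.
pose G (l : 'I_n) (i : 'I_r.+1) := bern (u l 0) r i *
  (if l == k then (i%:R / r%:R - u k 0) ^+ 2 else 1).
rewrite (eq_bigr (fun j : {ffun 'I_n -> 'I_r.+1} => \prod_l G l (j l))); last first.
  move=> j _; rewrite big_split/=; congr (_ * _).
  by rewrite -big_mkcond/= big_pred1_eq mxE.
rewrite -(bigA_distr_bigA G) (bigD1 k)//= [X in _ * X]big1 ?mulr1; last first.
  move=> l /negbTE lk; rewrite /G lk -[RHS](bern_sum (u l 0) r).
  by apply: eq_bigr => i _; rewrite mulr1.
rewrite /G eqxx; exact: bern_var.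
Qed.

(** Chebyshev's argument: nodes within [k] of [u] in each coordinate cost at most [e]. At the others
    [2 * M] is dominated by [2 * M / k ^+ 2] times the squared distance, whose mean is at most
    [n / r]. *)
Lemma mbern_approx u (F : 'cV[R]_n -> R) (M e k : R) : in_cube u ->
  (forall v, `|F v| <= M) -> 0 < k -> 0 <= e ->
  (forall v : 'cV[R]_n, (forall i, `|v i 0 - u i 0| < k) -> `|F u - F v| <= e) ->
  `|F u - \sum_j F (node j) * mbern u j| <=
    e + 2 * M / k ^+ 2 * (n%:R / r%:R).
Proof.
move=> cu FM k0 e0 Fe.
rewrite -[F u in leLHS]mulr1 -(mbern_sum u) mulr_sumr -sumrB.
apply: le_trans (ler_norm_sum _ _ _) _.
have M0 : 0 <= M by apply: le_trans (FM u).
apply: (@le_trans _ _ (\sum_j (e * mbern u j + 2 * M / k ^+ 2 *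
   \sum_i mbern u j * (node j i 0 - u i 0) ^+ 2))).
  apply: ler_sum => j _; rewrite -mulrBl normrM (ger0_norm (mbern_ge0 _ cu)).
  rewrite -mulr_sumr (mulrC (mbern u j) (\sum_i _)) mulrA -mulrDl.
  rewrite ler_wpM2r ?mbern_ge0//.
  have [H|/existsNP[i /negP]] := pselect (forall i, `|node j i 0 - u i 0| < k).
    by apply: le_trans (Fe _ H) _; rewrite lerDl !mulr_ge0 ?invr_ge0 ?exprn_ge0 ?(ltW k0)//
      sumr_ge0// => i _; rewrite sqr_ge0.
  rewrite -leNgt => ki.
  apply: (@le_trans _ _ (2 * M)).
    by rewrite mulr2n mulrDl mul1r; apply: le_trans (ler_normB _ _) _; rewrite lerD.
  apply: ler_wpDl => //.
  rewrite -mulrA ler_peMr ?mulr_ge0//.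
  rewrite -ler_pdivrMl ?invr_gt0 ?exprn_gt0// invrK mulr1.
  rewrite (bigD1 i)//= ler_wpDr//; first by rewrite sumr_ge0// => l _; rewrite sqr_ge0.
  rewrite -[leRHS]real_normK ?num_real//.
  by rewrite lerXn2r ?nnegrE ?(ltW k0).
rewrite big_split/= -!mulr_sumr mbern_sum mulr1 lerD2l.
rewrite ler_wpM2l ?mulr_ge0 ?invr_ge0 ?exprn_ge0 ?(ltW k0)//.
rewrite exchange_big/=.
have -> : n%:R / r%:R = \sum_(i < n) r%:R^-1 :> R by rewrite sumr_const card_ord mulr_natl.
by apply: ler_sum => i _; exact: mbern_var.
Qed.

End multi_bernstein.

Section trig.
Variables (R : realType) (n : nat).

(* The phase [b] encodes both real and imaginary parts of characteristic
   functions, and angle addition makes these sums an algebra. *)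
Inductive trig : ('cV[R]_n -> R) -> Prop :=
| trig_cos a b : trig (fun x => cos (dot a x + b))
| trigD f g : trig f -> trig g -> trig (fun x => f x + g x)
| trigZ c f : trig f -> trig (fun x => c * f x).

Lemma trig_cst c : trig (fun=> c).
Proof.
have -> : (fun=> c) = (fun x : 'cV[R]_n => c * cos (dot 0 x + 0)).
  by apply/funext => x; rewrite dot0l addr0 cos0 mulr1.
exact/trigZ/trig_cos.
Qed.

Lemma trig_sin a b : trig (fun x => sin (dot a x + b)).
Proof.
have -> : (fun x => sin (dot a x + b)) = (fun x => cos (dot a x + (b - pi / 2))).
  by apply/funext => x; rewrite addrA cosBpihalf.
exact: trig_cos.
Qed.

Lemma trigM f g : trig f -> trig g -> trig (fun x => f x * g x).
Proof.
move=> tf tg; elim: tf => [a b|f1 f2 _ t1 _ t2|c f1 _ t1]; last 2 first.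
- under eq_fun do rewrite mulrDl; exact: trigD.
- under eq_fun do rewrite -mulrA; exact: trigZ.
elim: tg => [a' b'|g1 g2 _ t1 _ t2|c g1 _ t1]; last 2 first.
- under eq_fun do rewrite mulrDr; exact: trigD.
- under eq_fun do rewrite mulrCA; exact: trigZ.
have -> : (fun x => cos (dot a x + b) * cos (dot a' x + b')) =
  (fun x => 2^-1 * (cos (dot (a + a') x + (b + b')) + cos (dot (a - a') x + (b - b')))).
  apply/funext => x.
  have -> : dot (a + a') x + (b + b') = (dot a x + b) + (dot a' x + b').
    by rewrite dotDl; ring.
  have -> : dot (a - a') x + (b - b') = (dot a x + b) - (dot a' x + b').
    by rewrite dotDl dotNl; ring.
  by move: (_ + b) (_ + b') => y z; rewrite cosD cosB; field.
by apply: trigZ; apply: trigD; exact: trig_cos.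
Qed.

Lemma trig_sum (I : Type) (s : seq I) (f : I -> 'cV[R]_n -> R) :
  (forall i, trig (f i)) -> trig (fun x => \sum_(i <- s) f i x).
Proof.
move=> tf; elim: s => [|i s IH].
  by under eq_fun do rewrite big_nil; exact: trig_cst.
by under eq_fun do rewrite big_cons; exact: trigD.
Qed.

Lemma trig_prod (I : Type) (s : seq I) (f : I -> 'cV[R]_n -> R) :
  (forall i, trig (f i)) -> trig (fun x => \prod_(i <- s) f i x).
Proof.
move=> tf; elim: s => [|i s IH].
  by under eq_fun do rewrite big_nil; exact: trig_cst.
by under eq_fun do rewrite big_cons; exact: trigM.
Qed.

Lemma trig_bern f r j : trig f -> trig (fun x => bern (f x) r j).
Proof.
move=> tf; elim: r j => [|r IH] j /=; first exact: trig_cst.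
apply: trigD.
  by case: j => [|j]; [exact: trig_cst|exact: trigM].
apply: trigM => //; apply: trigD; first exact: trig_cst.
under eq_fun do rewrite -mulN1r; exact: trigZ.
Qed.

Lemma trig_bounded f : trig f -> exists M, forall x, `|f x| <= M.
Proof.
elim=> [a b|f1 f2 _ [M1 H1] _ [M2 H2]|c g _ [M H]].
- by exists 1 => x; exact: cos_max.
- by exists (M1 + M2) => x; rewrite (le_trans (ler_normD _ _))// lerD.
- by exists (`|c| * M) => x; rewrite normrM ler_wpM2l.
Qed.

End trig.

Section matrix_limits.
Variable R : realType.

Lemma cvg_mx_coord (T : Type) (F : set_system T) (FF : Filter F) m n
    (f : T -> 'M[R]_(m, n)) (l : 'M[R]_(m, n)) :
  (forall i j, f t i j @[t --> F] --> l i j) -> f @ F --> l.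
Proof.
move=> fl; apply/cvg_ballP => e e0.
have H : \forall t \near F, forall p : 'I_m * 'I_n, ball (l p.1 p.2) e (f t p.1 p.2).
  by apply: filter_forall => p; move/cvg_ballP : (fl p.1 p.2); exact.
by apply: filterS H => t H; split=> // i j; exact: (H (i, j)).
Qed.

Lemma cV_compact n (A : 'I_n -> set R) : (forall i, compact (A i)) ->
  compact [set v : 'cV[R]_n | forall i, A i (v i 0)].
Proof.
move=> cA.
have -> : [set v : 'cV[R]_n | forall i, A i (v i 0)] =
    trmx @` [set v : 'rV[R]_n | forall i, A i (v ord0 i)].
  rewrite eqEsubset; split=> [v Av|_ [v Av <-] i]; last by rewrite mxE.
  by exists v^T; [move=> i; rewrite mxE|rewrite trmxK].
apply: continuous_compact; last exact: rV_compact.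
apply: continuous_subspaceT => v; apply: (cvg_mx_coord (nbhs_filter v)) => i j.
under eq_fun do rewrite mxE.
by rewrite mxE; exact: coord_continuous.
Qed.

Lemma dot_deltal n (k : 'I_n) (c : R) (x : 'cV[R]_n) :
  dot (c *: delta_mx k 0) x = c * x k 0.
Proof.
rewrite dotZl /dot (bigD1 k)//= mxE !eqxx mul1r big1 ?addr0// => i ik.
by rewrite mxE (negbTE ik) mul0r.
Qed.

End matrix_limits.

(** * Uniform approximation on balls by globally bounded trigonometric sums *)

Section trig_approx.
Variables (R : realType) (n : nat) (f : 'cV[R]_n.+1 -> R) (M L : R).
Hypotheses (cf : continuous f) (fM : forall x, `|f x| <= M) (L_gt0 : 0 < L).

(** The left inverse, on the ball of radius [L], of the map [U] below, which sends the space into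
    the unit cube by rescaled sines. The scale [2 * L] keeps the arguments of the sine in
    [[-1/2, 1/2]], strictly inside the interval where sine is injective. Bernstein approximation of
    [F] at the point [U x] then gives a trigonometric sum in [x]. *)
Let theta (u : 'cV[R]_n.+1) : 'cV[R]_n.+1 := \col_k (2 * L * asin (2 * u k 0 - 1)).
Let F := f \o theta.
Let s (k : 'I_n.+1) (x : 'cV[R]_n.+1) := sin (dot ((2 * L)^-1 *: delta_mx k 0) x + 0).
Let U x : 'cV[R]_n.+1 := \col_k ((1 + s k x) / 2).

Let s_bound k x : -1 <= s k x <= 1.
Proof. by rewrite sin_geN1 sin_le1. Qed.

Let in_cubeU x : in_cube (U x).
Proof. by move=> k; rewrite mxE; have := s_bound k x; move/andP => []; lra. Qed.

Let trigU k : trig (fun x => U x k 0).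
Proof.
have -> : (fun x => U x k 0) = (fun x => 2^-1 * (1 + s k x)).
  by apply/funext => x; rewrite mxE mulrC.
by apply: trigZ; apply: trigD; [exact: trig_cst|exact: trig_sin].
Qed.

Let half_pihalf (y : R) : `|y| <= 2^-1 -> y \in `[- (pi / 2), pi / 2].
Proof. by have := @pihalf_ge1 R; rewrite ler_norml in_itv/= => p /andP[]; lra. Qed.

Let sin1_bounds : 0 < (sin 2^-1 : R) < 1.
Proof.
have p := @pihalf_ge1 R.
have h : (2^-1 : R) \in `[- (pi / 2), pi / 2] by apply: half_pihalf; rewrite ger0_norm.
have h0 : (0 : R) \in `[- (pi / 2), pi / 2] by apply: half_pihalf; rewrite normr0.
have h1 : (pi / 2 : R) \in `[- (pi / 2), pi / 2] by rewrite in_itv/= lexx; lra.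
rewrite -[X in X < _]sin0 -[X in _ && (_ < X)]sin_pihalf !ltr_sin//.
by apply/andP; split => //; lra.
Qed.

Let arg_bound (x : 'cV[R]_n.+1) k : `|x| <= L -> `|(2 * L)^-1 * x k 0| <= 2^-1.
Proof.
move=> xL; rewrite normrM normfV (@gtr0_norm _ (2 * L)) ?mulr_gt0//.
rewrite ler_pdivrMl ?mulr_gt0// mulrAC divff ?mul1r//.
exact: le_trans (ler_mx_coord _ _ _) xL.
Qed.

Let s_boundL (x : 'cV[R]_n.+1) k : `|x| <= L -> - sin 2^-1 <= s k x <= sin 2^-1.
Proof.
move=> xL; rewrite /s dot_deltal addr0 -sinN.
have B := arg_bound k xL; have Bi := half_pihalf B.
have h : (2^-1 : R) \in `[- (pi / 2), pi / 2] by apply: half_pihalf; rewrite ger0_norm.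
have h' : (- 2^-1 : R) \in `[- (pi / 2), pi / 2].
  by apply: half_pihalf; rewrite normrN ger0_norm.
by move: B; rewrite ler_norml ![sin _ <= _]leNgt !ltr_sin// -!leNgt.
Qed.

Let thetaU (x : 'cV[R]_n.+1) : `|x| <= L -> theta (U x) = x.
Proof.
move=> xL; apply/colP => k; rewrite !mxE.
have -> : 2 * ((1 + s k x) / 2) - 1 = s k x by field.
rewrite /s dot_deltal addr0 sinK; first by rewrite mulVKf// gt_eqF// mulr_gt0.
exact/half_pihalf/arg_bound.
Qed.

Let continuousF (u : 'cV[R]_n.+1) : (forall k, 0 < u k 0 < 1) -> {for u, continuous F}.
Proof.
move=> u01; apply: continuous_comp; last exact: cf.
apply: (cvg_mx_coord (nbhs_filter u)) => i j; under eq_fun do rewrite mxE; rewrite mxE.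
apply: cvgM; first exact: cvg_cst.
apply: (@continuous_comp _ _ _ (fun v : 'cV[R]_n.+1 => 2 * v i 0 - 1) (@asin R)).
  apply: continuousB; last exact: cst_continuous.
  by apply: continuousM; [exact: cst_continuous|exact: coord_continuous].
by apply: continuous_asin; have := u01 i => /andP[]; lra.
Qed.

(** A compact box inside the open cube containing [U x] for [|x| <= L]. It stays away from the faces
    of the cube, so [F] is continuous at each of its points. *)
Let K : set 'cV[R]_n.+1 :=
  [set u : 'cV[R]_n.+1 | forall k,
    `[(1 - sin 2^-1) / 2, (1 + sin 2^-1) / 2]%classic (u k 0)].

(** Uniform continuity by compactness of [K]. The second point [v] is not confined to [K], because
    it will be a Bernstein node anywhere in the cube. *)
Let unif (e : R) : 0 < e -> exists2 k : R, 0 < k & forall u v : 'cV[R]_n.+1, K u ->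
  (forall i, `|v i 0 - u i 0| < k) -> `|F u - F v| <= e.
Proof.
move=> e0.
have cK : compact K.
  apply: (@cV_compact _ _ (fun=> `[(1 - sin 2^-1) / 2, (1 + sin 2^-1) / 2]%classic)).
  by move=> _; exact: segment_compact.
move/compact_near_coveringP : cK => /(_ R 0^'+
  (fun k u => forall v : 'cV[R]_n.+1, (forall i, `|v i 0 - u i 0| < k) -> `|F u - F v| <= e)) [].
  move=> u Ku; have : {for u, continuous F}.
    by apply: continuousF => k; have := Ku k; rewrite /= in_itv/=; have := sin1_bounds; lra.
  move=> /cvgrPdist_lt /(_ _ (divr_gt0 e0 (ltr0Sn _ 1))).
  move=> /nbhs_ballP[r /= r0 ball_r].
  exists (ball u (r / 2), [set k | k < r / 2]) => /=.
    split; first by apply: nbhsx_ballx; rewrite divr_gt0.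
    by apply: nbhs_right_lt; rewrite divr_gt0.
  move=> [u' k] /= [[_ uu'] kr] v vu'.
  have r20 : 0 < r / 2 by rewrite divr_gt0.
  have B1 : `|F u - F u'| < e / 2.
    apply: ball_r; split => // i j; apply: le_ball (uu' i j); lra.
  have B2 : `|F u - F v| < e / 2.
    apply: ball_r; split => // i j; rewrite ord1.
    have := vu' i; have := uu' i 0; rewrite /ball/= => H1 H2.
    have -> : u i 0 - v i 0 = (u i 0 - u' i 0) - (v i 0 - u' i 0) by ring.
    apply: le_lt_trans (ler_normB _ _) _.
    by rewrite [ltRHS]splitr ltrD// (lt_trans H2).
  have -> : F u' - F v = (F u - F v) - (F u - F u') by ring.
  by apply: le_trans (ler_normB _ _) _; rewrite [leRHS]splitr lerD// ltW.
move=> k /= k0 H.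
have k2 : 0 < k / 2 by rewrite divr_gt0.
exists (k / 2) => // u v Ku; apply: (H (k / 2)) => //.
by rewrite /= sub0r normrN gtr0_norm// ltr_pdivrMr// ltr_pMr// ltr1n.
Qed.

(** The bound [|g| <= M] holds on the whole space, since [g x] is a convex combination of values of
    [F]. It is what keeps the contribution of [g] outside the ball under control once the random
    vectors are tight. *)
Lemma trig_approx (e : R) : 0 < e -> exists g, [/\ trig g,
  forall x, `|g x| <= M & forall x, `|x| <= L -> `|f x - g x| <= e].
Proof.
move=> e0; have [k k0 Hk] := unif (divr_gt0 e0 (ltr0Sn _ 1)).
pose C := 2 * M / k ^+ 2 * n.+1%:R.
have M0 : 0 <= M by apply: le_trans (fM 0).
have C0 : 0 <= C by rewrite !mulr_ge0// invr_ge0 exprn_ge0// ltW.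
(* The degree makes the Chebyshev term [C / r] at most [e / 2]. *)
pose r := (Num.truncn (C / (e / 2))).+1.
have r0 : (0 < r)%N by [].
have rC : C / r%:R <= e / 2.
  rewrite ler_pdivrMr ?ltr0n// mulrC -ler_pdivrMr ?divr_gt0//.
  by rewrite ltW// truncnS_gt// divr_ge0// divr_ge0// ltW.
exists (fun x => \sum_(j : {ffun 'I_n.+1 -> 'I_r.+1}) F (node R j) * mbern (U x) j).
have FM v : `|F v| <= M by exact: fM.
split.
- apply: trig_sum => j; apply: trigZ; apply: trig_prod => i.
  exact: trig_bern.
- move=> x; apply: le_trans (ler_norm_sum _ _ _) _.
  rewrite -[leRHS]mulr1 -(mbern_sum r (U x)) mulr_sumr; apply: ler_sum => j _.
  by rewrite normrM [X in _ * X]ger0_norm ?mbern_ge0// ler_wpM2r ?mbern_ge0.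
- move=> x xL; have -> : f x = F (U x) by rewrite /F/= thetaU.
  apply: le_trans (@mbern_approx _ _ r r0 _ F M (e / 2) k (in_cubeU x) FM k0 _ _) _; last first.
  + by rewrite [leRHS]splitr lerD2l mulrA; exact: rC.
  + move=> v vU; apply: Hk => // i; rewrite mxE /= in_itv/=.
    by have := s_boundL i xL; move=> /andP[]; lra.
  + by rewrite divr_ge0// ltW.
Qed.

End trig_approx.

(** * Expectations *)

Section expectation.
Context d (T : measurableType d) (R : realType) (P : probability T R).
Implicit Types (X Y : T -> R) (c : R).

Definition L1 X := P.-integrable setT (EFin \o X).
Definition Ex X : R := \int[P]_w X w.

Lemma L1_measurable X : L1 X -> measurable_fun setT X.
Proof. by move=> /integrableP[/measurable_EFinP]. Qed.

Lemma L1_bounded X (M : R) : measurable_fun setT X -> (forall w, `|X w| <= M) -> L1 X.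
Proof.
move=> mX XM; apply: measurable_bounded_integrable => //.
  by apply: le_lt_trans (probability_le1 P measurableT) _; exact: ltry.
exists M; split; first exact: num_real.
by move=> y My w _; apply: le_trans (XM w) _; exact: ltW.
Qed.

Lemma L1_cst c : L1 (cst c).
Proof. by apply: (@L1_bounded _ `|c|). Qed.

Lemma L1_le X Y : measurable_fun setT X -> (forall w, `|X w| <= Y w) -> L1 Y -> L1 X.
Proof.
move=> mX XY; apply: le_integrable => //; first exact/measurable_EFinP.
by move=> w _; rewrite lee_fin (le_trans (XY w))// ler_norm.
Qed.

Lemma L1D X Y : L1 X -> L1 Y -> L1 (fun w => X w + Y w).
Proof. by move=> iX iY; have := integrableD measurableT iX iY. Qed.

Lemma L1B X Y : L1 X -> L1 Y -> L1 (fun w => X w - Y w).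
Proof. by move=> iX iY; have := integrableB measurableT iX iY. Qed.

Lemma L1Z c X : L1 X -> L1 (fun w => c * X w).
Proof. by move=> iX; have := integrableZl measurableT c iX. Qed.

Lemma L1_norm X : L1 X -> L1 (fun w => `|X w|).
Proof. exact: integrable_norm. Qed.

Lemma L1_sum (I : Type) (s : seq I) (p : pred I) (X : I -> T -> R) :
  (forall i, L1 (X i)) -> L1 (fun w => \sum_(i <- s | p i) X i w).
Proof.
move=> iX; have := @integrable_sum _ _ _ P setT measurableT _ s p
  (fun i => EFin \o X i) (fun i _ => iX i).
apply: eq_integrable => // w _.
by rewrite /= sumEFin.
Qed.

Lemma ExD X Y : L1 X -> L1 Y -> Ex (fun w => X w + Y w) = Ex X + Ex Y.
Proof. by move=> iX iY; rewrite /Ex RintegralD. Qed.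

Lemma ExB X Y : L1 X -> L1 Y -> Ex (fun w => X w - Y w) = Ex X - Ex Y.
Proof. by move=> iX iY; rewrite /Ex RintegralB. Qed.

Lemma ExZ c X : L1 X -> Ex (fun w => c * X w) = c * Ex X.
Proof. by move=> iX; rewrite /Ex RintegralZl. Qed.

Lemma Ex_cst c : Ex (cst c) = c.
Proof. 
rewrite /Ex Rintegral_cst// [X in fine X](_ : _ = 1%E) ?mulr1//.
exact: probability_setT.
Qed.

Lemma Ex_sum (I : Type) (s : seq I) (p : pred I) (X : I -> T -> R) :
  (forall i, L1 (X i)) ->
  Ex (fun w => \sum_(i <- s | p i) X i w) = \sum_(i <- s | p i) Ex (X i).
Proof.
move=> iX; elim: s => [|i s IH].
  by rewrite big_nil -[RHS](Ex_cst 0); congr Ex; apply/funext => w; rewrite big_nil.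
rewrite big_cons -IH; case: ifPn => pi.
  rewrite -ExD//; last exact: L1_sum.
  by congr Ex; apply/funext => w; rewrite big_cons pi.
by congr Ex; apply/funext => w; rewrite big_cons (negbTE pi).
Qed.

Lemma Ex_ge0 X : (forall w, 0 <= X w) -> 0 <= Ex X.
Proof. by move=> X0; apply: Rintegral_ge0. Qed.

Lemma Ex_le X Y : L1 X -> L1 Y -> (forall w, X w <= Y w) -> Ex X <= Ex Y.
Proof. by move=> iX iY XY; apply: le_Rintegral. Qed.

Lemma ler_norm_Ex X : L1 X -> `|Ex X| <= Ex (fun w => `|X w|).
Proof. by move=> iX; apply: le_normr_Rintegral. Qed.

Lemma Ex_bounded X (M : R) : measurable_fun setT X -> (forall w, `|X w| <= M) -> `|Ex X| <= M.
Proof.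
move=> mX XM; have iX := L1_bounded mX XM.
apply: le_trans (ler_norm_Ex iX) _; rewrite -[leRHS]Ex_cst.
by apply: Ex_le => //; [exact: L1_norm|exact: L1_cst].
Qed.

Lemma EFin_Ex X : L1 X -> ((Ex X)%:E = \int[P]_w (X w)%:E)%E.
Proof. by move=> iX; rewrite /Ex /Rintegral fineK//; exact: integrable_fin_num. Qed.

Lemma expectation_Ex X : L1 X -> 'E_P[X]%E = (Ex X)%:E.
Proof. by move=> iX; rewrite EFin_Ex// unlock. Qed.

Lemma measurable_ge X c : measurable_fun setT X -> measurable [set w | c <= X w].
Proof.
move=> mX; rewrite (_ : [set w | _] = setT `&` X @^-1` `[c, +oo[%classic).
  exact: mX.
by apply/seteqP; split => w /=; rewrite in_itv/= andbT//; case.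
Qed.

Lemma measurable_gt X c : measurable_fun setT X -> measurable [set w | c < X w].
Proof.
move=> mX; rewrite (_ : [set w | _] = setT `&` X @^-1` `]c, +oo[%classic).
  exact: mX.
by apply/seteqP; split => w /=; rewrite in_itv/= andbT//; case.
Qed.

Lemma Ex_indic (A : set T) : measurable A -> (Ex (\1_A))%:E = P A.
Proof.
move=> mA; rewrite EFin_Ex; first by rewrite integral_indic// setIT.
by apply: (@L1_bounded _ 1) => [|w]; [exact: measurable_indic|rewrite indicE;
  case: (_ \in _); rewrite ?normr1 ?normr0].
Qed.

Lemma L1_indic (A : set T) : measurable A -> L1 (\1_A).
Proof. by move=> mA; exact: integrable_indic. Qed.

Lemma markov_L1 X (c : R) : 0 < c -> L1 X ->
  (P [set w | (c <= `|X w|)%R] <= (Ex (fun w => `|X w|) / c)%:E)%E.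
Proof.
move=> c0 iX; have mA : measurable [set w | c <= `|X w|].
  by apply: measurable_ge; apply: measurableT_comp => //; exact: L1_measurable.
rewrite -Ex_indic// lee_fin ler_pdivlMr// mulrC -ExZ; last exact: L1_indic.
apply: Ex_le; [exact/L1Z/L1_indic|exact: L1_norm|move=> w].
rewrite indicE; case: (boolP (_ \in _)) => [|_]; last by rewrite mulr0.
by rewrite inE/= mulr1.
Qed.

Lemma probability_fine (A : set T) : measurable A -> P A = (fine (P A))%:E.
Proof. by move=> mA; rewrite fineK// fin_num_measure. Qed.

Lemma measurable_mx_norm m n (X : T -> 'M[R]_(m.+1, n.+1)) :
  (forall i j, measurable_fun setT (fun w => X w i j)) ->
  measurable_fun setT (fun w => `|X w|).
Proof.
move=> mX; rewrite (_ : (fun w => _) = (fun w =>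
    \big[Num.max/0]_(p : 'I_m.+1 * 'I_n.+1) `|X w p.1 p.2|)); last first.
  by apply/funext => w; rewrite [LHS]mx_normrE.
elim: (index_enum _) => [|p s IH].
  by under eq_fun do rewrite big_nil; exact: measurable_cst.
under eq_fun do rewrite big_cons.
by apply: measurable_maxr => //; apply: measurableT_comp.
Qed.

Lemma measurable_cV_norm n (X : T -> 'cV[R]_n.+1) :
  (forall i, measurable_fun setT (fun w => X w i 0)) ->
  measurable_fun setT (fun w => `|X w|).
Proof. by move=> mX; apply: measurable_mx_norm => i j; rewrite ord1. Qed.

Lemma measurable_sumr (I : Type) (s : seq I) (p : pred I) (X : I -> T -> R) :
  (forall i, measurable_fun setT (X i)) ->
  measurable_fun setT (fun w => \sum_(i <- s | p i) X i w).
Proof.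
move=> mX; elim: s => [|i s IH].
  by under eq_fun do rewrite big_nil; exact: measurable_cst.
under eq_fun do rewrite big_cons.
by case: (p i) => //; exact: measurable_funD.
Qed.

Lemma measurable_dot n (X : T -> 'cV[R]_n) (a : 'cV[R]_n) :
  (forall i, measurable_fun setT (fun w => X w i 0)) ->
  measurable_fun setT (fun w => dot a (X w)).
Proof.
by move=> mX; apply: measurable_sumr => i; apply: measurable_funM.
Qed.

Lemma measurable_cosD X (b : R) : measurable_fun setT X ->
  measurable_fun setT (fun w => cos (X w + b)).
Proof.
move=> mX; apply: (@measurableT_comp _ _ _ _ _ _ (@cos R)) => //.
  by apply: continuous_measurable_fun; exact: continuous_cos.
exact: measurable_funD.
Qed.

Lemma measurable_trig n (X : T -> 'cV[R]_n) (g : 'cV[R]_n -> R) : trig g ->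
  (forall i, measurable_fun setT (fun w => X w i 0)) ->
  measurable_fun setT (g \o X).
Proof.
move=> tg mX; elim: tg => [a b|g1 g2 _ m1 _ m2|c g1 _ m1].
- by apply: measurable_cosD; exact: measurable_dot.
- exact: measurable_funD.
- exact: measurable_funM.
Qed.

(** A bounded continuous function is a pointwise limit of trigonometric sums, which are measurable
    as functions of the coordinates. This reaches the sigma-algebra generated by the entries without
    comparing it with open sets. *)
Lemma measurable_continuous_bounded n (X : T -> 'cV[R]_n.+1) (f : 'cV[R]_n.+1 -> R) (M : R) :
  continuous f -> (forall x, `|f x| <= M) ->
  (forall i, measurable_fun setT (fun w => X w i 0)) ->
  measurable_fun setT (f \o X).
Proof.
move=> cf fM mX.
have /choice[g Hg] : forall k : nat, exists g : 'cV[R]_n.+1 -> R, [/\ trig g, forall x, `|g x| <= M &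
    forall x, `|x| <= k.+1%:R -> `|f x - g x| <= k.+1%:R^-1].
  by move=> k; apply: (trig_approx cf fM); rewrite ?invr_gt0 ltr0n.
apply: (@measurable_fun_cvg _ _ _ _ (fun k => g k \o X)).
  by move=> k; apply: measurable_trig => //; case: (Hg k).
move=> w _; apply/cvgrPdist_le => e e0.
have e1 : 0 <= e^-1 by rewrite invr_ge0 ltW.
near=> k; have [_ _ /(_ (X w)) H] := Hg k.
apply: le_trans (H _) _.
  near: k; exists (Num.truncn `|X w|) => // k /= Xk.
  by apply: le_trans (ltW (truncnS_gt _)) _; rewrite ler_nat.
near: k; exists (Num.truncn e^-1) => // k /= ek.
rewrite -[leRHS]invrK lef_pV2 ?posrE ?invr_gt0//.
by apply: le_trans (ltW (truncnS_gt _)) _; rewrite ler_nat.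
Unshelve. all: by end_near. Qed.

End expectation.

(** * Convergence in distribution from characteristic functions *)

Section approximation.
Context d (T : measurableType d) (R : realType) (P : probability T R) (n : nat).
Variable X : T -> 'cV[R]_n.+1.
Hypothesis mX : forall i, measurable_fun setT (fun w => X w i 0).

(** Continuity from above: the events [k + 1 < |X|] decrease to the empty set. *)
Lemma tight1 (e : R) : 0 < e -> exists2 L : R, 0 < L &
  fine (P [set w | L < `|X w|]) <= e.
Proof.
move=> e0; pose F k := [set w | k.+1%:R < `|X w|].
have mF k : measurable (F k) by apply: measurable_gt; exact: measurable_cV_norm.
have F0 : \bigcap_k F k = set0.
  apply/seteqP; split => // w Fw.
  have := Fw (Num.truncn `|X w|) I; rewrite /F/=.
  by move=> /(lt_trans (truncnS_gt _)); rewrite ltxx.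
have := @nonincreasing_cvg_mu _ T R P F; rewrite F0 measure0.
have Foo : (P (F 0%N) < +oo)%E.
  by apply: le_lt_trans (probability_le1 P (mF _)) _; exact: ltry.
have Fni : nonincreasing_seq F.
  move=> i j ij; apply/subsetPset => w; rewrite /F/=; apply: le_lt_trans.
  by rewrite ler_nat.
move=> /(_ Foo mF measurable0 Fni) /fine_cvgP[_] /cvgrPdist_le /(_ _ e0)[k _ /(_ k (leqnn _))].
rewrite sub0r normrN ger0_norm ?fine_ge0// => H.
by exists k.+1%:R.
Qed.

Lemma Ex_approx (f g : 'cV[R]_n.+1 -> R) (M L e : R) :
  measurable_fun setT (f \o X) -> measurable_fun setT (g \o X) ->
  (forall x, `|f x| <= M) -> (forall x, `|g x| <= M) -> 0 <= e ->
  (forall x, `|x| <= L -> `|f x - g x| <= e) ->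
  `|Ex P (f \o X) - Ex P (g \o X)| <= e + 2 * M * fine (P [set w | L < `|X w|]).
Proof.
move=> mf mg fM gM e0 fg.
have mD : measurable [set w | L < `|X w|] by apply: measurable_gt; exact: measurable_cV_norm.
have i_f : L1 P (f \o X) by exact: (L1_bounded P mf (fun w => fM _)).
have i_g : L1 P (g \o X) by exact: (L1_bounded P mg (fun w => gM _)).
have M0 : 0 <= M by apply: le_trans (fM 0).
have iD := L1_indic P mD.
rewrite -ExB// -[fine _]/(fine (P _)).
apply: le_trans (ler_norm_Ex (L1B i_f i_g)) _.
have -> : e + 2 * M * fine (P [set w | L < `|X w|]) =
    Ex P (fun w => e + 2 * M * \1_[set w | L < `|X w|] w).
  have iC := L1Z (2 * M) iD.
  by rewrite (ExD (L1_cst P e) iC) Ex_cst ExZ// -(Ex_indic P mD).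
apply: Ex_le => [|| w].
- exact/L1_norm/L1B.
- by apply: L1D; [exact: L1_cst|exact: L1Z].
- rewrite indicE; case: (boolP (w \in _)) => [_|].
    rewrite mulr1; apply: ler_wpDl => //; rewrite mulrDl mul1r.
    exact: le_trans (ler_normB _ _) (lerD (fM _) (gM _)).
  rewrite notin_setE/= => /negP; rewrite -leNgt => XL.
  by rewrite mulr0 addr0; exact: fg.
Qed.

End approximation.

Section weak_convergence.
Context d d' (T : measurableType d) (T' : measurableType d') (R : realType).
Variables (P : probability T R) (Q : probability T' R) (n : nat).
Variables (X : nat -> T -> 'cV[R]_n.+1) (Z : T' -> 'cV[R]_n.+1).
Hypothesis mX : forall m i, measurable_fun setT (fun w => X m w i 0).
Hypothesis mZ : forall i, measurable_fun setT (fun w => Z w i 0).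
Hypothesis charXZ : forall a b,
  Ex P (fun w => cos (dot a (X m w) + b)) @[m --> \oo] -->
  Ex Q (fun w => cos (dot a (Z w) + b)).
Hypothesis tightX : forall e : R, 0 < e -> exists2 L : R, 0 < L &
  \forall m \near \oo, fine (P [set w | L < `|X m w|]) <= e.

Lemma trig_cvg g : trig g -> Ex P (g \o X m) @[m --> \oo] --> Ex Q (g \o Z).
Proof.
elim=> [a b|g1 g2 t1 c1 t2 c2|c g1 t1 c1]; first exact: charXZ.
- have [M1 b1] := trig_bounded t1; have [M2 b2] := trig_bounded t2.
  have E d1 (T1 : measurableType d1) (P1 : probability T1 R) (Y : T1 -> 'cV[R]_n.+1) :
      (forall i, measurable_fun setT (fun w => Y w i 0)) ->
      Ex P1 ((fun x => g1 x + g2 x) \o Y) = Ex P1 (g1 \o Y) + Ex P1 (g2 \o Y).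
    move=> mY; rewrite -ExD//.
      exact: (L1_bounded P1 (measurable_trig t1 mY) (fun w => b1 _)).
    exact: (L1_bounded P1 (measurable_trig t2 mY) (fun w => b2 _)).
  rewrite E// (_ : (fun m => _) = (fun m => Ex P (g1 \o X m) + Ex P (g2 \o X m))).
    exact: cvgD.
  by apply/funext => m; rewrite E.
- have [M1 b1] := trig_bounded t1.
  have E d1 (T1 : measurableType d1) (P1 : probability T1 R) (Y : T1 -> 'cV[R]_n.+1) :
      (forall i, measurable_fun setT (fun w => Y w i 0)) ->
      Ex P1 ((fun x => c * g1 x) \o Y) = c * Ex P1 (g1 \o Y).
    move=> mY; rewrite -ExZ//.
    exact: (L1_bounded P1 (measurable_trig t1 mY) (fun w => b1 _)).
  rewrite E// (_ : (fun m => _) = (fun m => c * Ex P (g1 \o X m))).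
    by apply: cvgM => //; exact: cvg_cst.
  by apply/funext => m; rewrite E.
Qed.

Lemma cvg_in_distribution_trig : cvg_in_distribution P Q X Z.
Proof.
move=> f cf [M fM].
have M0 : 0 <= M by apply: le_trans (fM 0).
have mf m := measurable_continuous_bounded cf fM (mX m).
have mfZ := measurable_continuous_bounded cf fM mZ.
rewrite (expectation_Ex (L1_bounded Q mfZ (fun w => fM _))).
rewrite (_ : (fun m => _) = (fun m => (Ex P (f \o X m))%:E)); last first.
  by apply/funext => m; rewrite (expectation_Ex (L1_bounded P (mf m) (fun w => fM _))).
apply: cvg_EFin; first by near=> m.
apply/cvgrPdist_le => e e0.
(* Five errors share [e]: the approximation on the ball and the tail outside it, each for [X m] and
   for [Z], and the convergence for the trigonometric sum. A tail costs [2 * M * e']; the added 1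
   covers [M = 0]. *)
pose e' := e / 5 / (2 * M + 1).
have M1 : 0 < 2 * M + 1 by rewrite ltr_wpDl ?mulr_ge0.
have e'0 : 0 < e' by rewrite !divr_gt0.
have e'M : 2 * M * e' <= e / 5.
  rewrite /e' mulrCA -[leRHS]mulr1 ler_pM2l ?divr_gt0//.
  by rewrite ler_pdivrMr// mul1r lerDl.
have e50 : 0 < e / 5 by rewrite divr_gt0.
have [L1 L10 HX] := tightX e'0; have [L2 L20 HZ] := tight1 Q mZ e'0.
pose L := Num.max L1 L2.
have L0 : 0 < L by rewrite lt_max L10.
have [g [tg gM fg]] := trig_approx cf fM L0 e50.
have mg m := measurable_trig tg (mX m); have mgZ := measurable_trig tg mZ.
have HfgZ := Ex_approx Q mZ mfZ mgZ fM gM (ltW e50) fg.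
have tail (d1 : measure_display) (T1 : measurableType d1) (P1 : probability T1 R)
   (X1 : T1 -> 'cV[R]_n.+1) (L' : R) :
   (forall i, measurable_fun setT (fun w => X1 w i 0)) -> L' <= L ->
   fine (P1 [set w | L' < `|X1 w|]) <= e' ->
   2 * M * fine (P1 [set w | L < `|X1 w|]) <= e / 5.
  move=> mX1 LL H; apply: le_trans _ e'M; rewrite ler_wpM2l ?mulr_ge0//.
  apply: le_trans _ H.
  have mA c : measurable [set w | c < `|X1 w|] by apply: measurable_gt; exact: measurable_cV_norm.
  rewrite fine_le ?fin_num_measure// le_measure ?inE//.
  by move=> w /=; exact: le_lt_trans.
have {}HfgZ : `|Ex Q (f \o Z) - Ex Q (g \o Z)| <= e / 5 + e / 5.
  apply: le_trans HfgZ _; rewrite lerD2l (tail _ _ Q Z L2)//.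
  by rewrite le_max lexx orbT.
have gcvg := trig_cvg tg.
near=> m.
have HfgX : `|Ex P (f \o X m) - Ex P (g \o X m)| <= e / 5 + e / 5.
  apply: le_trans (Ex_approx P (mX m) (mf m) (mg m) fM gM (ltW e50) fg) _.
  rewrite lerD2l (tail _ _ P (X m) L1)//; first by rewrite le_max lexx.
  by near: m.
have Hg : `|Ex Q (g \o Z) - Ex P (g \o X m)| <= e / 5.
  by near: m; move/cvgrPdist_le : gcvg; apply.
have -> : Ex Q (f \o Z) - Ex P (f \o X m) = (Ex Q (f \o Z) - Ex Q (g \o Z)) +
  (Ex Q (g \o Z) - Ex P (g \o X m)) - (Ex P (f \o X m) - Ex P (g \o X m)) by ring.
apply: le_trans (ler_normB _ _) _.
have -> : e = (e / 5 + e / 5) + e / 5 + (e / 5 + e / 5) by field.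
by rewrite lerD// (le_trans (ler_normD _ _))// lerD.
Unshelve. all: by end_near. Qed.

End weak_convergence.

(** * Gaussian vectors *)

Section normal_integral.
Variables (R : realType) (m s : R).
Local Notation mu := (@lebesgue_measure R).

(** The Radon-Nikodym derivative of [normal_prob] agrees almost everywhere with [normal_pdf],
    because both have the same integral over every measurable set. *)
Lemma integral_normal_prob (f : R -> \bar R) :
  (normal_prob m s).-integrable setT f ->
  (\int[normal_prob m s]_x f x = \int[mu]_x (f x * (normal_pdf m s x)%:E))%E.
Proof.
move=> intf; have mf := measurable_int _ intf.
have dom := @normal_prob_dominates R m s.
rewrite -(Radon_Nikodym_change_of_variables dom)//=.
apply: ae_eq_integral => //.
- apply: emeasurable_funM => //; apply: (measurable_int mu).
- apply: emeasurable_funM => //=; apply/measurableT_comp => //=.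
  exact: measurable_normal_pdf.
- apply: ae_eqe_mul2l => /=.
  rewrite Radon_NikodymE//=.
  case: cid => /= h [h1 h2 h3].
  apply: integral_ae_eq => //=.
  + by apply/measurableT_comp =>//; exact: measurable_normal_pdf.
  + by move=> E _ mE; rewrite -h3.
Qed.

Lemma Ex_normal_prob (f : R -> R) (M : R) : measurable_fun setT f ->
  (forall x, `|f x| <= M) ->
  Ex (normal_prob m s) f = \int[mu]_x (f x * normal_pdf m s x).
Proof.
move=> mf fM; rewrite /Ex /Rintegral; congr fine.
rewrite integral_normal_prob//.
exact: (L1_bounded (normal_prob m s) mf fM).
Qed.

End normal_integral.

(** * The characteristic function of the centred normal law, by a differential equation *)

Section normal_charfun.
Variables (R : realType) (s : R).
Hypothesis s_neq0 : s != 0.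
Local Notation mu := (@lebesgue_measure R).
Let p : R -> R := normal_pdf 0 s.

Let pE x : p x = normal_peak s * expR (- x ^+ 2 / (s ^+ 2 *+ 2)).
Proof. by rewrite /p normal_pdfE//= /normal_fun subr0. Qed.

Let s2 : 0 < s ^+ 2 *+ 2.
Proof. by rewrite pmulrn_lgt0// exprn_even_gt0. Qed.

Let ip : mu.-integrable setT (EFin \o p).
Proof. exact: integrable_normal_pdf. Qed.

Let mp : measurable_fun setT p.
Proof. exact: measurable_normal_pdf. Qed.

Let p_ge0 x : 0 <= p x.
Proof. exact: normal_pdf_ge0. Qed.

(** The normal density of deviation [2 * s] absorbs the factor [|x|], which makes [|x| * p x]
    integrable. Of the surplus exponent [3 * x ^+ 2 / (8 * s ^+ 2)] only [y] is kept, and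
    [|x| <= (1 + 4 * s ^+ 2) * (1 + y)]. *)
Let xp_bound (x : R) : `|x| * p x <= (1 + s ^+ 2 *+ 4) *
  (normal_peak s / normal_peak (2 * s)) * normal_pdf 0 (2 * s) x.
Proof.
have s20 : 2 * s != 0 by rewrite mulf_neq0.
have pk : 0 < normal_peak s by rewrite normal_peak_gt0.
have pk2 : 0 < normal_peak (2 * s) by rewrite normal_peak_gt0.
rewrite (normal_pdfE _ s20) /normal_fun subr0 pE.
rewrite mulrCA -!mulrA [leRHS]mulrCA ler_pM2l// (mulrA (normal_peak _)^-1) mulVf ?gt_eqF// mul1r.
set y := x ^+ 2 / (s ^+ 2 *+ 4).
have s4 : 0 < s ^+ 2 *+ 4 by rewrite pmulrn_lgt0// exprn_even_gt0.
have -> : - x ^+ 2 / (s ^+ 2 *+ 2) = - (x ^+ 2 / ((2 * s) ^+ 2 *+ 2)) - (y + x ^+ 2 / ((2 * s) ^+ 2 *+ 2)).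
  by rewrite /y; field; rewrite s_neq0.
rewrite mulNr expRD mulrCA mulrC; apply: ler_wpM2r; first exact: expR_ge0.
apply: (@le_trans _ _ (`|x| * expR (- y))).
  rewrite ler_wpM2l// ler_expR lerN2 lerDl divr_ge0 ?sqr_ge0//.
  by rewrite mulrn_wge0// sqr_ge0.
rewrite expRN ler_pdivrMr ?expR_gt0//.
apply: (@le_trans _ _ ((1 + s ^+ 2 *+ 4) * (1 + y))); last first.
  by rewrite ler_wpM2l ?expR_ge1Dx// addr_ge0// ltW.
have -> : (1 + s ^+ 2 *+ 4) * (1 + y) = 1 + s ^+ 2 *+ 4 + y + x ^+ 2.
  by rewrite /y; field; rewrite s_neq0.
have : `|x| <= 1 + x ^+ 2.
  rewrite -[x ^+ 2]real_normK ?num_real//.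
  have := sqr_ge0 (`|x| - 1); rewrite sqrrB1; have := normr_ge0 x; lra.
move=> /le_trans; apply.
have y0 : 0 <= y by rewrite divr_ge0 ?sqr_ge0// ltW.
lra.
Qed.

Let ixp : mu.-integrable setT (EFin \o (fun x => `|x| * p x)).
Proof.
have H := @integrable_normal_pdf R 0 (2 * s).
have := integrableZl measurableT ((1 + s ^+ 2 *+ 4) *
  (normal_peak s / normal_peak (2 * s))) H.
apply: le_integrable => //.
  by apply/measurable_EFinP; apply: measurable_funM.
move=> x _; rewrite lee_fin ger0_norm ?mulr_ge0//.
exact: le_trans (xp_bound x) (ler_norm _).
Qed.

Let dp (x : R) : is_derive x 1 p (- (x / s ^+ 2) * p x).
Proof.
rewrite (_ : p = (fun x => normal_peak s * expR ((- x ^+ 2) * (s ^+ 2 *+ 2)^-1))); last first.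
  by apply/funext => z; rewrite pE.
apply: is_derive_eq; rewrite /GRing.scale/=.
by field; rewrite s_neq0.
Qed.

Variable b : R.

Let f (t x : R) := cos (t * x + b) * p x.

Let mlin t : measurable_fun setT (fun x : R => t * x + b).
Proof. by apply: measurable_funD => //; apply: measurable_funM. Qed.

Let mcos t : measurable_fun setT (fun x : R => cos (t * x + b)).
Proof.
apply: (@measurableT_comp _ _ _ _ _ _ (@cos R)) => //.
by apply: continuous_measurable_fun; exact: continuous_cos.
Qed.

Let msin t : measurable_fun setT (fun x : R => sin (t * x + b)).
Proof.
apply: (@measurableT_comp _ _ _ _ _ _ (@sin R)) => //.
by apply: continuous_measurable_fun; exact: continuous_sin.
Qed.

Let i_f t : mu.-integrable setT (EFin \o f t).
Proof.
apply: le_integrable ip => //.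
  by apply/measurable_EFinP/measurable_funM; [exact: mcos|exact: mp].
move=> x _; rewrite lee_fin normrM ler_piMl//; exact: cos_max.
Qed.

Let K t := \int[mu]_x (x * sin (t * x + b) * p x).

Let iK t : mu.-integrable setT (EFin \o (fun x => x * sin (t * x + b) * p x)).
Proof.
apply: le_integrable ixp => //.
  apply/measurable_EFinP/measurable_funM; last exact: mp.
  by apply: measurable_funM; last exact: msin.
move=> x _; rewrite lee_fin mulrAC normrM [leRHS]normrM !normrM normr_id ler_piMr//.
exact: sin_max.
Qed.

Let F t := \int[mu]_x f t x.

Let df (t x : R) : is_derive t 1 (f ^~ x) (- (x * sin (t * x + b)) * p x).
Proof.
rewrite /f; apply: is_derive_eq; rewrite /GRing.scale/=; ring.
Qed.

Let dF (t : R) : is_derive t 1 F (- K t).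
Proof.
have tI : `]t - 1, t + 1[%classic t by rewrite /= in_itv/=; apply/andP; split; lra.
have d1f t' x : partial1of2 f t' x = - (x * sin (t' * x + b)) * p x.
  by rewrite partial1of2E; apply: derive_val.
have derf (t' x : R) : `]t - 1, t + 1[%classic t' -> setT x -> derivable (f ^~ x) t' 1.
  by move=> _ _; have [] := df t' x.
have bnd (t' x : R) : `]t - 1, t + 1[%classic t' -> setT x -> `|partial1of2 f t' x| <= `|x| * p x.
  move=> _ _; rewrite d1f normrM normrN normrM (ger0_norm (p_ge0 x)).
  by rewrite ler_wpM2r// ler_piMr// sin_max.
have g0 (x : R) : 0 <= `|x| * p x by rewrite mulr_ge0.
have H1 := derivable_under_integral measurableT tI (fun t' _ => i_f t') derf g0 ixp bnd.
have H2 := differentiation_under_integral measurableT tI (fun t' _ => i_f t') derf g0 ixp bnd.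
apply: DeriveDef => //.
rewrite -derive1E H2 /K -[RHS]mulN1r -RintegralZl//.
by apply: eq_Rintegral => x _; rewrite d1f; ring.
Qed.

(** The primitive for integration by parts. As [p' = - x * p / s ^+ 2], its derivative [h t]
    combines the integrands of [K t] and [F t], so a vanishing integral of [h t] ties [K] to [F]. *)
Let H t (x : R) := p x * sin (t * x + b).
Let h t (x : R) := - (s ^- 2) * (x * sin (t * x + b) * p x) + t * f t x.

Let dH (t x : R) : is_derive x 1 (H t) (h t x).
Proof.
rewrite /H /h /f; have dpx := dp x.
by apply: is_derive_eq; rewrite /GRing.scale/=; field.
Qed.

Let ih t : mu.-integrable setT (EFin \o h t).
Proof.
have I1 := integrableZl measurableT (- s ^- 2) (iK t).
have I2 := integrableZl measurableT t (i_f t).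
by have := integrableD measurableT I1 I2.
Qed.

Let int_h t : \int[mu]_x h t x = - (s ^- 2) * K t + t * F t.
Proof.
rewrite /h RintegralD//; last 2 first.
- by have := integrableZl measurableT (- s ^- 2) (iK t).
- by have := integrableZl measurableT t (i_f t).
by rewrite !RintegralZl.
Qed.

Let p_cvg0 : p k.+1%:R @[k --> \oo] --> 0.
Proof.
apply/cvgrPdist_le => e e0; near=> k.
rewrite sub0r normrN ger0_norm// pE mulNr expRN.
have pk : 0 < normal_peak s by rewrite normal_peak_gt0.
rewrite ler_pdivrMr ?expR_gt0//.
apply: (@le_trans _ _ (e * (1 + k.+1%:R ^+ 2 / (s ^+ 2 *+ 2)))); last first.
  by rewrite ler_pM2l// expR_ge1Dx.
apply: (@le_trans _ _ (e * (k%:R / (s ^+ 2 *+ 2)))); last first.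
  rewrite ler_pM2l// ler_wpDl// ler_pM2r ?invr_gt0// -natrX ler_nat.
  by rewrite (leq_trans (leqnSn k))// -[X in (X <= _)%N]expn1 leq_pexp2l.
rewrite mulrA ler_pdivlMr// (mulrC e) -ler_pdivrMr//.
rewrite ltW//; near: k.
exists (Num.truncn (normal_peak s * (s ^+ 2 *+ 2) / e)).+1 => // k /= Hk.
by apply: lt_le_trans (truncnS_gt _) _; rewrite ler_nat.
Unshelve. all: by end_near. Qed.

(** On growing symmetric intervals the fundamental theorem of calculus leaves boundary terms of size
    at most [p k.+1%:R], which tend to 0; dominated convergence identifies the limit with the
    integral over the line. *)
Let int_h0 t : \int[mu]_x h t x = 0.
Proof.
have mh : measurable_fun setT (h t) by apply/measurable_EFinP; have /integrableP[] := ih t.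
pose I k := `[- k.+1%:R, k.+1%:R]%classic : set R.
have FTC k : \int[mu]_(x in I k) h t x = H t k.+1%:R - H t (- k.+1%:R).
  have cH x : {for x, continuous (H t)}.
    apply: differentiable_continuous; apply/derivable1_diffP.
    by have [] := dH t x.
  have ch : continuous (h t).
    move=> x; have dpx := dp x.
    apply: differentiable_continuous; apply/derivable1_diffP.
    by rewrite /h /f; apply: ex_derive.
  rewrite /Rintegral (@continuous_FTC2 _ (h t) (H t)).
  - by rewrite -EFinB.
  - by rewrite -subr_gt0 opprK addr_gt0.
  - exact: continuous_subspaceT.
  - split=> [x _||]; first by have [] := dH t x.
    + by apply: cvg_at_right_filter; exact: cH.
    + by apply: cvg_at_left_filter; exact: cH.
  - by move=> x _; rewrite derive1E; apply: derive_val.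
have L1 : \int[mu]_(x in I k) h t x @[k --> \oo] --> 0.
  under eq_fun do rewrite FTC.
  apply/cvgr0Pnorm_le => e e0.
  have e2 : 0 < e / 2 by rewrite divr_gt0.
  near=> k.
  have pk : p k.+1%:R <= e / 2.
    near: k; move/cvgrPdist_le : p_cvg0 => /(_ _ e2); apply: filterS => k.
    by rewrite sub0r normrN ger0_norm.
  have pkN : p (- k.+1%:R) = p k.+1%:R by rewrite !pE sqrrN.
  apply: le_trans (ler_normB _ _) _.
  rewrite /H !normrM pkN ger0_norm// [leRHS]splitr lerD//.
    by apply: le_trans pk; rewrite ler_piMr// sin_max.
  by apply: le_trans pk; rewrite ler_piMr// sin_max.
have L2 : \int[mu]_(x in I k) h t x @[k --> \oo] --> \int[mu]_x h t x.
  have mI k : measurable (I k) by exact: measurable_itv.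
  have [] := @dominated_convergence _ _ _ mu setT measurableT
    (fun k => (EFin \o h t) \_ (I k)) (EFin \o h t) (fun x => `|h t x|%:E).
  - move=> k; apply/(measurable_restrictT _ (mI k)).
    by apply/measurable_EFinP; exact: measurable_funTS.
  - exact/measurable_EFinP.
  - apply/aeW => x _; apply: cvg_near_cst.
    exists (Num.truncn `|x|) => // k /= xk.
    rewrite patchE ifT// inE /I/= in_itv/= -ler_norml.
    by apply: le_trans (ltW (truncnS_gt _)) _; rewrite ler_nat.
  - exact: (integrable_norm (ih t)).
  - apply/aeW => x k _; rewrite patchE; case: ifP => // _.
    by rewrite abse0 lee_fin.
  move=> _ _; rewrite -(fineK (integrable_fin_num measurableT (ih t))) => /fine_cvg.
  apply: cvg_trans; apply: near_eq_cvg; apply: nearW => k.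
  by rewrite /Rintegral/= [in RHS]integral_mkcond.
by rewrite -(cvg_lim _ L2)// (cvg_lim _ L1).
Unshelve. all: by end_near. Qed.

(** Differentiation under the integral gives [F' = - K], and integration by parts gives
    [K t = s ^+ 2 * t * F t]. The resulting linear equation is solved with an integrating factor and
    the initial value [F 0 = cos b]. *)
Lemma normal_charfun (t : R) :
  Ex (normal_prob 0 s) (fun x => cos (t * x + b)) =
  cos b * expR (- (s * t) ^+ 2 / 2).
Proof.
rewrite (@Ex_normal_prob _ _ _ _ 1) ?mcos//; last by move=> x; exact: cos_max.
have KE u : K u = s ^+ 2 * u * F u.
  have := int_h u; rewrite int_h0 => E.
  apply: (mulfI (_ : s ^- 2 != 0)); first by rewrite invr_neq0// expf_neq0.
  have -> : s ^- 2 * K u = u * F u by move: E; rewrite mulNr; lra.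
  by field.
pose g u := F u * expR ((s * u) ^+ 2 / 2).
have dg (u : R) : is_derive u 1 g 0.
  rewrite /g; have dFu := dF u.
  by apply: is_derive_eq; rewrite /GRing.scale/= KE; field.
have g0 : g t = g 0 by apply: is_derive_0_is_cst.
have F0 : F 0 = cos b.
  rewrite /F /f -[RHS]mulr1.
  under eq_Rintegral do rewrite mul0r add0r.
  rewrite RintegralZl//; congr (_ * _).
  by rewrite /Rintegral integral_normal_pdf.
rewrite -/(F t) -F0 mulNr expRN -[RHS]/(F 0 / _).
apply: (mulIf (_ : expR ((s * t) ^+ 2 / 2) != 0)); first by rewrite gt_eqF// expR_gt0.
rewrite -/(g t) g0 /g mulr0 expr0n/= mul0r expR0 mulr1 divfK//.
by rewrite gt_eqF// expR_gt0.
Qed.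

End normal_charfun.

Section matrix_measurability.
Context d (T : measurableType d) (R : realType) (m n : nat).

Lemma measurable_coord i j :
  measurable_fun setT (fun M : 'M[R]_(m, n) => M i j).
Proof.
move=> _ A mA; apply: sub_sigma_algebra; exists (i, j) => //.
by exists A.
Qed.

Lemma measurable_mx (X : T -> 'M[R]_(m, n)) :
  (forall i j, measurable_fun setT (fun w => X w i j)) -> measurable_fun setT X.
Proof.
move=> mX; apply: (@measurability _ _ _ _ _ _ (@matrix_cylinders R m n)) => //.
move=> _ [_ [[i j] _ [A mA <-]] <-] /=.
by have := mX i j measurableT A mA; rewrite !setTI.
Qed.

Lemma measurable_mx_coord (X : T -> 'M[R]_(m, n)) i j :
  measurable_fun setT X -> measurable_fun setT (fun w => X w i j).
Proof. by move=> mX; apply: (measurableT_comp (measurable_coord i j)). Qed.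

End matrix_measurability.

Section product_expectation.
Context d1 d2 (T1 : measurableType d1) (T2 : measurableType d2) (R : realType).
Variables (P1 : probability T1 R) (P2 : probability T2 R).

Definition prodP : probability (T1 * T2)%type R := (P1 \x P2)%E.

Lemma Ex_prod (F : T1 * T2 -> R) (M : R) : measurable_fun setT F ->
  (forall w, `|F w| <= M) ->
  Ex prodP F = Ex P1 (fun x => Ex P2 (fun y => F (x, y))).
Proof.
move=> mF FM; have iF := L1_bounded prodP mF FM.
rewrite /Ex /Rintegral -(@integral12_prod_meas1 _ _ _ _ _ P1 P2)//.
congr fine; apply: eq_integral => x _.
rewrite /fubini_F fineK//; apply: integrable_fin_num => //.
apply: (@L1_bounded _ _ _ P2 _ M) => //.
by apply: measurableT_comp => //; exact: measurable_pair1.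
Qed.

End product_expectation.

Section charfun_law.
Context d d' (T : measurableType d) (T' : measurableType d') (R : realType).
Variables (P : probability T R) (Q : probability T' R).

(** Uniqueness of a law given its characteristic function, obtained from the convergence theorem
    applied to a constant sequence. Bounded continuous functions then have equal expectations, ramps
    pass to closed half-lines, and these form a generating family stable under intersection. *)
Lemma charfun_law (X : T -> R) (Y : T' -> R) :
  measurable_fun setT X -> measurable_fun setT Y ->
  (forall t b, Ex P (fun w => cos (t * X w + b)) = Ex Q (fun w => cos (t * Y w + b))) ->
  forall B, measurable B -> P (X @^-1` B) = Q (Y @^-1` B).
Proof.
move=> mX mY XY.
pose V (S : Type) (W : S -> R) w : 'cV[R]_1 := \col_(_ < 1) W w.
have dotV S (W : S -> R) a w : dot a (V S W w) = a 0 0 * W w.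
  by rewrite /dot big_ord1 mxE.
have mV e (S : measurableType e) (W : S -> R) : measurable_fun setT W ->
    forall i : 'I_1, measurable_fun setT (fun w => V S W w i 0).
  by move=> mW i; under eq_fun do rewrite mxE.
have W : cvg_in_distribution P Q (fun _ : nat => V T X) (V T' Y).
  apply: cvg_in_distribution_trig => [_||a b|e e0].
  - exact: mV.
  - exact: mV.
  - rewrite (_ : Ex Q _ = Ex P (fun w => cos (dot a (V T X w) + b))).
      exact: cvg_cst.
    rewrite (_ : (fun w => cos _) = (fun w => cos (a 0 0 * Y w + b))).
      by rewrite -XY; congr Ex; apply/funext => w; rewrite dotV.
    by apply/funext => w; rewrite dotV.
  - have [L L0 HL] := tight1 P (mV _ _ _ mX) e0.
    by exists L => //; near=> m.
have EXY f : continuous f -> (forall v, `|f v| <= 1) ->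
    Ex P (f \o V T X) = Ex Q (f \o V T' Y).
  move=> cf f1; have mfX := measurable_continuous_bounded cf f1 (mV _ _ _ mX).
  have mfY := measurable_continuous_bounded cf f1 (mV _ _ _ mY).
  have := W f cf (ex_intro _ 1 f1).
  rewrite (expectation_Ex (L1_bounded P mfX (fun w => f1 _))).
  rewrite (expectation_Ex (L1_bounded Q mfY (fun w => f1 _))) => H.
  apply: EFin_inj; rewrite -(cvg_lim _ H)//; apply/esym/cvg_lim => //.
  exact: cvg_cst.
(* A ramp of slope [k] equal to 1 on [[a, +oo[]; for [k > 0] it is 0 below [a - 1/k], so these
   functions decrease to the indicator of the closed half-line. *)
pose f (a : R) (k : nat) (v : 'cV[R]_1) : R :=
  Num.max 0 (Num.min 1 (1 + k%:R * (v 0 0 - a))).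
have cf a k : continuous (f a k).
  have c1 (v : 'cV[R]_1) :
      (1 + k%:R * (z 0 0 - a) : R^o) @[z --> v] --> (1 + k%:R * (v 0 0 - a) : R^o).
    apply: cvgD; first exact: cvg_cst.
    apply: cvgM; first exact: cvg_cst.
    by apply: cvgB; [exact: coord_continuous|exact: cvg_cst].
  move=> v; have c2 := continuous_min (@cst_continuous _ R^o 1 v) (c1 v).
  exact: (continuous_max (@cst_continuous _ R^o 0 v) c2).
have f1 a k v : `|f a k v| <= 1.
  rewrite ger0_norm ?le_max ?lexx// /f ge_max ler01/=.
  by rewrite ge_min lexx.
have ray e (S : measurableType e) (P1 : probability S R) (W1 : S -> R) (a : R) :
    measurable_fun setT W1 ->
    Ex P1 (f a k \o V S W1) @[k --> \oo] --> fine (P1 (W1 @^-1` `[a, +oo[)).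
  move=> mW1; pose A := W1 @^-1` `[a, +oo[.
  have mA : measurable A by rewrite /A -[X in measurable X]setTI; exact: mW1.
  have mfk k := measurable_continuous_bounded (cf a k) (f1 a k) (mV _ _ _ mW1).
  have [] := @dominated_convergence _ _ _ P1 setT measurableT
    (fun k => EFin \o (f a k \o V S W1)) (EFin \o \1_A) (cst 1%:E).
  - by move=> k; apply/measurable_EFinP.
  - by apply/measurable_EFinP.
  - apply/aeW => w _; apply: cvg_near_cst.
    have [aw|wa] := leP a (W1 w).
      apply: nearW => k; rewrite /= indicE mem_set /A/= ?in_itv/= ?aw//.
      rewrite /f mxE min_l ?max_r//.
      by rewrite lerDl mulr_ge0// subr_ge0.
    have aw0 : 0 < a - W1 w by rewrite subr_gt0.
    exists (Num.truncn (a - W1 w)^-1).+1 => // k /= Hk.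
    rewrite indicE memNset /A/= ?in_itv/= ?andbT ?leNgt ?wa//.
    rewrite /f mxE max_l// ge_min; apply/orP; right.
    have : 1 <= k%:R * (a - W1 w).
      rewrite -ler_pdivrMr// div1r; apply/ltW/(lt_le_trans (truncnS_gt _)).
      by rewrite ler_nat.
    by rewrite -opprB mulrN; lra.
  - exact: (L1_cst P1 1).
  - by apply/aeW => w k _; rewrite lee_fin; exact: f1.
  move=> _ _; rewrite -[X in _ --> X]/(\int[P1]_x (\1_A x)%:E)%E integral_indic// setIT.
  by rewrite [X in _ --> X](probability_fine P1 mA) => /fine_cvg.
have rayE a : P (X @^-1` `[a, +oo[) = Q (Y @^-1` `[a, +oo[).
  have mXa : measurable (X @^-1` `[a, +oo[) by rewrite -[X in measurable X]setTI; exact: mX.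
  have mYa : measurable (Y @^-1` `[a, +oo[) by rewrite -[X in measurable X]setTI; exact: mY.
  rewrite (probability_fine P mXa) (probability_fine Q mYa); congr (_%:E).
  have H1 := ray _ _ P X a mX; have H2 := ray _ _ Q Y a mY.
  rewrite -(cvg_lim _ H1)//.
  rewrite (_ : (fun k => _) = (fun k => Ex Q (f a k \o V T' Y))) ?(cvg_lim _ H2)//.
  by apply/funext => k; exact: EXY.
move=> B mB; 
pose X' : {RV P >-> R} := mfun_Sub (mem_set mX).
pose Y' : {RV Q >-> R} := mfun_Sub (mem_set mY).
rewrite -[LHS]/(distribution P X' B) -[RHS]/(distribution Q Y' B).
apply: (measure_unique (@RGenCInfty.G R) (fun k => `[- k%:R, +oo[%classic)) => //.
- exact: RGenCInfty.measurableE.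
- move=> _ _ [x ->] [y ->]; exists (Num.max x y).
  by apply/seteqP; split => z; rewrite /= !in_itv/= !andbT ge_max => /andP.
- by move=> k; exists (- k%:R).
- apply/seteqP; split => // z _; exists (Num.truncn `|z|).+1 => //.
  rewrite /= in_itv/= andbT lerNl.
  by apply: le_trans (ltW (truncnS_gt _)); rewrite -normrN ler_norm.
- by move=> _ [x ->]; exact: rayE.
- by move=> k; apply: le_lt_trans (probability_le1 _ _) _; [exact: measurable_itv|exact: ltry].
Unshelve. all: by end_near. Qed.

End charfun_law.

Section gaussian_existence.
Variable R : realType.

(** The vector is a sum of the [v] in [vs] weighted by independent standard normal variables. Each
    one is adjoined by a product with the real line, which multiplies the characteristic function by
    [expR (- dot a v ^+ 2 / 2)]. *)
Lemma gaussian_charfun_exists n (vs : seq 'cV[R]_n) :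
  exists (d' : measure_display) (T' : measurableType d') (Q : probability T' R)
    (Z : T' -> 'cV[R]_n), (forall i, measurable_fun setT (fun w => Z w i 0)) /\
    forall a b, Ex Q (fun w => cos (dot a (Z w) + b)) =
      cos b * expR (- (\sum_(v <- vs) dot a v ^+ 2) / 2).
Proof.
pose N : probability (measurableTypeR R) R := normal_prob 0 1.
elim: vs => [|v vs [d' [T' [Q [Z [mZ EZ]]]]]].
  exists _, _, N, (fun=> 0); split.
    by move=> i; under eq_fun do rewrite mxE; exact: measurable_cst.
  move=> a b; rewrite big_nil oppr0 mul0r expR0 mulr1 -[RHS](Ex_cst N).
  by congr Ex; apply/funext => w; rewrite dot0r add0r.
exists _, _, (prodP Q N), (fun w => Z w.1 + w.2 *: v).
have mZ' i : measurable_fun setT (fun w : T' * measurableTypeR R => (Z w.1 + w.2 *: v) i 0).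
  under eq_fun do rewrite !mxE; apply: measurable_funD; last exact: measurable_funM.
  by apply: (measurableT_comp (mZ i)); exact: measurable_fst.
split=> // a b.
rewrite (@Ex_prod _ _ _ _ _ _ _ _ 1); last 2 first.
- by apply: measurable_cosD; exact: measurable_dot.
- by move=> w; exact: cos_max.
have s1 : (1 : R) != 0 by [].
rewrite (_ : (fun x => _) = (fun x => expR (- (dot a v ^+ 2) / 2) * cos (dot a (Z x) + b))).
  rewrite ExZ; last first.
    apply: (@L1_bounded _ _ _ _ _ 1); last by move=> w; exact: cos_max.
    by apply: measurable_cosD; exact: measurable_dot.
  rewrite EZ big_cons mulrCA -expRD; congr (_ * expR _); by field.
apply/funext => x; rewrite mulrC -[dot a v]mul1r -(normal_charfun s1).
congr Ex; apply/funext => y; congr cos; rewrite /= dotDr dotZr; ring.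
Qed.

Lemma multivariate_normal_exists n (vs : seq 'cV[R]_n) (S : 'M[R]_n) :
  (forall a, (a^T *m S *m a) 0 0 = \sum_(v <- vs) dot a v ^+ 2) ->
  exists (d' : measure_display) (T' : measurableType d') (Q : probability T' R)
    (Z : {RV Q >-> 'cV[R]_n}), multivariate_normal Z 0 S /\
    forall a b, Ex Q (fun w => cos (dot a (Z w) + b)) =
      cos b * expR (- (\sum_(v <- vs) dot a v ^+ 2) / 2).
Proof.
move=> SE; have [d' [T' [Q [Z [mZ EZ]]]]] := gaussian_charfun_exists vs.
have mZ' : measurable_fun setT Z by apply: measurable_mx => i j; rewrite ord1.
exists d', T', Q, (mfun_Sub (mem_set mZ')); split; last exact: EZ.
move=> a B mB; rewrite SE mulmx0 mxE /normal_law.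
set V := \sum_(v <- vs) _.
have maZ : measurable_fun setT (fun w => dot a (Z w)) by exact: measurable_dot.
pose X : {RV Q >-> R} := mfun_Sub (mem_set maZ).
have V0 : 0 <= V by apply: sumr_ge0 => v _; exact: sqr_ge0.
have EX t b : Ex Q (fun w => cos (t * X w + b)) = cos b * expR (- (t ^+ 2 * V) / 2).
  rewrite (_ : (fun w => _) = (fun w => cos (dot (t *: a) (Z w) + b))).
    rewrite EZ (_ : \sum_(v <- vs) _ = t ^+ 2 * V)// mulr_sumr.
    by apply: eq_bigr => v _; rewrite dotZl exprMn.
  by apply/funext => w; rewrite dotZl.
have -> : [set w | B ((a^T *m (mfun_Sub (mem_set mZ')) w) 0 0)] = X @^-1` B.
  by apply/seteqP; split => w /=; rewrite dotE.
(* [normal_law] is a Dirac mass at variance 0, so the degenerate direction is compared with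
   [dirac 0] and the others with [normal_prob]. *)
case: eqVneq => V0'.
  apply: (@charfun_law _ _ _ _ _ Q (dirac (0 : measurableTypeR R)) X id) => // t b.
   rewrite EX V0' mulr0 oppr0 mul0r expR0 mulr1.
  rewrite /Ex /Rintegral integral_dirac//=; last first.
    apply/measurable_EFinP/measurable_cosD.
    exact: measurable_funM.
  by rewrite indicE mem_set// mul1r mulr0 add0r.
have s0 : Num.sqrt V != 0 by rewrite sqrtr_eq0 -ltNge lt0r V0'.
pose N : probability (measurableTypeR R) R := normal_prob 0 (Num.sqrt V).
apply: (@charfun_law _ _ _ _ _ Q N X id) => // t b.
rewrite EX (normal_charfun s0) exprMn sqr_sqrtr//.
by rewrite (mulrC V).
Qed.

End gaussian_existence.

(** * Quadratic forms *)

Section quadratic_forms.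
Variable R : realType.

Definition qform n (S : 'M[R]_n) (a b : 'cV[R]_n) : R := dot a (S *m b).

Lemma qformE n (S : 'M[R]_n) a b : (a^T *m S *m b) 0 0 = qform S a b.
Proof. by rewrite -mulmxA dotE. Qed.

Lemma qformDl n (S : 'M[R]_n) a b c : qform S (a + b) c = qform S a c + qform S b c.
Proof. exact: dotDl. Qed.

Lemma qformDr n (S : 'M[R]_n) a b c : qform S a (b + c) = qform S a b + qform S a c.
Proof. by rewrite /qform mulmxDr dotDr. Qed.

Lemma qformZl n (S : 'M[R]_n) c a b : qform S (c *: a) b = c * qform S a b.
Proof. exact: dotZl. Qed.

Lemma qformZr n (S : 'M[R]_n) c a b : qform S a (c *: b) = c * qform S a b.
Proof. by rewrite /qform -scalemxAr dotZr. Qed.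

Lemma qform_sym n (S : 'M[R]_n) a b : S^T = S -> qform S a b = qform S b a.
Proof.
move=> ST; rewrite -!qformE.
have -> : a^T *m S *m b = (b^T *m S *m a)^T by rewrite !trmx_mul trmxK ST mulmxA.
by rewrite mxE.
Qed.

Lemma qform_mxB n (S S' : 'M[R]_n) a b : qform (S - S') a b = qform S a b - qform S' a b.
Proof. by rewrite /qform mulmxBl dotDr dotNr. Qed.

Lemma qform_delta n (S : 'M[R]_n) i j : qform S (delta_mx i 0) (delta_mx j 0) = S i j.
Proof.
rewrite /qform -[X in dot X _]scale1r dot_deltal mul1r -colE mxE.
by [].
Qed.

Lemma qform_sum n (S : 'M[R]_n) a b :
  qform S a b = \sum_i \sum_j a i 0 * S i j * b j 0.
Proof.
apply: eq_bigr => i _; rewrite mxE mulr_sumr.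
by apply: eq_bigr => j _; rewrite mulrA.
Qed.

Lemma ler_norm_qform n (S : 'M[R]_n.+1) a b :
  `|qform S a b| <= n.+1%:R ^+ 2 * `|S| * (`|a| * `|b|).
Proof.
rewrite qform_sum; apply: le_trans (ler_norm_sum _ _ _) _.
have -> : n.+1%:R ^+ 2 * `|S| * (`|a| * `|b|) =
    \sum_(i < n.+1) \sum_(j < n.+1) (`|a| * `|S| * `|b|).
  rewrite !sumr_const card_ord -mulrnA -(mulr_natr _ (n.+1 * n.+1)) natrM; move: n.+1%:R `|S| `|a| `|b| => x y z t; ring.
apply: ler_sum => i _; apply: le_trans (ler_norm_sum _ _ _) _.
apply: ler_sum => j _; rewrite !normrM.
by rewrite !ler_pM ?mulr_ge0// ler_mx_coord.
Qed.

Definition psd n (S : 'M[R]_n) := S^T = S /\ forall a, 0 <= qform S a a.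

Lemma psd_row0 n (S : 'M[R]_n) p : psd S -> S p p = 0 -> forall j, S p j = 0.
Proof.
move=> [ST S0] Spp j.
have H t : 0 <= S j j + 2 * t * S p j.
  have := S0 (delta_mx j 0 + t *: delta_mx p 0).
  rewrite !(qformDl, qformDr, qformZl, qformZr) !qform_delta Spp.
  have -> : S j p = S p j by rewrite -{1}ST mxE.
  by move=> /le_trans; apply; rewrite le_eqVlt; apply/orP; left; apply/eqP; ring.
have [//|Spj] := eqVneq (S p j) 0.
(* The form at [e_j + t * e_p] is affine in [t] when the diagonal entry [S p p] vanishes; this [t]
   would give it the value -1. *)
have := H (- (S j j + 1) / (2 * S p j)).
have -> : 2 * (- (S j j + 1) / (2 * S p j)) * S p j = - (S j j + 1) by field.
by lra.
Qed.

(** Symmetric Gaussian elimination, as in a Cholesky factorization. The induction is on the number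
    [k] of final rows that may still be nonzero; each step removes one square and clears row
    [n - k.+1]. *)
Lemma psd_sum_squares n (S : 'M[R]_n) : psd S ->
  exists vs : seq 'cV[R]_n, forall a, qform S a a = \sum_(v <- vs) dot a v ^+ 2.
Proof.
suff H : forall k (S : 'M[R]_n), psd S ->
    (forall i j : 'I_n, (i + k < n)%N -> S i j = 0) ->
    exists vs : seq 'cV[R]_n, forall a, qform S a a = \sum_(v <- vs) dot a v ^+ 2.
  move=> pS; apply: (H n S pS) => i j.
  by rewrite ltnNge leq_addl.
elim=> [|k IH] {}S pS rows.
  exists [::] => a; rewrite big_nil qform_sum big1// => i _; rewrite big1// => j _.
  by rewrite rows ?addn0// mulr0 mul0r.
have [kn|nk] := ltnP k n; last first.
  by apply: IH => // i j; rewrite ltnNge (leq_trans nk)// leq_addl.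
have pn : (n - k.+1 < n)%N by rewrite ltn_subrL (leq_ltn_trans _ kn).
pose p := Ordinal pn.
have [ST S0] := pS.
have rows' (S' : 'M[R]_n) : (forall i j : 'I_n, (i + k.+1 < n)%N -> S' i j = 0) ->
    (forall j, S' p j = 0) -> forall i j : 'I_n, (i + k < n)%N -> S' i j = 0.
  move=> H1 H2 i j; rewrite leq_eqVlt => /orP[/eqP ik|]; last by rewrite -addnS; exact: H1.
  suff -> : i = p by [].
  by apply/val_inj/eqP; rewrite /= -(eqn_add2r k.+1) addnS ik subnK.
have [c0|c0] := eqVneq (S p p) 0.
  by apply: IH => //; apply: rows' => //; exact: psd_row0.
have Sc : 0 < S p p by rewrite lt0r c0 -qform_delta S0.
(* Subtracting [v *m v^T] leaves the Schur complement of the pivot: row [p] vanishes and the rows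
   already cleared stay zero. *)
pose v := (Num.sqrt (S p p))^-1 *: col p S.
have sq : Num.sqrt (S p p) != 0 by rewrite gt_eqF// sqrtr_gt0.
have sqE : (Num.sqrt (S p p))^-1 ^+ 2 = (S p p)^-1 by rewrite exprVn sqr_sqrtr// ltW.
have dv a : dot a v = (Num.sqrt (S p p))^-1 * qform S a (delta_mx p 0).
  by rewrite /v dotZr colE.
have [|i j ij|vs Hvs] := IH (S - v *m v^T).
- split.
    by rewrite raddfB/= trmx_mul trmxK ST.
  move=> a; rewrite qform_mxB.
  have -> : qform (v *m v^T) a a = dot a v ^+ 2.
    rewrite -qformE !mulmxA -mulmxA mxE big_ord1 dotE expr2; congr (_ * _).
    by rewrite dotE dotC.
  rewrite dv exprMn sqE.
  set b := qform S a (delta_mx p 0).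
  (* The shift minimizes the form along the direction [p], and the minimum is exactly the value of
     the Schur complement at [a]. *)
  have := S0 (a + (- b / S p p) *: delta_mx p 0).
  rewrite !(qformDl, qformDr, qformZl, qformZr) qform_delta -/b.
  rewrite (qform_sym (delta_mx p 0) a ST) -/b => /le_trans; apply.
  by rewrite le_eqVlt; apply/orP; left; apply/eqP; field.
- apply: (rows') ij => [{}i {}j ij|{}j].
    rewrite !mxE big_ord1 !mxE (rows i j ij) (rows i p ij).
    by rewrite mulr0 mul0r subr0.
  rewrite !mxE big_ord1 !mxE.
  have -> : S j p = S p j by rewrite -{1}ST mxE.
  by rewrite mulrACA -expr2 sqE mulrA mulVf// mul1r subrr.
- exists (v :: vs) => a; rewrite big_cons -Hvs qform_mxB.
  have -> : qform (v *m v^T) a a = dot a v ^+ 2.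
    rewrite -qformE !mulmxA -mulmxA mxE big_ord1 dotE expr2; congr (_ * _).
    by rewrite dotE dotC.
  by rewrite addrC subrK.
Qed.

Lemma positive_definite_qform n (S : 'M[R]_n) :
  positive_definite S <-> S^T = S /\ forall a, a != 0 -> 0 < qform S a a.
Proof.
by split=> -[ST H]; split => // a /H; rewrite qformE.
Qed.

Lemma positive_definite_psd n (S : 'M[R]_n) : positive_definite S -> psd S.
Proof.
move=> /positive_definite_qform[ST S0]; split => // a.
have [->|/S0/ltW//] := eqVneq a 0.
by rewrite /qform dot0l.
Qed.

Lemma positive_definite_unitmx n (S : 'M[R]_n) : positive_definite S -> S \in unitmx.
Proof.
move=> [ST S0]; rewrite -row_free_unit -kermx_eq0; apply/eqP/row_matrixP => i.
rewrite row0; apply/eqP; apply: contraT => r0.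
have := S0 (row i (kermx S))^T; rewrite trmx_eq0 => /(_ r0).
by rewrite trmxK -row_mul mulmx_ker row0 mul0mx mxE ltxx.
Qed.

Lemma qform_cauchy_schwarz n (S : 'M[R]_n) a b : psd S -> 0 < qform S b b ->
  qform S a b ^+ 2 <= qform S a a * qform S b b.
Proof.
move=> [ST S0] qb.
have := S0 (qform S b b *: a - qform S a b *: b).
rewrite -scaleNr !(qformDl, qformDr, qformZl, qformZr) (qform_sym b a ST).
rewrite [X in 0 <= X -> _](_ : _ =
    qform S b b * (qform S a a * qform S b b - qform S a b ^+ 2)); last by ring.
by rewrite pmulr_rge0// subr_ge0.
Qed.

(** Cauchy-Schwarz replaces eigenvalues: coordinate [k] of [s] is [qform S s (w k)] with [w k] the
    [k]-th column of the inverse. The constant [C] is the trace of that inverse. *)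
Lemma positive_definite_lower n (S : 'M[R]_n.+1) : positive_definite S ->
  exists2 l : R, 0 < l & forall s, l * `|s| ^+ 2 <= qform S s s.
Proof.
move=> pS; have uS := positive_definite_unitmx pS.
have psdS := positive_definite_psd pS.
pose w (k : 'I_n.+1) : 'cV[R]_n.+1 := invmx S *m delta_mx k 0.
have Sw k : S *m w k = delta_mx k 0 by rewrite mulKVmx.
have qw k : 0 < qform S (w k) (w k).
  have [_] := (positive_definite_qform S).1 pS; apply.
  apply/negP => /eqP w0; have := Sw k; rewrite w0 mulmx0 => /matrixP/(_ k 0).
  by rewrite !mxE !eqxx => /eqP; rewrite eq_sym oner_eq0.
pose C := \sum_k qform S (w k) (w k).
have C0 : 0 < C.
  by rewrite /C (bigD1 ord0)//= ltr_pwDl// sumr_ge0// => k _; rewrite ltW.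
exists C^-1; first by rewrite invr_gt0.
move=> s; rewrite ler_pdivrMl//.
have [k [j ->]] := mx_norm_coord s; rewrite ord1 real_normK ?num_real//.
have -> : s k 0 = qform S s (w k).
  by rewrite /qform Sw dotC -[X in dot X _]scale1r dot_deltal mul1r.
apply: le_trans (qform_cauchy_schwarz s psdS (qw k)) _.
rewrite mulrC ler_wpM2r//; first by have [_] := psdS; exact.
by rewrite /C (bigD1 k)//= lerDl sumr_ge0// => i _; rewrite ltW.
Qed.

Lemma positive_definite_sandwich n (J K : 'M[R]_n) (c : R) : 0 < c ->
  positive_definite J -> positive_definite K ->
  positive_definite (c *: (invmx J *m K *m invmx J)) /\
  forall a, qform (c *: (invmx J *m K *m invmx J)) a a =
    c * qform K (invmx J *m a) (invmx J *m a).
Proof.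
move=> c0 pJ pK; have uJ := positive_definite_unitmx pJ.
have [JT _] := pJ; have [KT K0] := pK.
have iJT : (invmx J)^T = invmx J by rewrite trmx_inv JT.
have E a : qform (c *: (invmx J *m K *m invmx J)) a a =
    c * qform K (invmx J *m a) (invmx J *m a).
  rewrite /qform -scalemxAl dotZr; congr (_ * _).
  by rewrite -!dotE trmx_mul iJT !mulmxA.
split => //; apply/positive_definite_qform; split.
  by rewrite linearZ/= !trmx_mul iJT KT mulmxA.
move=> a a0; rewrite E mulr_gt0//.
have [_] := (positive_definite_qform K).1 pK; apply.
apply: contra_neq a0 => H.
by rewrite -(mulKVmx uJ a) H mulmx0.
Qed.

End quadratic_forms.

(** * Independence and identical laws *)

Section equal_laws.
Context d d' (T : measurableType d) (T' : measurableType d') (R : realType).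
Variables (P : probability T R) (X Y : {RV P >-> T'}).
Hypothesis XY : identically_distributed X Y.

Lemma L1_identically_distributed (f : T' -> R) : measurable_fun setT f ->
  L1 P (f \o X) -> L1 P (f \o Y).
Proof.
move=> mf /integrableP[_ foo]; apply/integrableP; split.
  by apply/measurable_EFinP; exact: measurableT_comp.
rewrite -(@ge0_integral_distribution _ _ _ _ _ P Y (fun y => `|(f y)%:E|)%E)//; last first.
  by apply: measurableT_comp => //; exact/measurable_EFinP.
rewrite (eq_measure_integral (distribution P X)); last first.
  by move=> A mA _; rewrite /= -XY.
rewrite (@ge0_integral_distribution _ _ _ _ _ P X (fun y => `|(f y)%:E|)%E)//.
by apply: measurableT_comp => //; exact/measurable_EFinP.
Qed.

Lemma Ex_identically_distributed (f : T' -> R) : measurable_fun setT f ->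
  L1 P (f \o X) -> Ex P (f \o X) = Ex P (f \o Y).
Proof.
move=> mf iX; have iY := L1_identically_distributed mf iX.
apply: EFin_inj; rewrite !EFin_Ex//.
have mf' : measurable_fun setT (EFin \o f) by exact/measurable_EFinP.
have := @integral_distribution _ _ _ _ _ P X _ mf' iX; rewrite /comp => <-.
have := @integral_distribution _ _ _ _ _ P Y _ mf' iY; rewrite /comp => <-.
by apply: eq_measure_integral => A mA _; exact: XY.
Qed.

End equal_laws.

Section independent_product.
Context d (T : measurableType d) (R : realType) (P : probability T R).

(** By independence the law of the pair is the product of the marginal laws. Tonelli gives
    integrability of the product, which is part of the conclusion, and Fubini then gives the
    value. *)
Lemma independent_product (F G : T -> R) : L1 P F -> L1 P G ->
  (forall A B : set R, measurable A -> measurable B ->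
    P (F @^-1` A `&` G @^-1` B) = (P (F @^-1` A) * P (G @^-1` B))%E) ->
  L1 P (fun w => F w * G w) /\ Ex P (fun w => F w * G w) = Ex P F * Ex P G.
Proof.
move=> iF iG FG.
have mF := L1_measurable iF; have mG := L1_measurable iG.
pose F' : {RV P >-> R} := mfun_Sub (mem_set mF).
pose G' : {RV P >-> R} := mfun_Sub (mem_set mG).
have mW : measurable_fun setT (fun w => (F w, G w)) by exact: measurable_fun_pair.
pose W : {RV P >-> (R * R)%type} := mfun_Sub (mem_set mW).
pose mu1 : probability R R := distribution P F'; pose mu2 : probability R R := distribution P G'.
have law C : measurable C -> (mu1 \x mu2)%E C = distribution P W C.
  apply: product_measure_unique => A B mA mB.
  by rewrite -[RHS]FG.
have mM : measurable_fun setT (fun z : R * R => z.1 * z.2).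
  by apply: measurable_funM.
have iabs (H : T -> R) (mH : measurable_fun setT H) :
   (\int[distribution P (mfun_Sub (mem_set mH))]_y `|y%:E| = \int[P]_w `|(H w)%:E|)%E.
  rewrite (@ge0_integral_distribution _ _ _ _ _ P _ (fun y : R => `|y%:E|)%E)//.
  exact: measurableT_comp.
have iM : (mu1 \x mu2)%E.-integrable setT (fun z : R * R => (z.1 * z.2)%:E).
  apply/integrableP; split; first exact/measurable_EFinP.
  rewrite (@fubini_tonelli1 _ _ _ _ _ mu1 mu2 (fun z : R * R => `|(z.1 * z.2)%:E|)%E)//; last first.
    by apply: measurableT_comp => //; exact/measurable_EFinP.
  rewrite /fubini_F.
  under eq_integral do under eq_integral do rewrite /= normrM EFinM.
  have mabs : measurable_fun setT (fun y : R => `|y|%:E).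
    by apply/measurable_EFinP; exact: normr_measurable.
  pose C := (\int[P]_w `|(G w)%:E|)%E.
  have C0 : (0 <= C)%E by apply: integral_ge0.
  rewrite (eq_integral (fun x : R => (`|x|%:E * C)%E)); last first.
    by move=> x _; rewrite ge0_integralZl// /C -(iabs G mG).
  rewrite ge0_integralZr//.
  rewrite [X in (X * _)%E](iabs F mF).
  move/integrableP : iF => [_ Foo]; move/integrableP : iG => [_ Goo].
  by apply: lte_mul_pinfty => //; rewrite ?integral_ge0// ge0_fin_numE// integral_ge0.
have mEM : measurable_fun setT (fun z : R * R => (z.1 * z.2)%:E) by exact/measurable_EFinP.
have i_FG : L1 P (fun w => F w * G w).
  move/integrableP : iM => [_ Moo]; apply/integrableP; split.
    by apply/measurable_EFinP; exact: measurable_funM.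
  rewrite -(@ge0_integral_distribution _ _ _ _ _ P W (fun z : R * R => `|(z.1 * z.2)%:E|)%E)//; last first.
    exact: measurableT_comp.
  rewrite (eq_measure_integral (mu1 \x mu2)%E)//.
  by move=> A mA _; rewrite /= -law.
split => //; apply: EFin_inj; rewrite EFinM !EFin_Ex//.
have := @integral_distribution _ _ _ _ _ P W _ mEM i_FG; rewrite /comp/= => <-.
rewrite (eq_measure_integral (mu1 \x mu2)%E); last first.
  by move=> A mA _; rewrite /= -law.
rewrite -(@integral12_prod_meas1 _ _ _ _ _ mu1 mu2)// /fubini_F.
have mid : measurable_fun setT (EFin : R -> \bar R) by exact: EFin_measurable.
have i2 : mu2.-integrable setT EFin.
  apply/integrableP; split => //; rewrite (iabs G mG).
  by move/integrableP : iG => [].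
have i1 : mu1.-integrable setT EFin.
  apply/integrableP; split => //; rewrite (iabs F mF).
  by move/integrableP : iF => [].
have E2 : (\int[mu2]_y y%:E = (Ex P G)%:E)%E.
  rewrite EFin_Ex//.
  by have := @integral_distribution _ _ _ _ _ P G' _ mid iG.
have E1 : (\int[mu1]_y y%:E = (Ex P F)%:E)%E.
  rewrite EFin_Ex//.
  by have := @integral_distribution _ _ _ _ _ P F' _ mid iF.
under eq_integral do under eq_integral do rewrite /= EFinM.
under eq_integral do rewrite integralZl// E2.
by rewrite integralZr// E1 -!EFin_Ex.
Qed.

End independent_product.

Section pi_lambda.
Context d (T : measurableType d) (R : realType) (P : probability T R).
Variables (G H : set (set T)).
Hypotheses (Gm : G `<=` measurable) (Hm : H `<=` measurable).
Hypotheses (GT : G setT) (HT : H setT).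
Hypotheses (GI : setI_closed G) (HI : setI_closed H).
Hypothesis GH : forall A B, G A -> H B -> P (A `&` B) = (P A * P B)%E.

(** For fixed [C], both sides are finite measures in [A] that agree on a generating family stable
    under intersection. Independence of two generated sigma-algebras follows by extending one factor
    at a time. *)
Let aux (K : set (set T)) (C : set T) : K `<=` measurable -> K setT ->
  setI_closed K -> measurable C ->
  (forall A, K A -> P (A `&` C) = (P A * P C)%E) ->
  forall A, <<s K >> A -> P (A `&` C) = (P A * P C)%E.
Proof.
move=> Km KT KI mC KC A KA.
have rC : 0 <= fine (P C) by rewrite fine_ge0.
pose r : {nonneg R} := NngNum rC.
have E B : mscale r P B = (P B * P C)%E.
  by rewrite /mscale/= fineK ?fin_num_measure// muleC.
rewrite -[LHS]/(mrestr P mC A) -E.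
apply: (@g_sigma_algebra_measure_unique _ R T K Km (fun=> setT) (fun=> KT) _
  (mrestr P mC) (mscale r P) KI _ _ A KA).
- by apply/seteqP; split => // w _; exists 0%N.
- by move=> B KB; exact: etrans (KC B KB) (esym (E B)).
- move=> _; apply: le_lt_trans (probability_le1 P (measurableI _ _ measurableT mC)) _.
  exact: ltry.
Qed.

Lemma independent_g_sigma A B : <<s G >> A -> <<s H >> B ->
  P (A `&` B) = (P A * P B)%E.
Proof.
move=> sA sB.
have mA : measurable A by apply: (smallest_sub (@sigma_algebra_measurable _ T) Gm).
rewrite setIC muleC; apply: (aux Hm HT HI mA _ sB) => C HC.
rewrite setIC muleC; apply: (aux Gm GT GI (Hm HC) _ sA) => D GD.
exact: GH.
Qed.

End pi_lambda.

Section cylinders.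
Context d d' (T : measurableType d) (T' : measurableType d') (R : realType)
  (P : probability T R) (I : choiceType) (X : I -> {RV P >-> T'}).

Definition cylinder (J : {fset I}) (A : I -> set T') : set T :=
  \bigcap_(i in [set` J]) (X i @^-1` A i).

(** The restriction to [S] bears on the sets [A i] and not on the finite index set. Two cylinders
    can thus be brought to a common index set, which may leave [S]. *)
Definition supported (S : set I) (A : I -> set T') :=
  (forall i, measurable (A i)) /\ (forall i, ~ S i -> A i = setT).

Definition cylinders (S : set I) : set (set T) :=
  [set E | exists J A, supported S A /\ E = cylinder J A].

Let widen (J : {fset I}) (A : I -> set T') i := if i \in J then A i else setT.

Lemma cylinder_widen (J K : {fset I}) A : (J `<=` K)%fset ->
  cylinder J A = cylinder K (widen J A).
Proof.
move=> /fsubsetP JK; apply/seteqP; split => w Aw i /= iK.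
  by rewrite /widen; case: ifP => // iJ; exact: Aw.
by have := Aw i (JK _ iK); rewrite /widen iK.
Qed.

Lemma supported_widen S J A : supported S A -> supported S (widen J A).
Proof.
move=> [mA SA]; split => i; rewrite /widen; case: ifP => // _.
by move=> iS; exact: SA.
Qed.

Lemma cylinderI J A B :
  cylinder J A `&` cylinder J B = cylinder J (fun i => A i `&` B i).
Proof.
apply/seteqP; split => w; first by move=> [Aw Bw] i iJ; split; [exact: Aw|exact: Bw].
by move=> ABw; split=> i iJ; have [] := ABw i iJ.
Qed.

Lemma cylinders_setI S : setI_closed (cylinders S).
Proof.
move=> _ _ [J [A [sA ->]]] [K [B [sB ->]]].
have sA' := supported_widen J sA; have sB' := supported_widen K sB.
exists (J `|` K)%fset, (fun i => widen J A i `&` widen K B i); split.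
  split=> i; first by apply: measurableI; [exact: sA'.1|exact: sB'.1].
  by move=> iS; rewrite sA'.2// sB'.2// setIT.
by rewrite -cylinderI -!cylinder_widen ?fsubsetUl ?fsubsetUr.
Qed.

Lemma cylindersT S : cylinders S setT.
Proof.
exists fset0, (fun=> setT); split; first by split.
by apply/seteqP; split => // w _ i.
Qed.

Lemma cylinders_sub S S' : (S `<=` S')%classic -> (cylinders S `<=` cylinders S')%classic.
Proof.
move=> SS' _ [J [A [[mA SA] ->]]]; exists J, A; split => //; split => // i iS'.
by apply: SA => /SS'.
Qed.

Lemma cylinders_generated S E : cylinders S E -> generated_events X E.
Proof.
move=> [J [A [[mA _] ->]]].
apply: (@fin_bigcap_measurable _ (g_sigma_algebraType
  (\bigcup_(i in [set: I]) preimage_set_system setT (X i) measurable)%classic)).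
  exact: finite_fset.
move=> i _; apply: sub_sigma_algebra; exists i => //.
by exists (A i) => //; rewrite setTI.
Qed.

Lemma cylinders_measurable S E : cylinders S E -> measurable E.
Proof.
move=> /cylinders_generated; apply: smallest_sub.
  exact: sigma_algebra_measurable.
move=> _ [i _ [A mA <-]]; exact: measurable_funPT.
Qed.

Hypothesis indX : mutually_independent X.

(** At every index at least one of the two constraints is the full set, so the product formula
    splits factor by factor. *)
Lemma cylinders_independent S S' E E' : (S `&` S' = set0)%classic ->
  cylinders S E -> cylinders S' E' -> P (E `&` E') = (P E * P E')%E.
Proof.
move=> SS' [J [A [sA ->]]] [K [B [sB ->]]].
have sA' := supported_widen J sA; have sB' := supported_widen K sB.
rewrite (@cylinder_widen J (J `|` K)%fset) ?fsubsetUl// (@cylinder_widen K (J `|` K)%fset) ?fsubsetUr//.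
rewrite cylinderI /cylinder !indX; last 3 first.
- exact: sB'.1.
- exact: sA'.1.
- by move=> i; apply: measurableI; [exact: sA'.1|exact: sB'.1].
rewrite -big_split/=; apply: eq_bigr => i _.
have [iS|iS] := pselect (S i).
  have iS' : ~ S' i by move=> iS'; have : (S `&` S')%classic i by []; rewrite SS'.
  by rewrite (sB'.2 _ iS') setIT preimage_setT probability_setT mule1.
by rewrite (sA'.2 _ iS) setTI preimage_setT probability_setT mul1e.
Qed.

End cylinders.

Section joint_sigma_algebra.
Context d d1 d2 (T : measurableType d) (T1 : measurableType d1)
  (T2 : measurableType d2) (R : realType) (P : probability T R)
  (I1 I2 : choiceType) (X : I1 -> {RV P >-> T1}) (Y : I2 -> {RV P >-> T2}).

Definition joint_cylinders (S1 : set I1) (S2 : set I2) : set (set T) :=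
  [set E | exists E1 E2, [/\ cylinders X S1 E1, cylinders Y S2 E2 & E = E1 `&` E2]].

(** The sample space with the sigma-algebra generated by the [X i], [i] in [S1], and the [Y i], [i]
    in [S2]. Measurability on it says that a quantity depends on these variables only. *)
Definition joint (S1 : set I1) (S2 : set I2) :=
  g_sigma_algebraType (joint_cylinders S1 S2).

Lemma measurable_jointl (S1 : set I1) (S2 : set I2) i : S1 i ->
  measurable_fun (setT : set (joint S1 S2)) (X i : T -> T1).
Proof.
move=> Si _ A mA; rewrite setTI; apply: sub_sigma_algebra.
exists (X i @^-1` A), setT; split; [|exact: cylindersT|by rewrite setIT].
exists [fset i]%fset, (fun k => if k == i then A else setT); split.
  split=> k; first by case: ifP.
  by case: eqVneq => // -> /(_ Si).
apply/seteqP; split => w; first by move=> Aw k /= /fset1P ->; rewrite /= eqxx.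
by move=> /(_ i)/=; rewrite eqxx inE; apply.
Qed.

Lemma measurable_jointr (S1 : set I1) (S2 : set I2) i : S2 i ->
  measurable_fun (setT : set (joint S1 S2)) (Y i : T -> T2).
Proof.
move=> Si _ A mA; rewrite setTI; apply: sub_sigma_algebra.
exists setT, (Y i @^-1` A); split; [exact: cylindersT| |by rewrite setTI].
exists [fset i]%fset, (fun k => if k == i then A else setT); split.
  split=> k; first by case: ifP.
  by case: eqVneq => // -> /(_ Si).
apply/seteqP; split => w; first by move=> Aw k /= /fset1P ->; rewrite /= eqxx.
by move=> /(_ i)/=; rewrite eqxx inE; apply.
Qed.

Lemma joint_cylinders_measurable S1 S2 : joint_cylinders S1 S2 `<=` measurable.
Proof.
move=> _ [E1 [E2 [c1 c2 ->]]].
by apply: measurableI; [exact: cylinders_measurable c1|exact: cylinders_measurable c2].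
Qed.

Let joint_cylindersT S1 S2 : joint_cylinders S1 S2 setT.
Proof. by exists setT, setT; split; [exact: cylindersT|exact: cylindersT|rewrite setIT]. Qed.

Let joint_cylindersI S1 S2 : setI_closed (joint_cylinders S1 S2).
Proof.
move=> _ _ [E1 [E2 [c1 c2 ->]]] [F1 [F2 [e1 e2 ->]]].
exists (E1 `&` F1), (E2 `&` F2); split; first exact: cylinders_setI.
  exact: cylinders_setI.
by rewrite setIACA.
Qed.

Hypotheses (indX : mutually_independent X) (indY : mutually_independent Y).
Hypothesis indXY : independent_families X Y.

(** The one independence statement behind all later ones: quantities built from disjoint blocks of
    both families are independent. On cylinders the [X] and [Y] parts are separated first, and then
    each family is split by its own independence. *)
Lemma joint_independent (S1 S1' : set I1) (S2 S2' : set I2) d3 d4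
    (T3 : measurableType d3) (T4 : measurableType d4) (F : T -> T3) (G : T -> T4) :
  S1 `&` S1' = set0 -> S2 `&` S2' = set0 ->
  measurable_fun (setT : set (joint S1 S2)) F ->
  measurable_fun (setT : set (joint S1' S2')) G ->
  forall A B, measurable A -> measurable B ->
    P (F @^-1` A `&` G @^-1` B) = (P (F @^-1` A) * P (G @^-1` B))%E.
Proof.
move=> S11 S22 mF mG A B mA mB.
apply: (@independent_g_sigma _ _ _ P (joint_cylinders S1 S2) (joint_cylinders S1' S2')) => //.
- exact: joint_cylinders_measurable.
- exact: joint_cylinders_measurable.
- move=> _ _ [E1 [E2 [c1 c2 ->]]] [F1 [F2 [e1 e2 ->]]].
  have sub1 S E : cylinders X S E -> cylinders X setT E by exact: cylinders_sub.
  have sub2 S E : cylinders Y S E -> cylinders Y setT E by exact: cylinders_sub.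
  have split2 E E' : cylinders X setT E -> cylinders Y setT E' ->
      P (E `&` E') = (P E * P E')%E.
    by move=> cE cF; apply: indXY; apply: cylinders_generated; [exact: cE|exact: cF].
  rewrite setIACA split2; last 2 first.
  + by apply: cylinders_setI; [exact: sub1 c1|exact: sub1 e1].
  + by apply: cylinders_setI; [exact: sub2 c2|exact: sub2 e2].
  rewrite (cylinders_independent indX S11 c1 e1) (cylinders_independent indY S22 c2 e2).
  rewrite (split2 E1 E2 (sub1 _ _ c1) (sub2 _ _ c2)).
  rewrite (split2 F1 F2 (sub1 _ _ e1) (sub2 _ _ e2)).
  by rewrite muleACA.
- by have := mF measurableT A mA; rewrite setTI.
- by have := mG measurableT B mB; rewrite setTI.
Qed.

End joint_sigma_algebra.

Section sample.
Context d (T : measurableType d) (R : realType) (P : probability T R) (n : nat).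
Variables (U : nat -> {RV P >-> 'cV[R]_n.+1}) (delta : 'I_n.+1 -> nat -> {RV P >-> R}).
Let dl (p : 'I_n.+1 * nat) := delta p.1 p.2.
Hypotheses (U_indep : mutually_independent U)
  (U_ident : forall j, identically_distributed (U j) (U 0%N))
  (delta_indep : mutually_independent dl)
  (delta_ident : forall i j, identically_distributed (delta i j) (delta ord0 0%N))
  (U_delta_indep : independent_families U dl).

Definition noise j w : 'cV[R]_n.+1 := \col_i delta i j w.

Lemma measurable_noise j : measurable_fun setT (noise j).
Proof.
apply: measurable_mx => i k; under eq_fun do rewrite mxE.
exact: measurable_funPT.
Qed.

Definition sample_point j (w : T) := (U j w, noise j w).

Lemma measurable_sample_point_joint j (S1 : set nat) (S2 : set ('I_n.+1 * nat)) :
  S1 j -> (forall i, S2 (i, j)) ->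
  measurable_fun (setT : set (joint U dl S1 S2)) (sample_point j).
Proof.
move=> Sj S2j; apply: measurable_fun_pair; first exact: measurable_jointl.
apply: measurable_mx => i k; rewrite (_ : (fun w => _) = dl (i, j)).
  exact: measurable_jointr.
by apply/funext => w; rewrite mxE.
Qed.

Lemma measurable_sample_point j : measurable_fun setT (sample_point j).
Proof.
apply: measurable_fun_pair; [exact: measurable_funPT|exact: measurable_noise].
Qed.

Definition sample_rv j : {RV P >-> ('cV[R]_n.+1 * 'cV[R]_n.+1)%type} :=
  mfun_Sub (mem_set (measurable_sample_point j)).

Let boxes : set (set 'cV[R]_n.+1) := [set E | exists B : 'I_n.+1 -> set R,
  (forall i, measurable (B i)) /\ E = [set v : 'cV[R]_n.+1 | forall i, B i (v i 0)]].

(** On boxes independence turns both sides into the same product of probabilities for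
    [delta ord0 0%N]; boxes generate the sigma-algebra and are stable under intersection. *)
Let noise_law j j' (A : set 'cV[R]_n.+1) : measurable A -> P (noise j @^-1` A) = P (noise j' @^-1` A).
Proof.
move=> mA.
pose Dj : {RV P >-> 'cV[R]_n.+1} := mfun_Sub (mem_set (measurable_noise j)).
pose Dj' : {RV P >-> 'cV[R]_n.+1} := mfun_Sub (mem_set (measurable_noise j')).
have boxm : boxes `<=` measurable.
  move=> _ [B [mB ->]].
  rewrite (_ : [set v : 'cV[R]_n.+1 | _] =
      \bigcap_(i in [set: 'I_n.+1]) ((fun v : 'cV[R]_n.+1 => v i 0) @^-1` B i)).
    apply: fin_bigcap_measurable; first exact: finite_finset.
    by move=> i _; rewrite -[X in measurable X]setTI; exact: measurable_coord.
  by apply/seteqP; split => v Bv i; [move=> _|]; exact: Bv.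
have mE : <<s boxes >> A.
  move: mA; apply: smallest_sub; first exact: smallest_sigma_algebra.
  move=> _ [[i k] _ [B mB <-]]; apply: sub_sigma_algebra.
  exists (fun i' => if i' == i then B else setT); split.
    by move=> i'; case: ifP.
  rewrite setTI ord1; apply/seteqP; split => v /=.
    by move=> Bv i'; case: eqVneq => // ->.
  by move=> /(_ i); rewrite eqxx.
have PE l (B : 'I_n.+1 -> set R) : (forall i, measurable (B i)) ->
    P [set w | forall i, B i (noise l w i 0)] =
    \big[*%E/1%E]_(i : 'I_n.+1) P (delta ord0 0%N @^-1` B i).
  move=> mB; pose J : {fset 'I_n.+1 * nat} := [fset (i, l) | i in 'I_n.+1]%fset.
  have -> : [set w | forall i, B i (noise l w i 0)] =
      \bigcap_(p in [set` J]) (dl p @^-1` B p.1).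
    apply/seteqP; split => w Bw /=.
      by move=> _ /imfsetP[i /= _ ->]; have := Bw i; rewrite mxE.
    move=> i; rewrite mxE; apply: (Bw (i, l)).
    by apply/imfsetP; exists i.
  rewrite (delta_indep J (fun p => mB p.1)).
  rewrite big_imfset/=; last by move=> i i' _ _ [].
  rewrite big_enum/=; apply: eq_bigr => i _.
  by rewrite [LHS](delta_ident i l (mB i)).
rewrite -[LHS]/(distribution P Dj A) -[RHS]/(distribution P Dj' A).
apply: (@g_sigma_algebra_measure_unique _ R _ boxes boxm (fun=> setT) _ _
  (distribution P Dj) (distribution P Dj') _ _ _ A mE).
- by move=> _; exists (fun=> setT); split => //; apply/seteqP; split.
- by apply/seteqP; split => // v _; exists 0%N.
- move=> _ _ [B [mB ->]] [C [mC ->]]; exists (fun i => B i `&` C i); split.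
    by move=> i; apply: measurableI.
  apply/seteqP; split => v /=; first by move=> [H1 H2] i; split.
  by move=> H; split => i; have [] := H i.
- by move=> _ [B [mB ->]]; rewrite /distribution /pushforward/= [LHS]PE// [RHS]PE.
- by move=> _; apply: le_lt_trans (probability_le1 _ measurableT) _; exact: ltry.
Qed.

Lemma sample_identically_distributed j :
  identically_distributed (sample_rv 0%N) (sample_rv j).
Proof.
pose D l : {RV P >-> 'cV[R]_n.+1} := mfun_Sub (mem_set (measurable_noise l)).
pose m1 : probability _ R := distribution P (U 0%N).
pose m2 : probability _ R := distribution P (D 0%N).
have H l C : measurable C -> (m1 \x m2)%E C = distribution P (sample_rv l) C.
  apply: product_measure_unique => A B mA mB.
  transitivity (P (U l @^-1` A `&` D l @^-1` B)); first by [].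
  transitivity (P (U l @^-1` A) * P (D l @^-1` B))%E; last first.
    by congr (_ * _)%E; [exact: (U_ident l mA)|exact: noise_law].
  apply: (joint_independent U_indep delta_indep U_delta_indep
    (S1 := [set l]) (S1' := set0) (S2 := set0) (S2' := [set p | p.2 = l])) => //.
  - exact: setI0.
  - exact: set0I.
  - exact: measurable_jointl.
  - apply: measurable_mx => i k; rewrite (_ : (fun w => _) = dl (i, l)).
      exact: measurable_jointr.
    by apply/funext => w; rewrite /= mxE.
by move=> C mC; rewrite -!H.
Qed.

End sample.

(** * Weak law of large numbers and central limit theorem *)

Section taylor_bounds.
Variable R : realType.
Implicit Types (f : R -> R) (r y : R).

Lemma cosB1_bound1 y : `|cos y - 1| <= `|y|.
Proof.
rewrite -[X in _ - X]cos0 -[leRHS]mul1r; apply: (@mvt_bound _ _ (fun x => - sin x)) => x _.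
by rewrite normrN sin_max.
Qed.

Lemma sin_bound1 y : `|sin y| <= `|y|.
Proof.
rewrite -[sin y]subr0 -[X in _ - X]sin0 -[leRHS]mul1r.
by apply: (@mvt_bound _ _ (fun x => cos x)) => x _; exact: cos_max.
Qed.

Lemma cosB1_bound2 y : `|cos y - 1| <= `|y| ^+ 2.
Proof.
rewrite -[X in _ - X]cos0 expr2; apply: (@mvt_bound _ _ (fun x => - sin x)) => x xy.
by rewrite normrN (le_trans (sin_bound1 _)).
Qed.

Let dsin (x : R) : is_derive x 1 (fun y : R => sin y - y) (cos x - 1).
Proof. exact: is_derive_eq. Qed.

Lemma sinB_bound2 y : `|sin y - y| <= `|y| ^+ 2.
Proof.
have := @mvt_bound R (fun x => sin x - x) (fun x => cos x - 1) y `|y| (fun x _ => dsin x).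
rewrite sin0 subrr subr0 expr2; apply => x xy.
exact: le_trans (cosB1_bound1 _) xy.
Qed.

Lemma sinB_bound3 y : `|sin y - y| <= `|y| ^+ 3.
Proof.
have := @mvt_bound R (fun x => sin x - x) (fun x => cos x - 1) y (`|y| ^+ 2) (fun x _ => dsin x).
rewrite sin0 subrr subr0 -exprSr; apply => x xy.
by apply: le_trans (cosB1_bound2 _) _; rewrite lerXn2r ?nnegrE.
Qed.

(** The quadratic bound supplies an integrable majorant under second moments alone, while the cubic
    bound that follows supplies the pointwise limit. *)
Lemma cos_taylor_bound2 y : `|cos y - 1 + y ^+ 2 / 2| <= 2 * `|y| ^+ 2.
Proof.
apply: le_trans (ler_normD _ _) _; have := cosB1_bound2 y.
rewrite [X in _ -> _ + X <= _]ger0_norm ?divr_ge0 ?sqr_ge0// -[y ^+ 2]real_normK ?num_real//.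
by have := sqr_ge0 `|y|; lra.
Qed.

Lemma cos_taylor_bound3 y : `|cos y - 1 + y ^+ 2 / 2| <= `|y| ^+ 3.
Proof.
have D (x : R) : is_derive x 1 (fun y : R => cos y - 1 + y ^+ 2 / 2) (- sin x + x).
  by apply: is_derive_eq; rewrite /GRing.scale/=; field.
have := @mvt_bound _ _ _ y (`|y| ^+ 2) (fun x _ => D x).
rewrite cos0 subrr add0r expr0n/= mul0r subr0 -exprSr; apply => x xy.
rewrite addrC distrC; apply: le_trans (sinB_bound2 _) _.
by rewrite lerXn2r ?nnegrE.
Qed.

Lemma expRN_bound y : 0 <= y -> `|expR (- y) - (1 - y)| <= y ^+ 2.
Proof.
move=> y0; have y1 : 0 < 1 + y by rewrite ltr_pwDl.
have H := @expR_ge1Dx R (- y).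
rewrite ger0_norm; last by rewrite subr_ge0.
rewrite lerBlDr expRN.
apply: (@le_trans _ _ (1 + y)^-1).
  by rewrite lef_pV2 ?posrE ?expR_gt0// expR_ge1Dx.
rewrite -[leLHS]mul1r ler_pdivrMr//.
have -> : (y ^+ 2 + (1 - y)) * (1 + y) = 1 + y ^+ 3 by ring.
by rewrite lerDl exprn_ge0.
Qed.

End taylor_bounds.

Section iid.
Context d d' (T : measurableType d) (S : measurableType d') (R : realType)
  (P : probability T R) (V : nat -> {RV P >-> S}).
Hypothesis V_id : forall j, identically_distributed (V 0%N) (V j).
(** Independence enters in two forms: a new term against the partial sum before it, for the
    characteristic function, and [V_pair], for second moments. *)
Hypothesis V_past : forall m (f g : S -> R), measurable_fun setT f -> measurable_fun setT g ->
  forall A B : set R, measurable A -> measurable B ->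
  P ((fun w => \sum_(j < m) f (V j w)) @^-1` A `&` (g \o V m) @^-1` B) =
  (P ((fun w => (\sum_(j < m) f (V j w))%R) @^-1` A) * P ((g \o V m) @^-1` B))%E.
Hypothesis V_pair : forall j k (f g : S -> R), j != k ->
  measurable_fun setT f -> measurable_fun setT g ->
  forall A B : set R, measurable A -> measurable B ->
  P ((f \o V j) @^-1` A `&` (g \o V k) @^-1` B) =
  (P ((f \o V j) @^-1` A) * P ((g \o V k) @^-1` B))%E.

Lemma iid_L1 (f : S -> R) j : measurable_fun setT f -> L1 P (f \o V 0%N) -> L1 P (f \o V j).
Proof. by move=> mf; apply: L1_identically_distributed. Qed.

Lemma iid_Ex (f : S -> R) j : measurable_fun setT f -> L1 P (f \o V 0%N) ->
  Ex P (f \o V j) = Ex P (f \o V 0%N).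
Proof. by move=> mf i0; rewrite -(Ex_identically_distributed (V_id j)). Qed.

Lemma iid_second_moment (f : S -> R) m :
  measurable_fun setT f -> L1 P (f \o V 0%N) -> L1 P (fun w => f (V 0%N w) ^+ 2) ->
  Ex P (f \o V 0%N) = 0 ->
  L1 P (fun w => (\sum_(j < m) f (V j w)) ^+ 2) /\
  Ex P (fun w => (\sum_(j < m) f (V j w)) ^+ 2) = m%:R * Ex P (fun w => f (V 0%N w) ^+ 2).
Proof.
move=> mf i1 i2 f0.
have mf2 : measurable_fun setT (fun s => f s ^+ 2) by exact: measurable_funX.
have ifV j : L1 P (f \o V j) by exact: iid_L1.
have iff j k : L1 P (fun w => f (V j w) * f (V k w)).
  have [->|jk] := eqVneq j k; first exact: (iid_L1 k mf2 i2).
  exact: (independent_product (ifV j) (ifV k) (V_pair jk mf mf)).1.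
have E : (fun w => (\sum_(j < m) f (V j w)) ^+ 2) =
    (fun w => \sum_(j < m) \sum_(k < m) f (V j w) * f (V k w)).
  apply/funext => w; rewrite expr2 mulr_suml; apply: eq_bigr => j _.
  by rewrite mulr_sumr.
rewrite E; split; first by apply: L1_sum => j; exact: L1_sum.
rewrite Ex_sum; last by move=> j; apply: L1_sum.
have -> : m%:R * Ex P (fun w => f (V 0%N w) ^+ 2) = \sum_(j < m) Ex P (fun w => f (V 0%N w) ^+ 2).
  by rewrite sumr_const card_ord mulr_natl.
apply: eq_bigr => j _; rewrite Ex_sum// (bigD1 j)//= big1 ?addr0; last first.
  move=> k kj; have jk : j != k :> nat by rewrite eq_sym.
  have [_] := independent_product (ifV j) (ifV k) (V_pair jk mf mf).
  rewrite /comp => ->; rewrite -[X in X * _]/(Ex P (f \o V j)) iid_Ex//.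
  by rewrite f0 mul0r.
exact: (iid_Ex j mf2 i2).
Qed.

Lemma truncation_L1 (f : S -> R) (e : R) : measurable_fun setT f ->
  L1 P (f \o V 0%N) -> 0 < e -> exists K : R, 0 <= K /\
  Ex P (fun w => `|f (V 0%N w) - (f (V 0%N w) * \1_[set s | `|f s| <= K] (V 0%N w))|) <= e.
Proof.
move=> mf i0 e0.
pose g k w := `|f (V 0%N w) - (f (V 0%N w) * \1_[set s | `|f s| <= k%:R] (V 0%N w))|.
have mfV : measurable_fun setT (f \o V 0%N) by apply: measurableT_comp.
have mA (k : R) : measurable [set s | `|f s| <= k].
  rewrite (_ : [set s | _] = setT `&` (fun s => `|f s|) @^-1` `]-oo, k]%classic).
    by apply: (measurableT_comp (@normr_measurable R setT) mf measurableT).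
  by apply/seteqP; split => s /=; rewrite in_itv/=; [split|case].
have mg k : measurable_fun setT (g k).
  apply: measurableT_comp => //; apply: measurable_funB => //.
  apply: measurable_funM => //.
  have mI : measurable_fun setT (\1_[set s | `|f s| <= k%:R] : S -> R).
    exact: measurable_indic.
  exact: measurableT_comp mI _.
have gf k w : `|g k w| <= `|f (V 0%N w)|.
  rewrite /g normr_id indicE; case: (_ \in _).
    by rewrite mulr1 subrr normr0.
  by rewrite mulr0 subr0.
have [] := @dominated_convergence _ _ _ P setT measurableT
    (fun k => EFin \o g k) (cst 0%E) (fun w => `|f (V 0%N w)|%:E).
- by move=> k; apply/measurable_EFinP.
- exact: measurable_cst.
- apply/aeW => w _; apply: cvg_near_cst.
  exists (Num.truncn `|f (V 0%N w)|).+1 => // k /= Hk.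
  rewrite /g indicE mem_set ?mulr1 ?subrr ?normr0//=.
  by apply: le_trans (ltW (truncnS_gt _)) _; rewrite ler_nat.
- exact: (L1_norm i0).
- by apply/aeW => w k _; rewrite lee_fin.
move=> _ _; rewrite integral0 => /fine_cvg /cvgrPdist_le /(_ _ e0)[k _ /(_ k (leqnn _))].
rewrite sub0r normrN => H.
exists k%:R; split => //; apply: le_trans H.
by rewrite ler_norm.
Qed.

(** Only a first moment is assumed, since the noise may have infinite variance. Truncation costs
    little in mean, and the bounded centred part is handled by its variance. Convergence in mean is
    the form that Markov's inequality consumes. *)
Lemma weak_lln (f : S -> R) : measurable_fun setT f -> L1 P (f \o V 0%N) ->
  Ex P (fun w => `|(\sum_(j < m) f (V j w)) / m%:R - Ex P (f \o V 0%N)|)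
    @[m --> \oo] --> 0.
Proof.
move=> mf i0; apply/cvgrPdist_le => e e0.
have e4 : 0 < e / 4 by rewrite divr_gt0.
have [K [K0 HK]] := truncation_L1 mf i0 e4.
set A := [set s | `|f s| <= K] in HK.
have mA : measurable A.
  rewrite (_ : A = setT `&` (fun s => `|f s|) @^-1` `]-oo, K]%classic).
    by apply: (measurableT_comp (@normr_measurable R setT) mf measurableT).
  by apply/seteqP; split => s /=; rewrite /A/= in_itv/=; [split|case].
pose h s := f s * \1_A s.
have mh : measurable_fun setT h by apply: measurable_funM => //; exact: measurable_indic.
have hK s : `|h s| <= K.
  rewrite /h indicE; case: (boolP (s \in A)) => [|_].
    by rewrite inE mulr1.
  by rewrite mulr0 normr0.
have mhV j : measurable_fun setT (h \o V j) by apply: measurableT_comp.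
have ihV j : L1 P (h \o V j) by apply: (L1_bounded P (mhV j) (fun w => hK _)).
pose mu := Ex P (f \o V 0%N); pose muh := Ex P (h \o V 0%N).
pose r s := `|f s - h s|.
have mr : measurable_fun setT r by apply: measurableT_comp => //; apply: measurable_funB.
have ifV j : L1 P (f \o V j) by exact: iid_L1.
have irV j : L1 P (r \o V j) by exact: (L1_norm (L1B (ifV j) (ihV j))).
have Er j : Ex P (r \o V j) <= e / 4 by rewrite iid_Ex.
have mumuh : `|muh - mu| <= e / 4.
  rewrite -ExB//; apply: le_trans (ler_norm_Ex (L1B (ihV _) (ifV _))) _.
  by apply: le_trans (Er 0%N); rewrite /r; under eq_fun do rewrite distrC.
pose g s := h s - muh.
have mg : measurable_fun setT g by apply: measurable_funB.
have muhK : `|muh| <= K by apply: (Ex_bounded P (mhV _) (fun w => hK _)).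
have gK s : `|g s| <= 2 * K.
  by apply: le_trans (ler_normB _ _) _; rewrite mulrDl mul1r lerD.
have Eg : Ex P (g \o V 0%N) = 0.
  by rewrite /g (ExB (ihV 0%N) (L1_cst P muh)) Ex_cst subrr.
near=> m.
have m0 : (0 < m)%N by near: m; exists 1%N.
have mR : 0 < m%:R :> R by rewrite ltr0n.
have igV j : L1 P (g \o V j) by exact: (L1B (ihV j) (L1_cst P muh)).
pose G w := (\sum_(j < m) g (V j w)) / m%:R.
have ig2 : L1 P (fun w => g (V 0%N w) ^+ 2).
  apply: (@L1_bounded _ _ _ _ _ ((2 * K) ^+ 2)) => [|w].
    by apply: measurable_funX; exact: measurableT_comp.
  by rewrite normrX lerXn2r ?nnegrE// mulr_ge0.
have [mG2 EG2] := iid_second_moment m mg (igV 0%N) ig2 Eg.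
(* The bound [|G| <= G ^+ 2 / e + e / 4] turns the second moment of the truncated average [G] into a
   first-moment estimate. The four quarters of [e] pay for the truncation, the second moment, this
   inequality and the shift of the mean. *)
have B w : `|(\sum_(j < m) f (V j w)) / m%:R - mu| <=
    m%:R^-1 * (\sum_(j < m) r (V j w)) +
    (((e * m%:R ^+ 2)^-1 * (\sum_(j < m) g (V j w)) ^+ 2 + e / 4) + e / 4).
  have -> : (\sum_(j < m) f (V j w)) / m%:R - mu =
     m%:R^-1 * (\sum_(j < m) (f (V j w) - h (V j w))) + (G w + (muh - mu)).
    rewrite /G /g !sumrB sumr_const card_ord -mulr_natr; field; exact: lt0r_neq0.
  apply: le_trans (ler_normD _ _) _; apply: lerD.
    rewrite normrM ger0_norm ?invr_ge0 ?ler0n// ler_wpM2l ?invr_ge0//.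
    exact: ler_norm_sum.
  apply: le_trans (ler_normD _ _) _; apply: lerD => //.
  have -> : (e * m%:R ^+ 2)^-1 * (\sum_(j < m) g (V j w)) ^+ 2 = `|G w| ^+ 2 / e.
    rewrite real_normK ?num_real// /G; field.
    by rewrite !gt_eqF.
  have := sqr_ge0 (`|G w| - e / 2); rewrite sqrrB => H.
  rewrite -(ler_pM2r e0) mulrDl divfK ?gt_eqF//; nra.
rewrite sub0r normrN ger0_norm; last by apply: Ex_ge0.
have iA1 : L1 P (fun w => m%:R^-1 * (\sum_(j < m) r (V j w))).
  by apply: L1Z; apply: L1_sum => j; exact: irV.
have iA2 : L1 P (fun w => ((e * m%:R ^+ 2)^-1 * (\sum_(j < m) g (V j w)) ^+ 2)).
  exact: L1Z.
have icst c : L1 P (fun=> c) by exact: L1_cst.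
apply: (@le_trans _ _ (e / 4 + ((e / 4 + e / 4) + e / 4))); last by lra.
apply: le_trans (Ex_le _ _ B) _.
- apply: L1_norm; apply: L1B => //.
  have := L1Z m%:R^-1 (@L1_sum _ _ _ P _ (index_enum 'I_m) xpredT (fun j => f \o V j) ifV).
  by under eq_fun do rewrite mulrC.
- by apply: L1D => //; apply: L1D => //; apply: L1D.
have iA3 := L1D iA2 (icst (e / 4)).
rewrite (ExD iA1 (L1D iA3 (icst (e / 4)))) (ExD iA3 (icst (e / 4))) (ExD iA2 (icst (e / 4))).
rewrite (_ : Ex P (fun=> e / 4) = e / 4); last exact: Ex_cst.
apply: lerD.
  rewrite ExZ; last by apply: L1_sum => j; exact: irV.
  rewrite ler_pdivrMl// Ex_sum; last by move=> j; exact: irV.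
  apply: (@le_trans _ _ (\sum_(j < m) e / 4)); last by rewrite sumr_const card_ord mulr_natl.
  by apply: ler_sum => j _; exact: Er.
rewrite !lerD2r ExZ//.
apply: (@le_trans _ _ ((e * m%:R ^+ 2)^-1 * (m%:R * (2 * K) ^+ 2))).
  apply: ler_wpM2l; first by rewrite invr_ge0 mulr_ge0 ?sqr_ge0// ltW.
  rewrite EG2 ler_wpM2l// (le_trans (ler_norm _))//; apply: Ex_bounded.
    exact: L1_measurable ig2.
  by move=> w; rewrite normrX lerXn2r ?nnegrE// mulr_ge0.
rewrite ler_pdivrMl ?mulr_gt0 ?exprn_gt0//.
have -> : e * m%:R ^+ 2 * (e / 4) = m%:R * (m%:R * (e ^+ 2 / 4)) by field.
rewrite ler_pM2l// -ler_pdivrMr ?divr_gt0 ?exprn_gt0//.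
near: m; exists (Num.truncn ((2 * K) ^+ 2 / (e ^+ 2 / 4))).+1 => // m /= Hm.
by apply: le_trans (ltW (truncnS_gt _)) _; rewrite ler_nat.
Unshelve. all: by end_near. Qed.

(** * The central limit theorem through real cosines with a phase *)

Section clt.
Variable f : S -> R.
Hypothesis mf : measurable_fun setT f.

Let past j (t b : R) w := cos (t * (\sum_(k < j) f (V k w)) + b).

Let mS j (t : R) : measurable_fun setT (fun w => t * (\sum_(k < j) f (V k w))).
Proof.
apply: measurable_funM => //; apply: measurable_sumr => k; exact: measurableT_comp.
Qed.

Let past_L1 j t b : L1 P (past j t b).
Proof. by apply: (@L1_bounded _ _ _ _ _ 1) => [|w]; [exact: measurable_cosD|exact: cos_max]. Qed.

(* [cos (A + B) = cos A * cos B - cos (A - pi/2) * cos (B - pi/2)] splits off the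
   last summand without leaving the family of cosines with a phase. *)
Let past_step j (t b : R) : Ex P (past j.+1 t b) =
  Ex P (fun w => cos (t * f (V 0%N w) + 0)) * Ex P (past j t b) -
  Ex P (fun w => cos (t * f (V 0%N w) + - (pi / 2))) * Ex P (past j t (b - pi / 2)).
Proof.
have mc (t' b' : R) : measurable_fun setT (fun x : R => cos (t' * x + b')).
  by apply: measurable_cosD; exact: measurable_funM.
have mg (b' : R) : measurable_fun setT (fun s => cos (t * f s + b')).
  by apply: measurable_cosD; exact: measurable_funM.
have ig j' (b' : R) : L1 P ((fun s => cos (t * f s + b')) \o V j').
  apply: (@L1_bounded _ _ _ _ _ 1) => [|w]; last exact: cos_max.
  exact: measurableT_comp.
have key (b1 b2 : R) : L1 P (fun w => past j t b1 w * cos (t * f (V j w) + b2)) /\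
    Ex P (fun w => past j t b1 w * cos (t * f (V j w) + b2)) =
    Ex P (past j t b1) * Ex P (fun w => cos (t * f (V 0%N w) + b2)).
  have := @independent_product _ _ _ P _ _ (past_L1 j t b1) (ig j b2).
  rewrite /comp => -[A B mA mB|i1 ->].
    have := V_past j mf (mg b2) (mc t b1 measurableT A mA) mB.
    by rewrite setTI.
  split => //; congr (_ * _).
  exact: (esym (Ex_identically_distributed (V_id j) (mg b2) (ig 0%N b2))).
have -> : past j.+1 t b = (fun w => past j t b w * cos (t * f (V j w) + 0) -
    past j t (b - pi / 2) w * cos (t * f (V j w) + - (pi / 2))).
  apply/funext => w; rewrite /past big_ord_recr/= mulrDr addrAC cosD addr0 addrA.
  by rewrite !cosBpihalf.
rewrite ExB; last 2 first.
- exact: (key _ _).1.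
- exact: (key _ _).1.
by rewrite !(key _ _).2 ![_ * Ex P (past _ _ _)]mulrC.
Qed.

(** The real counterpart of bounding a difference of [j]-th powers by [j] times the difference of
    the bases. Each step replaces the cosine mean by [g] and discards the sine mean, and both
    multiply quantities at most 1. *)
Let past_bound j (t b g : R) : 0 <= g <= 1 ->
  `|Ex P (past j t b) - g ^+ j * cos b| <=
  j%:R * (`|Ex P (fun w => cos (t * f (V 0%N w) + 0)) - g| +
          `|Ex P (fun w => cos (t * f (V 0%N w) + - (pi / 2)))|).
Proof.
move=> /andP[g0 g1]; elim: j => [|j IH].
  have -> : past 0 t b = cst (cos b).
    by apply/funext => w; rewrite /past big_ord0 mulr0 add0r.
  by rewrite Ex_cst expr0 mul1r subrr normr0 mul0r.
rewrite past_step; set c := Ex P (fun w => cos (_ + 0)) in IH *; set s := Ex P (fun w => cos (_ + - _)) in IH *.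
have B b' : `|Ex P (past j t b')| <= 1.
  by apply: Ex_bounded => [|w]; [exact: measurable_cosD|exact: cos_max].
have -> : c * Ex P (past j t b) - s * Ex P (past j t (b - pi / 2)) - g ^+ j.+1 * cos b =
  g * (Ex P (past j t b) - g ^+ j * cos b) +
  ((c - g) * Ex P (past j t b) - s * Ex P (past j t (b - pi / 2))).
  by rewrite exprS; ring.
apply: le_trans (ler_normD _ _) _.
rewrite -[j.+1]addn1 natrD [leRHS]mulrDl mul1r; apply: lerD.
  rewrite normrM ger0_norm// -[leRHS]mul1r; exact: ler_pM.
apply: le_trans (ler_normB _ _) _; rewrite !normrM.
by apply: lerD; rewrite -[leRHS]mulr1 ler_wpM2l.
Qed.

(** Dominated convergence: the quadratic bound gives the majorant [2 * f ^+ 2], and the cubic one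
    makes the integrand of order [1 / sqrt m] pointwise. *)
Let small_remainder (phi : R -> R) : measurable_fun setT phi ->
  (forall y, `|phi y| <= 2 * `|y| ^+ 2) -> (forall y, `|phi y| <= `|y| ^+ 3) ->
  L1 P (fun w => f (V 0%N w) ^+ 2) ->
  m%:R * Ex P (fun w => `|phi ((Num.sqrt m%:R)^-1 * f (V 0%N w))|) @[m --> \oo] --> 0.
Proof.
move=> mphi phi2 phi3 i2.
have mfV : measurable_fun setT (f \o V 0%N) by exact: measurableT_comp.
pose g m w := m%:R * `|phi ((Num.sqrt m%:R)^-1 * f (V 0%N w))|.
have mg0 m : measurable_fun setT (fun w => `|phi ((Num.sqrt m%:R)^-1 * f (V 0%N w))|).
  apply: measurableT_comp => //; apply: (measurableT_comp mphi).
  exact: measurable_funM.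
have mg m : measurable_fun setT (g m) by exact: measurable_funM.
have sq m : (0 < m)%N -> (Num.sqrt m%:R)^-1 ^+ 2 = m%:R^-1 :> R.
  by move=> m0; rewrite exprVn sqr_sqrtr.
have gb m w : `|g m w| <= 2 * f (V 0%N w) ^+ 2.
  rewrite /g; case: m => [|m]; first by rewrite mul0r normr0 mulr_ge0// sqr_ge0.
  rewrite normrM normr_id ger0_norm//.
  apply: (@le_trans _ _ (m.+1%:R * (2 * `|(Num.sqrt m.+1%:R)^-1 * f (V 0%N w)| ^+ 2))).
    by rewrite ler_wpM2l.
  rewrite real_normK ?num_real// exprMn sq// mulrCA mulVKf ?pnatr_eq0//.
have gc w : g m w @[m --> \oo] --> 0.
  apply/cvgrPdist_le => e e0; near=> m.
  have m0 : (0 < m)%N by near: m; exists 1%N.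
  have s0 : 0 < Num.sqrt m%:R :> R by rewrite sqrtr_gt0 ltr0n.
  rewrite sub0r normrN ger0_norm; last by rewrite mulr_ge0.
  apply: (@le_trans _ _ (m%:R * `|(Num.sqrt m%:R)^-1 * f (V 0%N w)| ^+ 3)).
    by rewrite ler_wpM2l.
  rewrite normrM exprMn ger0_norm ?invr_ge0 ?(ltW s0)// exprSr sq//.
  rewrite -mulrA mulVKf ?pnatr_eq0 -?lt0n//.
  rewrite ler_pdivrMl//.
  rewrite -ler_pdivrMr//.
  rewrite -[leLHS]ger0_norm ?divr_ge0 ?exprn_ge0 ?(ltW e0)// -sqrtr_sqr ler_sqrt//.
  near: m; exists (Num.truncn ((`|f (V 0%N w)| ^+ 3 / e) ^+ 2)).+1 => // m /= Hm.
  by apply: le_trans (ltW (truncnS_gt _)) _; rewrite ler_nat.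
have [] := @dominated_convergence _ _ _ P setT measurableT
    (fun k => EFin \o g k) (cst 0%E) (fun w => (2 * f (V 0%N w) ^+ 2)%:E).
- by move=> k; apply/measurable_EFinP.
- exact: measurable_cst.
- by apply/aeW => w _; apply: cvg_EFin; [exact: nearW|exact: gc].
- exact: (L1Z 2 i2).
- by apply/aeW => w k _; rewrite lee_fin.
move=> _ _; rewrite integral0 => /fine_cvg; apply: cvg_trans; apply: near_eq_cvg.
near=> m; rewrite -ExZ //.
have m0 : (0 < m)%N by near: m; exists 1%N.
have := L1_le (mg m) (gb m) (L1Z 2 i2) => /(L1Z m%:R^-1).
by rewrite /g; under eq_fun do rewrite mulKf ?pnatr_eq0 -?lt0n//.
Unshelve. all: by end_near. Qed.

Theorem iid_clt (b : R) : L1 P (f \o V 0%N) -> L1 P (fun w => f (V 0%N w) ^+ 2) ->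
  Ex P (f \o V 0%N) = 0 ->
  Ex P (fun w => cos ((Num.sqrt m%:R)^-1 * (\sum_(j < m) f (V j w)) + b)) @[m --> \oo] -->
  cos b * expR (- Ex P (fun w => f (V 0%N w) ^+ 2) / 2).
Proof.
move=> i1 i2 Ef; set v := Ex P (fun w => f (V 0%N w) ^+ 2).
have v0 : 0 <= v by apply: Ex_ge0 => w; exact: sqr_ge0.
pose phi1 (y : R) := cos y - 1 + y ^+ 2 / 2; pose phi2 (y : R) := sin y - y.
have mcos : measurable_fun setT (@cos R).
  by apply: continuous_measurable_fun; exact: continuous_cos.
have msin : measurable_fun setT (@sin R).
  by apply: continuous_measurable_fun; exact: continuous_sin.
have mphi1 : measurable_fun setT phi1.
  by apply: measurable_funD; [exact: measurable_funB|exact: measurable_funM].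
have mphi2 : measurable_fun setT phi2 by exact: measurable_funB.
have c1 := small_remainder mphi1 (@cos_taylor_bound2 R) (@cos_taylor_bound3 R) i2.
have phi22 (y : R) : `|phi2 y| <= 2 * `|y| ^+ 2.
  by apply: le_trans (sinB_bound2 y) _; rewrite ler_peMl ?sqr_ge0// ler1n.
have c2 := small_remainder mphi2 phi22 (@sinB_bound3 R) i2.
pose r m := m%:R * Ex P (fun w => `|phi1 ((Num.sqrt m%:R)^-1 * f (V 0%N w))|) +
  m%:R * Ex P (fun w => `|phi2 ((Num.sqrt m%:R)^-1 * f (V 0%N w))|) + (v / 2) ^+ 2 / m%:R.
have cr : r m @[m --> \oo] --> 0.
  rewrite -[0]addr0 -[X in _ --> X + _]addr0; apply: cvgD; first exact: cvgD.
  rewrite -[X in _ --> X](mulr0 ((v / 2) ^+ 2)); apply: cvgM; first exact: cvg_cst.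
  apply/gtr0_cvgV0; last exact: cvgr_idn.
  by near=> m; rewrite ltr0n; near: m; exists 1%N.
apply/cvgrPdist_le => e e0; near=> m.
have m0 : (0 < m)%N by near: m; exists 1%N.
have mR : 0 < m%:R :> R by rewrite ltr0n.
have re : `|r m| <= e.
  by near: m; move/cvgrPdist_le : cr => /(_ _ e0); apply: filterS => m; rewrite sub0r normrN.
set t := (Num.sqrt m%:R)^-1.
have t2 : t ^+ 2 = m%:R^-1 by rewrite exprVn sqr_sqrtr.
(* Chosen so that [g ^+ m] is the Gaussian factor itself; the error [|1 - v / (2 * m) - g|] is then
   of order [1 / m ^+ 2] for each of the [m] factors. *)
pose g := expR (- (v / 2 / m%:R)).
have g01 : 0 <= g <= 1.
  rewrite expR_ge0 -expR0 ler_expR oppr_le0 !divr_ge0//.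
have gm : g ^+ m = expR (- v / 2).
  rewrite -expRM_natr; congr expR; field; exact: lt0r_neq0.
rewrite -gm mulrC distrC; apply: le_trans (past_bound m t b g01) _.
apply: le_trans re; apply: le_trans (ler_norm _).
have mt : measurable_fun setT (fun w => t * f (V 0%N w)).
  by apply: measurable_funM => //; exact: measurableT_comp.
have itf : L1 P (fun w => t * f (V 0%N w)) by exact: L1Z.
have itf2 : L1 P (fun w => (t * f (V 0%N w)) ^+ 2 / 2).
  have := L1Z (t ^+ 2 / 2) i2; under eq_fun do rewrite mulrAC -exprMn.
  by [].
have ic : L1 P (fun w => cos (t * f (V 0%N w))).
  by apply: (@L1_bounded _ _ _ _ _ 1) => [|w]; [exact: measurableT_comp|exact: cos_max].
have isn : L1 P (fun w => sin (t * f (V 0%N w))).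
  by apply: (@L1_bounded _ _ _ _ _ 1) => [|w]; [exact: measurableT_comp|exact: sin_max].
have iphi1 : L1 P (fun w => phi1 (t * f (V 0%N w))).
  by apply: L1D => //; apply: (L1B ic (L1_cst P 1)).
have iphi2 : L1 P (fun w => phi2 (t * f (V 0%N w))) by exact: L1B.
rewrite /r -/t [leLHS]mulrDr addrAC; apply: lerD.
  rewrite -[X in m%:R * X <= _]/(`|_ - _|).
  have -> : Ex P (fun w => cos (t * f (V 0%N w) + 0)) - g =
      Ex P (fun w => phi1 (t * f (V 0%N w))) + ((1 - v / 2 / m%:R) - g).
    rewrite /phi1 ExD//; last exact: (L1B ic (L1_cst P 1)).
    rewrite (ExB ic (L1_cst P 1)) Ex_cst.
    have -> : Ex P (fun w => (t * f (V 0%N w)) ^+ 2 / 2) = v / 2 / m%:R.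
      have -> : v / 2 / m%:R = t ^+ 2 / 2 * v by rewrite t2; field; exact: lt0r_neq0.
      by rewrite /v -ExZ//; congr Ex; apply/funext => w; field.
    rewrite (_ : (fun w => _) = (fun w => cos (t * f (V 0%N w)))); first by ring.
    by apply/funext => w; rewrite addr0.
  have -> : (v / 2) ^+ 2 / m%:R = m%:R * (v / 2 / m%:R) ^+ 2.
    by field; exact: lt0r_neq0.
  rewrite -mulrDr ler_wpM2l//; apply: le_trans (ler_normD _ _) _; apply: lerD.
    exact: ler_norm_Ex.
  by rewrite distrC; apply: expRN_bound; rewrite !divr_ge0.
rewrite ler_wpM2l//; apply: le_trans (ler_norm_Ex iphi2).
(* Since [f] is centred, subtracting the linear term does not change the mean of the sine. *)
have -> // : Ex P (fun w => cos (t * f (V 0%N w) + - (pi / 2))) = Ex P (fun w => phi2 (t * f (V 0%N w))).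
rewrite /phi2 ExB// ExZ// Ef mulr0 subr0; congr Ex; apply/funext => w.
by rewrite cosBpihalf.
Unshelve. all: by end_near. Qed.

End clt.

End iid.

(** * Minimizers near the Newton step *)

Section newton_step.
Variables (R : realType) (n : nat) (I : finType).
Variables (d : I -> R) (x : I -> 'cV[R]_n.+1) (hs : 'cV[R]_n.+1) (k : R).
Hypotheses (d_ge0 : forall l, 0 <= d l) (x_ge0 : forall l i, 0 <= x l i 0).
Hypotheses (k_gt0 : 0 < k) (khs : forall i, k <= hs i 0).
Variables (mR : R) (J Jm : 'M[R]_n.+1) (l eta rho A : R) (t h : 'cV[R]_n.+1).
Hypotheses (mR_gt0 : 0 < mR) (J_sym : J^T = J)
  (J_lower : forall s, l * `|s| ^+ 2 <= qform J s s)
  (curvatureE : forall s, curvature d x hs s s = mR * qform Jm s s)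
  (scoreE : forall s, dot s (score d x) = - (mR * qform J s t))
  (JmJ : `|Jm - J| <= eta) (tA : `|t| <= A) (rho_gt0 : 0 < rho) (Ark : A + rho <= k / 2).
Let a l := d l * dot hs (x l).
Let c : R := n.+1%:R ^+ 2.
(** Up to the factor [mR], the left side is twice the error in [approx], spent once at the centre
    and once on the sphere; the right side is the least growth of the quadratic model. In each error
    the term with [eta] comes from replacing [Jm] by [J], the other from the Taylor remainder. *)
Hypothesis small : c * eta * (A + rho) ^+ 2 +
  4 / k * (c * (`|J| + eta) * (A + rho) ^+ 3) < l * rho ^+ 2 / 2.
Hypotheses (h_ge0 : nonneg_orthant h) (h_admissible : admissible a x h)
  (h_min : forall h', nonneg_orthant h' -> admissible a x h' ->
    robjective a x h <= robjective a x h').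

Let c_ge0 : 0 <= c. Proof. exact: exprn_ge0. Qed.

Let near_ge0 (s : 'cV[R]_n.+1) : `|s| <= k / 2 -> nonneg_orthant (hs + s).
Proof.
move=> sk i; rewrite mxE; have := khs i; have := ler_mx_coord s i 0.
by move=> /le_trans/(_ sk); rewrite ler_norml => /andP[]; move: k_gt0; lra.
Qed.

Let approx (s : 'cV[R]_n.+1) : `|s| <= A + rho ->
  `|robjective a x (hs + s) - robjective a x hs
     - mR * (qform J s s / 2 - qform J s t)| <=
  mR * (c * eta * (A + rho) ^+ 2 / 2 + 2 / k * (c * (`|J| + eta) * (A + rho) ^+ 3)).
Proof.
move=> sB; have sk := le_trans sB Ark.
have := robjective_taylor d_ge0 x_ge0 k_gt0 khs sk.
rewrite scoreE curvatureE -/a => H.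
have s2 : `|s| * `|s| <= (A + rho) ^+ 2 by rewrite expr2 ler_pM.
have D : `|qform Jm s s - qform J s s| <= c * eta * (A + rho) ^+ 2.
  rewrite -qform_mxB; apply: le_trans (ler_norm_qform _ _ _) _.
  by rewrite -/c ler_pM ?mulr_ge0// ler_wpM2l.
have Q : `|qform Jm s s| <= c * (`|J| + eta) * (A + rho) ^+ 2.
  apply: le_trans (ler_norm_qform _ _ _) _.
  rewrite -/c ler_pM ?mulr_ge0// ler_wpM2l// -[Jm](subrK J) addrC.
  by apply: le_trans (ler_normD _ _) _; rewrite lerD2l.
rewrite [leRHS]mulrDr; set Psi := _ - robjective a x hs in H *.
have -> : Psi - mR * (qform J s s / 2 - qform J s t) =
  mR * ((qform Jm s s - qform J s s) / 2) +
  (Psi - (- (mR * qform J s t) + mR * qform Jm s s / 2)) by field.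
apply: le_trans (ler_normD _ _) _; apply: lerD.
  by rewrite normrM gtr0_norm// ler_wpM2l ?(ltW mR_gt0)// normrM (@ger0_norm _ 2^-1)// ler_wpM2r.
apply: le_trans H _.
have -> : 2 * `|s| / k * (mR * qform Jm s s) = mR * (2 / k * (qform Jm s s * `|s|)) by field; exact: lt0r_neq0.
rewrite ler_wpM2l ?(ltW mR_gt0)// ler_wpM2l ?divr_ge0 ?(ltW k_gt0)// [(A + rho) ^+ 3]exprSr mulrA.
apply: (@le_trans _ _ (`|qform Jm s s| * `|s|)); first by rewrite ler_wpM2r// ler_norm.
by rewrite ler_pM.
Qed.

(* The quadratic model is minimal at [t], with excess at least [mR l rho^2 / 2]
   on the sphere of radius [rho] around it; convexity of the objective confines
   its minimizer to the ball. *)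
Lemma minimizer_near_newton_step : `|h - (hs + t)| <= rho.
Proof.
have tB : `|t| <= A + rho by apply: le_trans tA _; rewrite lerDl ltW.
have tk := le_trans tB Ark.
have t_ge0 := near_ge0 tk.
have t_adm : admissible a x (hs + t) by exact: (admissible_near x_ge0 k_gt0 khs tk).
have a_ge0 i : 0 <= a i.
  by rewrite mulr_ge0// dot_orthant_ge0// => i'; apply: le_trans (khs i'); exact: ltW.
apply: (robjective_localize a_ge0 x_ge0 rho_gt0 h_ge0 t_ge0 h_admissible t_adm).
  exact: h_min.
move=> h' h'r; pose r := h' - (hs + t); pose s := t + r.
have h'E : h' = hs + s by rewrite /s /r addrA addrC subrK.
have sB : `|s| <= A + rho by apply: le_trans (ler_normD _ _) _; rewrite lerD// h'r.
have Qr : l * rho ^+ 2 <= qform J r r by rewrite -h'r.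
(* Completing the square: the model is stationary at [t], so the terms linear in [r] cancel. *)
clearbody r; have Es : qform J s s / 2 - qform J s t = qform J r r / 2 + (qform J t t / 2 - qform J t t).
  rewrite /s !(qformDl, qformDr) (qform_sym r t J_sym).
  by field.
have := approx sB; have := approx tB; rewrite h'E Es.
set P0 := robjective a x hs; set P1 := robjective a x (hs + s).
set P2 := robjective a x (hs + t).
rewrite !ler_norml => /andP[_ H1] /andP[H2 _].
rewrite -subr_gt0; have small' := small.
set e1 := c * eta * (A + rho) ^+ 2 in H1 H2 small'.
set e2 := c * (`|J| + eta) * (A + rho) ^+ 3 in H1 H2 small'.
have H3 : mR * (e1 + 4 / k * e2) < mR * (qform J r r / 2).
  rewrite ltr_pM2l//; apply: lt_le_trans small' _.
  by rewrite ler_wpM2r.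
have E4 : 4 / k * e2 = 2 * (2 / k * e2) by field; exact: lt0r_neq0.
rewrite E4 in H3; set e3 := 2 / k * e2 in H1 H2 H3.
move: H1 H2 H3; rewrite !mulrDr !mulrN.
set q1 := mR * (qform J r r / 2); set q2 := mR * (qform J t t / 2); set q3 := mR * qform J t t.
have -> : mR * (2 * e3) = 2 * (mR * e3) by ring.
have -> : mR * (e1 / 2) = mR * e1 / 2 by ring.
lra.
Qed.

End newton_step.

Section vanishing.
Context d (T : measurableType d) (R : realType) (P : probability T R).
Implicit Types A B C : nat -> set T.

Definition vanishing A :=
  forall e : R, 0 < e -> \forall m \near \oo, fine (P (A m)) <= e.

Lemma vanishing_cvg A : (forall m, measurable (A m)) -> vanishing A ->
  P (A m) @[m --> \oo] --> 0%E.
Proof.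
move=> mA vA; apply: cvg_EFin.
  by apply: nearW => m; exact: fin_num_measure.
apply/cvgrPdist_le => e e0; have := vA e e0; apply: filterS => m.
by rewrite sub0r normrN ger0_norm// fine_ge0.
Qed.

Lemma fine_probability_le (A B : set T) : measurable A -> measurable B ->
  A `<=` B -> fine (P A) <= fine (P B).
Proof.
move=> mA mB AB; apply: fine_le; rewrite ?fin_num_measure//.
by apply: le_measure => //; rewrite inE.
Qed.

Lemma fine_probability_leU (A B C : set T) : measurable A -> measurable B -> measurable C ->
  A `<=` B `|` C -> fine (P A) <= fine (P B) + fine (P C).
Proof.
move=> mA mB mC ABC.
apply: le_trans (fine_probability_le mA (measurableU _ _ mB mC) ABC) _.
rewrite -fineD ?fin_num_measure//; apply: fine_le; rewrite ?fin_numD ?fin_num_measure//.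
  exact: measurableU.
exact: measureU2.
Qed.

Lemma vanishing_sub2 A B C : (forall m, measurable (A m)) ->
  (forall m, measurable (B m)) -> (forall m, measurable (C m)) ->
  (\forall m \near \oo, A m `<=` B m `|` C m) ->
  vanishing B -> vanishing C -> vanishing A.
Proof.
move=> mA mB mC ABC vB vC e e0.
have e2 : 0 < e / 2 by rewrite divr_gt0.
near=> m.
have AB : A m `<=` B m `|` C m by near: m.
have Be : fine (P (B m)) <= e / 2 by near: m; exact: vB.
have Ce : fine (P (C m)) <= e / 2 by near: m; exact: vC.
apply: le_trans (fine_probability_leU (mA m) (mB m) (mC m) AB) _.
by rewrite [leRHS](splitr e) lerD.
Unshelve. all: by end_near. Qed.

Lemma vanishing_markov (X : nat -> T -> R) (c : R) : 0 < c -> (forall m, L1 P (X m)) ->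
  Ex P (fun w => `|X m w|) @[m --> \oo] --> 0 ->
  vanishing (fun m => [set w | c <= `|X m w|]).
Proof.
move=> c0 iX /cvgrPdist_le X0 e e0.
have := X0 _ (mulr_gt0 e0 c0); apply: filterS => m.
rewrite sub0r normrN ger0_norm ?Ex_ge0// => H.
have mX : measurable [set w | c <= `|X m w|].
  by apply: measurable_ge; apply: measurableT_comp => //; exact: L1_measurable.
rewrite -lee_fin -probability_fine//; apply: le_trans (markov_L1 c0 (iX m)) _.
by rewrite lee_fin ler_pdivrMr.
Qed.

Lemma vanishing_mx_coord p q (X : nat -> T -> 'M[R]_(p.+1, q.+1)) (c : R) :
  (forall m i j, measurable_fun setT (fun w => X m w i j)) ->
  (forall i j, vanishing (fun m => [set w | c <= `|X m w i j|])) ->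
  vanishing (fun m => [set w | c <= `|X m w|]).
Proof.
move=> mX vX.
have mA m i j : measurable [set w | c <= `|X m w i j|].
  by apply: measurable_ge; exact: measurableT_comp.
pose U (s : seq ('I_p.+1 * 'I_q.+1)) m := \big[setU/set0]_(p <- s) [set w | c <= `|X m w p.1 p.2|].
have mU s m : measurable (U s m) by exact: bigsetU_measurable.
have vU s : vanishing (U s).
  elim: s => [|[i j] s IH].
    by move=> e e0; near=> m; rewrite /U big_nil measure0/= ltW.
  apply: (@vanishing_sub2 _ _ (U s) _ _ _ _ (vX i j) IH) => //.
  by apply: nearW => m; rewrite /U big_cons.
have H : forall m, [set w | c <= `|X m w|] `<=` U (index_enum ('I_p.+1 * 'I_q.+1)%type) m.
  move=> m w /= cX; have [i [j Xij]] := mx_norm_coord (X m w).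
  rewrite /U (big_rem (i, j)) ?mem_index_enum//=; left; by rewrite /= -Xij.
apply: (@vanishing_sub2 _ (U (index_enum ('I_p.+1 * 'I_q.+1)%type)) (U (index_enum ('I_p.+1 * 'I_q.+1)%type))) => //.
  by move=> m; apply: measurable_ge; exact: measurable_mx_norm.
by apply: nearW => m; apply: subset_trans (H m) _; left.
Unshelve. all: by end_near. Qed.

End vanishing.

Section slutsky.
Context d (T : measurableType d) (R : realType) (P : probability T R) (n : nat).
Variables (X Y : nat -> T -> 'cV[R]_n.+1).
Hypotheses (mX : forall m i, measurable_fun setT (fun w => X m w i 0))
  (mY : forall m i, measurable_fun setT (fun w => Y m w i 0)).
Hypothesis XY : forall e : R, 0 < e -> vanishing P (fun m => [set w | e <= `|X m w - Y m w|]).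

Lemma cos_lipschitz (u v : R) : `|cos u - cos v| <= `|u - v|.
Proof.
have D (x : R) : is_derive x 1 (fun y : R => cos (v + y)) (- sin (v + x)).
  by apply: is_derive_eq; rewrite add0r /GRing.scale/= mulr1.
have := @mvt_bound R (fun y : R => cos (v + y)) (fun x => - sin (v + x)) (u - v) 1 (fun x _ => D x).
rewrite addr0 (addrC v) subrK mul1r; apply => x _.
by rewrite normrN sin_max.
Qed.

Let mXY m : measurable_fun setT (fun w => `|X m w - Y m w|).
Proof.
apply: measurable_cV_norm => i.
rewrite (_ : (fun w => _) = (fun w => X m w i 0 - Y m w i 0)); first exact: measurable_funB.
by apply/funext => w; rewrite !mxE.
Qed.

(** Cosine is 1-Lipschitz, so the two integrands differ by at most [K * r = e / 2] where
    [|X m - Y m| < r], and by at most 2 on the remaining event, which has small probability. *)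
Lemma slutsky_charfun (a : 'cV[R]_n.+1) (b c : R) :
  Ex P (fun w => cos (dot a (Y m w) + b)) @[m --> \oo] --> c ->
  Ex P (fun w => cos (dot a (X m w) + b)) @[m --> \oo] --> c.
Proof.
move=> Yc; rewrite -[c]addr0.
have -> : (fun m => Ex P (fun w => cos (dot a (X m w) + b))) =
  (fun m => Ex P (fun w => cos (dot a (Y m w) + b)) +
     (Ex P (fun w => cos (dot a (X m w) + b)) - Ex P (fun w => cos (dot a (Y m w) + b)))).
  by apply/funext => m; rewrite addrC subrK.
apply: cvgD => //; apply/cvgrPdist_le => e e0.
have iX m : L1 P (fun w => cos (dot a (X m w) + b)).
  apply: (@L1_bounded _ _ _ _ _ 1) => [|w]; last exact: cos_max.
  by apply: measurable_cosD; exact: measurable_dot.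
have iY m : L1 P (fun w => cos (dot a (Y m w) + b)).
  apply: (@L1_bounded _ _ _ _ _ 1) => [|w]; last exact: cos_max.
  by apply: measurable_cosD; exact: measurable_dot.
pose K : R := n.+1%:R * `|a| + 1.
have K0 : 0 < K by rewrite ltr_wpDl// mulr_ge0.
pose r := e / 2 / K; have r0 : 0 < r by rewrite !divr_gt0.
have e4 : 0 < e / 4 by rewrite divr_gt0.
near=> m.
have Pe : fine (P [set w | r <= `|X m w - Y m w|]) <= e / 4 by near: m; exact: XY.
set A := [set w | _] in Pe.
have mA : measurable A by exact: measurable_ge.
rewrite sub0r normrN -ExB//; apply: le_trans (ler_norm_Ex (L1B (iX m) (iY m))) _.
apply: (@le_trans _ _ (Ex P (fun w => e / 2 + 2 * \1_A w))).
  apply: Ex_le.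
  - exact: L1_norm (L1B (iX m) (iY m)).
  - exact: (L1D (L1_cst P (e / 2)) (L1Z 2 (L1_indic P mA))).
  move=> w; rewrite indicE; case: (boolP (w \in A)) => [_|].
    rewrite mulr1; apply: (@le_trans _ _ 2); last by rewrite lerDr divr_ge0 ?ltW.
    apply: le_trans (ler_normB _ _) _.
    have -> : 2 = 1 + 1 :> R by [].
    by apply: lerD; exact: cos_max.
  rewrite notin_setE /A/= mulr0 addr0 => /negP; rewrite -ltNge => Xr.
  apply: le_trans (cos_lipschitz _ _) _.
  have -> : dot a (X m w) + b - (dot a (Y m w) + b) = dot a (X m w - Y m w).
    by rewrite dotDr dotNr; ring.
  apply: le_trans (ler_norm_dot _ _) _; rewrite mulrA.
  apply: (@le_trans _ _ (K * r)); last by rewrite /r mulrC divfK ?gt_eqF.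
  by rewrite ler_pM ?mulr_ge0 ?(ltW Xr)// /K lerDl.
rewrite (ExD (L1_cst P (e / 2)) (L1Z 2 (L1_indic P mA))) (Ex_cst P (e / 2)).
rewrite (ExZ 2 (L1_indic P mA)).
have -> : Ex P \1_A = fine (P A) by rewrite -Ex_indic.
by move: Pe; lra.
Unshelve. all: by end_near. Qed.

Lemma slutsky_tight :
  (forall e : R, 0 < e -> exists2 L : R, 0 < L &
    \forall m \near \oo, fine (P [set w | L < `|Y m w|]) <= e) ->
  forall e : R, 0 < e -> exists2 L : R, 0 < L &
    \forall m \near \oo, fine (P [set w | L < `|X m w|]) <= e.
Proof.
move=> tY e e0; have e2 : 0 < e / 2 by rewrite divr_gt0.
have [L L0 HL] := tY _ e2; exists (L + 1); first by rewrite addr_gt0.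
near=> m.
have H1 : fine (P [set w | L < `|Y m w|]) <= e / 2 by near: m.
have H2 : fine (P [set w | 1 <= `|X m w - Y m w|]) <= e / 2 by near: m; exact: XY.
have mA : measurable [set w | L < `|Y m w|].
  by apply: measurable_gt; exact: measurable_cV_norm.
have mB : measurable [set w | 1 <= `|X m w - Y m w|] by exact: measurable_ge.
have mC : measurable [set w | L + 1 < `|X m w|].
  by apply: measurable_gt; exact: measurable_cV_norm.
have CAB : [set w | L + 1 < `|X m w|] `<=`
    [set w | L < `|Y m w|] `|` [set w | 1 <= `|X m w - Y m w|].
  move=> w /= LX; have [LY|YL] := ltP L `|Y m w|; [by left|right].
  have := ler_normD (X m w - Y m w) (Y m w); rewrite subrK => H; lra.
apply: le_trans (fine_probability_leU P mC mA mB CAB) _.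
by rewrite [leRHS](splitr e) lerD.
Unshelve. all: by end_near. Qed.

End slutsky.

Section newton_asymptotics.
Context d (T : measurableType d) (R : realType) (P : probability T R) (n : nat).
Variables (h t : nat -> T -> 'cV[R]_n.+1) (Jm : nat -> T -> 'M[R]_n.+1).
Variables (hs : 'cV[R]_n.+1) (J : 'M[R]_n.+1) (k l c : R).
Hypotheses (mh : forall m i, measurable_fun setT (fun w => h m w i 0))
  (mt : forall m i, measurable_fun setT (fun w => t m w i 0))
  (mJ : forall m i j, measurable_fun setT (fun w => Jm m w i j)).
Hypotheses (k_gt0 : 0 < k) (l_gt0 : 0 < l) (c_ge0 : 0 <= c).
(** The deterministic localization at one outcome. Leaving [eta], [rho] and [A] free allows the two
    lemmas below to work at different scales. *)
Hypothesis newton : forall m w (eta rho A : R), (0 < m)%N ->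
  `|Jm m w - J| <= eta -> `|t m w| <= A -> 0 < rho -> A + rho <= k / 2 ->
  c * eta * (A + rho) ^+ 2 + 4 / k * (c * (`|J| + eta) * (A + rho) ^+ 3) < l * rho ^+ 2 / 2 ->
  `|h m w - (hs + t m w)| <= rho.
Hypothesis J_cvg : forall e : R, 0 < e -> vanishing P (fun m => [set w | e <= `|Jm m w - J|]).

Let mJB m : measurable_fun setT (fun w => `|Jm m w - J|).
Proof.
apply: measurable_mx_norm => i j.
rewrite (_ : (fun w => _) = (fun w => Jm m w i j - J i j)); first exact: measurable_funB.
by apply/funext => w; rewrite !mxE.
Qed.

(* The radius [rho] of the confining ball is fixed here, and of order
   [1 / sqrt m] in [newton_linearization]. *)
Lemma newton_consistent :
  (forall e : R, 0 < e -> vanishing P (fun m => [set w | e <= `|t m w|])) ->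
  cvg_in_probability P h hs.
Proof.
move=> t_cvg eps eps0.
(* With [eta = A = rho] the smallness condition becomes [rho * (4 * c + 32 / k * (c * (|J| + rho)))
   < l / 2], where 4 and 32 come from the powers of [2 * rho]. For [rho <= 1] the bracket is at most
   [C], and [rho <= l / (4 * C)] then suffices; [rho <= eps / 4] puts the final distance below
   [eps]. *)
pose C := 4 * c + 32 / k * (c * (`|J| + 1)) + 1.
have C0 : 0 < C.
  by rewrite ltr_wpDl// addr_ge0 ?mulr_ge0 ?invr_ge0 ?addr_ge0 ?(ltW k_gt0).
pose rho := Num.min (Num.min (eps / 4) (k / 4)) (Num.min 1 (l / (4 * C))).
have rho0 : 0 < rho by rewrite !lt_min ltr01 !divr_gt0 ?mulr_gt0.
have [r1 r2 r3 r4] : [/\ rho <= eps / 4, rho <= k / 4, rho <= 1 & rho <= l / (4 * C)].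
  by split; rewrite !ge_min lexx ?orbT.
have mhB m : measurable_fun setT (fun w => `|h m w - hs|).
  apply: measurable_cV_norm => i.
  rewrite (_ : (fun w => _) = (fun w => h m w i 0 - hs i 0)); first exact: measurable_funB.
  by apply/funext => w; rewrite !mxE.
have mtn m : measurable_fun setT (fun w => `|t m w|) by exact: measurable_cV_norm.
apply: vanishing_cvg; first by move=> m; exact: measurable_ge.
apply: (vanishing_sub2 _ _ _ _ (J_cvg rho0) (t_cvg _ rho0)) => [m|m|m|].
- exact: measurable_ge.
- exact: measurable_ge.
- exact: measurable_ge.
near=> m; have m0 : (0 < m)%N by near: m; exists 1%N.
move=> w /= epsh.
have [Jr|Jr] := leP rho `|Jm m w - J|; [by left|right].
have [//|tr] := leP rho `|t m w|.
have := newton m0 (ltW Jr) (ltW tr) rho0.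
have -> : (rho + rho <= k / 2) by move: r2; lra.
move=> /(_ isT); have -> : c * rho * (rho + rho) ^+ 2 + 4 / k * (c * (`|J| + rho) * (rho + rho) ^+ 3)
    < l * rho ^+ 2 / 2.
  have -> : c * rho * (rho + rho) ^+ 2 + 4 / k * (c * (`|J| + rho) * (rho + rho) ^+ 3) =
     rho ^+ 2 * (rho * (4 * c + 32 / k * (c * (`|J| + rho)))) by field; exact: lt0r_neq0.
  have -> : l * rho ^+ 2 / 2 = rho ^+ 2 * (l / 2) by field.
  rewrite ltr_pM2l ?exprn_gt0//.
  apply: (@le_lt_trans _ _ (rho * C)).
    rewrite ler_wpM2l ?(ltW rho0)// ler_wpDr// lerD2l ler_wpM2l ?divr_ge0 ?(ltW k_gt0)//.
    by rewrite ler_wpM2l// lerD2l.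
  apply: (@le_lt_trans _ _ (l / (4 * C) * C)); first by rewrite ler_wpM2r// ltW.
  have -> : l / (4 * C) * C = l / 4 by field; exact: lt0r_neq0.
  by rewrite ltr_pM2l// ltf_pV2 ?posrE// ltr_nat.
move=> /(_ isT) H.
have := ler_normD (h m w - (hs + t m w)) (t m w).
rewrite opprD addrA subrK => H2.
by move: epsh H H2 tr r1 eps0; rewrite opprD addrA; lra.
Unshelve. all: by end_near. Qed.

Lemma newton_linearization :
  (forall e : R, 0 < e -> exists2 L : R, 0 < L &
    \forall m \near \oo, fine (P [set w | L < `|Num.sqrt m%:R *: t m w|]) <= e) ->
  forall e : R, 0 < e -> vanishing P (fun m =>
    [set w | e <= `|Num.sqrt m%:R *: (h m w - hs) - Num.sqrt m%:R *: t m w|]).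
Proof.
move=> tight e e0 e' e'0.
have e2 : 0 < e' / 2 by rewrite divr_gt0.
have [L L0 HL] := tight _ e2.
pose r := e / 2; have r0 : 0 < r by rewrite divr_gt0.
(* With [A = L / s] and [rho = r / s], where [s = sqrt m], the growth on the right and the term with
   [eta] scale alike, as [1 / s ^+ 2]. So [eta] is fixed and takes up half of the growth. The cubic
   term [W] has an additional factor [1 / s] and fits in the other half for large [m]. *)
pose eta := l * r ^+ 2 / 4 / (c * (L + r) ^+ 2 + 1).
have D0 : 0 < c * (L + r) ^+ 2 + 1 by rewrite ltr_wpDl// mulr_ge0// sqr_ge0.
have eta0 : 0 < eta by rewrite !divr_gt0// mulr_gt0// exprn_gt0.
have etaP : c * eta * (L + r) ^+ 2 <= l * r ^+ 2 / 4.
  have -> : l * r ^+ 2 / 4 = eta * (c * (L + r) ^+ 2 + 1).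
    by rewrite /eta divfK ?gt_eqF.
  by rewrite mulrAC [leLHS]mulrC ler_wpM2l ?(ltW eta0)// lerDl.
pose W := 4 / k * (c * (`|J| + eta) * (L + r) ^+ 3).
have W0 : 0 <= W.
  rewrite mulr_ge0 ?divr_ge0 ?(ltW k_gt0)// mulr_ge0 ?exprn_ge0 ?addr_ge0 ?(ltW L0) ?(ltW r0)//.
  by rewrite mulr_ge0// addr_ge0// ltW.
near=> m.
have m0 : (0 < m)%N by near: m; exists 1%N.
pose s : R := Num.sqrt m%:R.
have s0 : 0 < s by rewrite sqrtr_gt0 ltr0n.
have big x : (Num.truncn (x ^+ 2) < m)%N -> 0 <= x -> x < s.
  move=> xm x0; rewrite -[x]ger0_norm// -sqrtr_sqr ltr_sqrt ?ltr0n//.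
  by apply: lt_le_trans (truncnS_gt _) _; rewrite ler_nat.
have s1 : (L + r) / (k / 2) < s.
  apply: big; last by rewrite !divr_ge0 ?addr_ge0 ?(ltW L0) ?(ltW r0) ?(ltW k_gt0).
  by near: m; exists (Num.truncn (((L + r) / (k / 2)) ^+ 2)).+1.
have s2 : W / (l * r ^+ 2 / 4) < s.
  apply: big; last by apply: divr_ge0 => //; rewrite divr_ge0// mulr_ge0 ?sqr_ge0// ltW.
  by near: m; exists (Num.truncn ((W / (l * r ^+ 2 / 4)) ^+ 2)).+1.
have H1 : fine (P [set w | L < `|s *: t m w|]) <= e' / 2 by rewrite /s; near: m; exact: HL.
have H2 : fine (P [set w | eta <= `|Jm m w - J|]) <= e' / 2 by near: m; exact: J_cvg.
have mst i : measurable_fun setT (fun w => (s *: t m w) i 0).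
  rewrite (_ : (fun w => _) = (fun w => s * t m w i 0)); first exact: measurable_funM.
  by apply/funext => w; rewrite !mxE.
have mA : measurable [set w | L < `|s *: t m w|].
  by apply: measurable_gt; exact: measurable_cV_norm.
have mB : measurable [set w | eta <= `|Jm m w - J|] by exact: measurable_ge.
have mC : measurable [set w | e <= `|s *: (h m w - hs) - s *: t m w|].
  apply: measurable_ge; apply: measurable_cV_norm => i.
  rewrite (_ : (fun w => _) = (fun w => s * (h m w i 0 - hs i 0) - (s *: t m w) i 0)).
    by apply: measurable_funB => //; apply: measurable_funM => //; exact: measurable_funB.
  by apply/funext => w; rewrite !mxE.
have CAB : [set w | e <= `|s *: (h m w - hs) - s *: t m w|] `<=`
    [set w | L < `|s *: t m w|] `|` [set w | eta <= `|Jm m w - J|].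
  move=> w /= eh; have [Lt|tL] := ltP L `|s *: t m w|; [by left|right].
  have [//|Je] := leP eta `|Jm m w - J|.
  have tA : `|t m w| <= L / s.
    by rewrite ler_pdivlMr// mulrC -[s]gtr0_norm// -normrZ.
  have rs : 0 < r / s by rewrite divr_gt0.
  have Ark : L / s + r / s <= k / 2.
    by rewrite -mulrDl ler_pdivrMr// mulrC -ler_pdivrMr ?divr_gt0// ltW.
  have := newton m0 (ltW Je) tA rs Ark.
  have -> : c * eta * (L / s + r / s) ^+ 2 + 4 / k * (c * (`|J| + eta) * (L / s + r / s) ^+ 3)
    < l * (r / s) ^+ 2 / 2.
    have -> : c * eta * (L / s + r / s) ^+ 2 + 4 / k * (c * (`|J| + eta) * (L / s + r / s) ^+ 3) =
      (s ^+ 2)^-1 * (c * eta * (L + r) ^+ 2 + W / s).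
      by rewrite /W; field; rewrite !gt_eqF.
    have -> : l * (r / s) ^+ 2 / 2 = (s ^+ 2)^-1 * (l * r ^+ 2 / 4 + l * r ^+ 2 / 4).
      by field; rewrite gt_eqF.
    rewrite ltr_pM2l ?invr_gt0 ?exprn_gt0//; apply: ler_ltD => //.
    by rewrite ltr_pdivrMr// mulrC -ltr_pdivrMr// !divr_gt0// mulr_gt0// exprn_gt0.
  move=> /(_ isT) H.
  move: eh; rewrite -scalerBr -addrA -opprD normrZ gtr0_norm//.
  move: H; rewrite ler_pdivlMr// mulrC => H /le_trans/(_ H).
  by rewrite /r leNgt ltr_pdivrMr// ltr_pMr// ltr1n.
apply: le_trans (fine_probability_leU P mC mA mB CAB) _.
by rewrite [leRHS](splitr e') lerD.
Unshelve. all: by end_near. Qed.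

End newton_asymptotics.

(** * Moments of the model *)

Section moments_toolkit.
Context d (T : measurableType d) (R : realType) (P : probability T R).
Implicit Types X : T -> R.

(** Inversion is a pointwise limit of continuous functions that all vanish at 0, in agreement with
    the convention [0^-1 = 0]. *)
Lemma measurable_invr : measurable_fun setT (@GRing.inv R).
Proof.
pose g (k : nat) (x : R) := x * (x ^+ 2 + k.+1%:R^-1)^-1.
apply: (@measurable_fun_cvg _ _ _ _ g) => [k|x _].
  apply: continuous_measurable_fun => x; apply: cvgM; first exact: cvg_id.
  apply: cvgV; last by apply: cvgD; [exact: exprn_continuous|exact: cvg_cst].
  by rewrite gt_eqF// ltr_wpDl ?sqr_ge0// invr_gt0.
have [->|x0] := eqVneq x 0.
  by rewrite invr0 /g; under eq_fun do rewrite mul0r; exact: cvg_cst.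
have -> : x^-1 = x * (x ^+ 2 + 0)^-1 by field.
apply: cvgM; first exact: cvg_cst.
apply: cvgV; first by rewrite addr0 expf_neq0.
by apply: cvgD; [exact: cvg_cst|exact: cvg_harmonic].
Qed.

Lemma L1_square X : measurable_fun setT X -> L1 P (fun w => X w ^+ 2) -> L1 P X.
Proof.
move=> mX i2; apply: (@L1_le _ _ _ _ _ (fun w => 1 + X w ^+ 2)) => // [w|].
  by rewrite -[X in _ <= _ + X]real_normK ?num_real//; have := sqr_ge0 (`|X w| - 1); nra.
exact: (L1D (L1_cst P 1) i2).
Qed.

Lemma L1M_square X (Y : T -> R) : measurable_fun setT X -> measurable_fun setT Y ->
  L1 P (fun w => X w ^+ 2) -> L1 P (fun w => Y w ^+ 2) -> L1 P (fun w => X w * Y w).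
Proof.
move=> mX mY iX iY; apply: (@L1_le _ _ _ _ _ (fun w => X w ^+ 2 + Y w ^+ 2)) => [|w|].
- exact: measurable_funM.
- rewrite normrM -[X w ^+ 2]real_normK ?num_real// -[Y w ^+ 2]real_normK ?num_real//.
  by have := sqr_ge0 (`|X w| - `|Y w|); have := sqr_ge0 (`|X w|); nra.
- exact: L1D.
Qed.

Lemma L1_expectation_fin X : measurable_fun setT X -> (forall w, 0 <= X w) ->
  ('E_P[X] < +oo)%E -> L1 P X.
Proof.
move=> mX X0; rewrite unlock => fin; apply/integrableP; split; first exact/measurable_EFinP.
rewrite (eq_integral (EFin \o X))// => w _.
by rewrite /= ger0_norm.
Qed.

Lemma Ex_gt0 X (A : set T) : L1 P X -> (forall w, 0 <= X w) ->
  measurable A -> (0 < P A)%E -> (forall w, A w -> 0 < X w) -> 0 < Ex P X.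
Proof.
move=> iX X0 mA PA AX; rewrite lt0r Ex_ge0// andbT; apply/negP => /eqP E0.
have mX := L1_measurable iX.
have := EFin_Ex iX; rewrite E0 => /esym I0.
have : (\int[P]_w `|(X w)%:E| = 0)%E.
  by transitivity (\int[P]_w (X w)%:E)%E => //; apply: eq_integral => w _; rewrite gee0_abs// lee_fin.
move=> /(ae_eq_integral_abs P measurableT (f := EFin \o X)) [].
  exact/measurable_EFinP.
move=> B [mB PB BX]; move: PA; rewrite lt_neqAle => /andP[/eqP + _]; apply.
apply/esym/eqP; rewrite -measure_le0 -[X in (_ <= X)%E]PB; apply: le_measure; rewrite ?inE//.
move=> w /AX Xw; apply: BX => /= /(_ I) [] H.
by rewrite H ltxx in Xw.
Qed.

End moments_toolkit.

Section design_rank.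
Variables (R : realType) (q N : nat).
Hypothesis qN : (q <= N)%N.

(* Row [k] of the design, with [k] the first nonzero entry of [a], isolates [a k * u 0]. *)
Lemma design_injective (u : 'cV[R]_N.+1) (a : 'cV[R]_q.+1) : nonneg_orthant u ->
  0 < u ord0 0 -> a != 0 -> exists i : 'I_N.+1, dot a (design q u i) != 0 /\
    forall h : 'cV[R]_q.+1, (forall k, 0 < h k 0) -> 0 < dot h (design q u i).
Proof.
move=> u_ge0 u0 a0.
have [k0 ak0] : exists k, a k 0 != 0.
  apply/existsP; apply: contra_neqT a0; rewrite negb_exists => /forallP H.
  by apply/matrixP => i j; rewrite ord1 mxE; apply/eqP; have := H i; rewrite negbK.
have [k ak kmin] := @arg_minnP _ k0 (fun k : 'I_q.+1 => a k 0 != 0) (fun k => k : nat) ak0.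
have kN : (k < N.+1)%N by rewrite ltnS (leq_trans _ qN)// -ltnS.
exists (Ordinal kN).
have Dk : (design q u (Ordinal kN) : 'cV[R]_q.+1) k 0 = u ord0 0.
  by rewrite mxE leqnn subnn; congr (u _ 0); apply/val_inj; rewrite /= inordK.
split.
  rewrite /dot (bigD1 k)//= Dk big1 ?addr0 ?mulf_neq0 ?(gt_eqF u0)// => k' k'k.
  rewrite mxE/=; case: leqP => [k'_le|]; last by rewrite mulr0.
  have [->|/kmin kk'] := eqVneq (a k' 0) 0; first by rewrite mul0r.
  by move: k'k; rewrite -val_eqE/= eqn_leq k'_le kk'.
(* The same row has a positive fitted value for every positive [h], so the weight [(dot hstar x)^-1]
   of the Fisher matrix is strictly positive there. *)
move=> h h0; rewrite /dot (bigD1 k)//= Dk ltr_pwDl ?mulr_gt0//.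
by apply: sumr_ge0 => k' _; rewrite mulr_ge0 ?design_ge0// ltW.
Qed.

End design_rank.

Section model.
Context d (T : measurableType d) (R : realType) (P : probability T R) (q N : nat).
Variables (hstar : 'cV[R]_q.+1) (kappa : R).
Variables (U : nat -> {RV P >-> 'cV[R]_N.+1}) (delta : 'I_N.+1 -> nat -> {RV P >-> R}).
Hypotheses (qN : (q <= N)%N) (kappa_gt0 : 0 < kappa)
  (hstar_kappa : forall k, kappa <= hstar k 0)
  (U_ge0 : forall j w, nonneg_orthant (U j w))
  (U_indep : mutually_independent U)
  (U_ident : forall j, identically_distributed (U j) (U 0%N))
  (delta_ge0 : forall i j w, 0 <= delta i j w)
  (delta_indep : mutually_independent (fun p : 'I_N.+1 * nat => delta p.1 p.2))
  (delta_ident : forall i j, identically_distributed (delta i j) (delta ord0 0%N))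
  (U_delta_indep : independent_families U (fun p : 'I_N.+1 * nat => delta p.1 p.2))
  (delta_mean : forall i j, ('E_P[delta i j] = 1)%E)
  (U_pos : (0 < P [set w | (0 < U 0%N w ord0 0)%R])%E)
  (U_sqr : forall i, ('E_P[fun w => (U 0%N w i 0 ^+ 2)%R] < +oo)%E).

Let x (u : 'cV[R]_N.+1) i : 'cV[R]_q.+1 := design q u i.
Let u0 (w : T) : 'cV[R]_N.+1 := U 0%N w.
Let e0 (w : T) : 'cV[R]_N.+1 := noise delta 0%N w.

Let hstar_gt0 k : 0 < hstar k 0. Proof. exact: lt_le_trans (hstar_kappa k). Qed.

Lemma measurable_design i k : measurable_fun setT (fun u => x u i k 0).
Proof.
rewrite /x /design; under eq_fun do rewrite mxE.
by case: leqP => _; [exact: measurable_coord|exact: measurable_cst].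
Qed.

Lemma measurable_dot_design a i : measurable_fun setT (fun u => dot a (x u i)).
Proof. by apply: measurable_dot => k; exact: measurable_design. Qed.

Let mu0 (F : 'cV[R]_N.+1 -> R) : measurable_fun setT F -> measurable_fun setT (fun w => F (u0 w)).
Proof. by move=> mF; exact: measurableT_comp. Qed.

Let U2_L1 i : L1 P (fun w => u0 w i 0 ^+ 2).
Proof.
apply: L1_expectation_fin => //; last by move=> w; exact: sqr_ge0.
by apply: measurable_funX; exact: (mu0 (measurable_coord i 0)).
Qed.

Let design_sqr_L1 i k : L1 P (fun w => x (u0 w) i k 0 ^+ 2).
Proof.
rewrite /x /design; under eq_fun do rewrite mxE.
case: leqP => _; first exact: U2_L1.
by apply: (@L1_bounded _ _ _ _ _ 0) => [|w]; rewrite ?expr0n ?normr0.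
Qed.

Let design_L1 i k : L1 P (fun w => x (u0 w) i k 0).
Proof. by apply: L1_square => //; exact: mu0 (measurable_design i k). Qed.

Let designM_L1 i k l : L1 P (fun w => x (u0 w) i k 0 * x (u0 w) i l 0).
Proof. by apply: L1M_square => //; exact: mu0 (measurable_design i _). Qed.

Section moment_matrix.
Variable g : 'cV[R]_N.+1 -> 'I_N.+1 -> R.
Hypotheses (g_ge0 : forall u i, nonneg_orthant u -> 0 <= g u i)
  (g_gt0 : forall u i, nonneg_orthant u -> 0 < dot hstar (x u i) -> 0 < g u i)
  (gL1 : forall i k l, L1 P (fun w => g (u0 w) i * (x (u0 w) i k 0 * x (u0 w) i l 0))).

(** One weighted second-moment matrix serves for both [gram] and [fisher]. The weight is required to
    be positive only on rows with [dot hstar x > 0], because the Fisher weight is 0 on null rows. *)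
Definition moment : 'M[R]_q.+1 := \matrix_(k, l)
  \sum_i Ex P (fun w => g (u0 w) i * (x (u0 w) i k 0 * x (u0 w) i l 0)).

Let expand (a b : 'cV[R]_q.+1) i : (fun w => g (u0 w) i * (dot a (x (u0 w) i) * dot b (x (u0 w) i))) =
  (fun w => \sum_k \sum_l (a k 0 * b l 0) * (g (u0 w) i * (x (u0 w) i k 0 * x (u0 w) i l 0))).
Proof.
apply/funext => w; rewrite /dot mulr_suml mulr_sumr; apply: eq_bigr => k _.
by rewrite !mulr_sumr; apply: eq_bigr => l _; ring.
Qed.

Lemma moment_L1 a b i :
  L1 P (fun w => g (u0 w) i * (dot a (x (u0 w) i) * dot b (x (u0 w) i))).
Proof. by rewrite expand; apply: L1_sum => k; apply: L1_sum => l; exact: L1Z. Qed.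

Lemma moment_qform a b : qform moment a b =
  \sum_i Ex P (fun w => g (u0 w) i * (dot a (x (u0 w) i) * dot b (x (u0 w) i))).
Proof.
transitivity (\sum_i \sum_k \sum_l (a k 0 * b l 0) *
    Ex P (fun w => g (u0 w) i * (x (u0 w) i k 0 * x (u0 w) i l 0))).
  rewrite qform_sum [RHS]exchange_big/=; apply: eq_bigr => k _.
  rewrite [RHS]exchange_big/=; apply: eq_bigr => l _.
  by rewrite mxE mulr_sumr mulr_suml; apply: eq_bigr => i _; ring.
apply: eq_bigr => i _; rewrite expand Ex_sum; last first.
  by move=> k; apply: L1_sum => l; exact: L1Z.
apply: eq_bigr => k _; rewrite Ex_sum; last by move=> l; exact: L1Z.
by apply: eq_bigr => l _; rewrite ExZ.
Qed.

Lemma moment_positive_definite : positive_definite moment.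
Proof.
apply/positive_definite_qform; split.
  apply/matrixP => k l; rewrite !mxE; apply: eq_bigr => i _.
  by congr Ex; apply/funext => w; ring.
move=> a a0; rewrite moment_qform -Ex_sum; last by move=> i; exact: moment_L1.
have sq w i : 0 <= g (u0 w) i * (dot a (x (u0 w) i) * dot a (x (u0 w) i)).
  by rewrite mulr_ge0 ?g_ge0//; [exact: U_ge0|rewrite -expr2 sqr_ge0].
apply: (@Ex_gt0 _ _ _ _ _ [set w | 0 < U 0%N w ord0 0]) => //.
- by apply: L1_sum => i; exact: moment_L1.
- by move=> w; apply: sumr_ge0.
- apply: measurable_gt; exact: (mu0 (measurable_coord ord0 0)).
move=> w /= w0; have [i [ai hi]] := design_injective qN (U_ge0 0%N w) w0 a0.
rewrite (bigD1 i)//= ltr_pwDl ?sumr_ge0// mulr_gt0 ?g_gt0//.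
- exact: U_ge0.
- exact: hi.
- by rewrite -expr2 exprn_even_gt0.
Qed.

End moment_matrix.

Definition gram := moment (fun _ _ => 1).
Definition fisher := moment (fun u i => (dot hstar (x u i))^-1).

Lemma gram_positive_definite : positive_definite gram.
Proof.
apply: moment_positive_definite => // i k l.
by under eq_fun do rewrite mul1r.
Qed.

(** One entry of the row is absorbed by the denominator: [kappa * x_l <= hstar_l * x_l <= dot hstar
    x]. *)
Lemma fisher_L1 i k l :
  L1 P (fun w => (dot hstar (x (u0 w) i))^-1 * (x (u0 w) i k 0 * x (u0 w) i l 0)).
Proof.
apply: (@L1_le _ _ _ _ _ (fun w => kappa^-1 * x (u0 w) i k 0)); last 2 first.
- move=> w; have x0 k' : 0 <= x (u0 w) i k' 0 by apply: design_ge0; exact: U_ge0.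
  have v0 : 0 <= dot hstar (x (u0 w) i).
    by apply: sumr_ge0 => k' _; rewrite mulr_ge0// ltW.
  rewrite ger0_norm ?mulr_ge0 ?invr_ge0//.
  have [v00|v_neq0] := eqVneq (dot hstar (x (u0 w) i)) 0.
    by rewrite v00 invr0 mul0r mulr_ge0// invr_ge0 ltW.
  have vgt0 : 0 < dot hstar (x (u0 w) i) by rewrite lt0r v_neq0.
  rewrite ler_pdivrMl//.
  rewrite [leRHS](_ : _ = x (u0 w) i k 0 * (kappa^-1 * dot hstar (x (u0 w) i))); last by ring.
  rewrite ler_wpM2l// ler_pdivlMl//.
  apply: (@le_trans _ _ (hstar l 0 * x (u0 w) i l 0)); first by rewrite ler_wpM2r.
  rewrite /dot (bigD1 l)//= lerDl; apply: sumr_ge0 => k' _.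
  by rewrite mulr_ge0// ltW.
- exact: L1Z.
apply: measurable_funM.
  by apply: (measurableT_comp (@measurable_invr R)); exact: (mu0 (measurable_dot_design _ _)).
by apply: measurable_funM; exact: (mu0 (measurable_design _ _)).
Qed.

Lemma fisher_positive_definite : positive_definite fisher.
Proof.
apply: moment_positive_definite; last exact: fisher_L1.
- move=> u i u_ge0; rewrite invr_ge0; apply: sumr_ge0 => k _.
  by rewrite mulr_ge0 ?design_ge0// ltW.
- by move=> u i _; rewrite invr_gt0.
Qed.

Lemma noise_product (F G : 'cV[R]_N.+1 -> R) :
  measurable_fun setT F -> measurable_fun setT G ->
  L1 P (fun w => F (u0 w)) -> L1 P (fun w => G (e0 w)) ->
  L1 P (fun w => G (e0 w) * F (u0 w)) /\
  Ex P (fun w => G (e0 w) * F (u0 w)) = Ex P (fun w => G (e0 w)) * Ex P (fun w => F (u0 w)).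
Proof.
move=> mF mG iF iG; apply: independent_product => // A B mA mB.
apply: (joint_independent U_indep delta_indep U_delta_indep
    (S1 := set0) (S1' := [set 0%N]) (S2 := [set p | p.2 = 0%N]) (S2' := set0)) => //.
- exact: set0I.
- exact: setI0.
- apply: (measurableT_comp mG); apply: measurable_mx => i k.
  rewrite (_ : (fun w => _) = (delta i 0%N : T -> R)).
    exact: (@measurable_jointr _ _ _ _ _ _ _ P _ _ U (fun p : 'I_N.+1 * nat => delta p.1 p.2) _ _ (i, 0%N)).
  by apply/funext => w; rewrite /e0 mxE.
- apply: (measurableT_comp mF).
  exact: measurable_jointl.
Qed.

Let delta_L1 i j : L1 P (delta i j).
Proof.
by apply: L1_expectation_fin => //; rewrite delta_mean ltry.
Qed.

Let delta_Ex i j : Ex P (delta i j) = 1.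
Proof. by apply: EFin_inj; rewrite -(expectation_Ex (delta_L1 i j)) delta_mean. Qed.

Let me0 i : measurable_fun setT (fun e : 'cV[R]_N.+1 => 1 - e i 0).
Proof. by apply: measurable_funB => //; exact: measurable_coord. Qed.

Let e0E i : (fun w => e0 w i 0) = (delta i 0%N : T -> R).
Proof. by apply/funext => w; rewrite /e0 mxE. Qed.

Let e0_L1 i : L1 P (fun w => 1 - e0 w i 0).
Proof. by apply: (L1B (L1_cst P 1)); rewrite e0E. Qed.

Let e0_Ex i : Ex P (fun w => 1 - e0 w i 0) = 0.
Proof.
have iD : L1 P (fun w => e0 w i 0) by rewrite e0E.
by rewrite (ExB (L1_cst P 1) iD) Ex_cst e0E delta_Ex subrr.
Qed.

(** The contribution of one observation to the score in direction [a], with [s.1] the input vector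
    and [s.2] the noise. *)
Definition influence (a : 'cV[R]_q.+1) (s : 'cV[R]_N.+1 * 'cV[R]_N.+1) : R :=
  \sum_i (1 - s.2 i 0) * dot a (x s.1 i).

(* A row with [dot hstar x = 0] is zero, so the junk value [0^-1 = 0] is harmless. *)
Definition information k l (s : 'cV[R]_N.+1 * 'cV[R]_N.+1) : R :=
  \sum_i s.2 i 0 * ((dot hstar (x s.1 i))^-1 * (x s.1 i k 0 * x s.1 i l 0)).

Let V := sample_rv U delta.

Lemma measurable_influence a : measurable_fun setT (influence a).
Proof.
apply: measurable_sumr => i; apply: measurable_funM.
  exact: (measurableT_comp (me0 i) measurable_snd).
exact: (measurableT_comp (measurable_dot_design a i) measurable_fst).
Qed.

Lemma measurable_information k l : measurable_fun setT (information k l).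
Proof.
apply: measurable_sumr => i; apply: measurable_funM.
  exact: (measurableT_comp (measurable_coord i 0) measurable_snd).
have m1 : measurable_fun setT (fun u => (dot hstar (x u i))^-1 * (x u i k 0 * x u i l 0)).
  apply: measurable_funM.
    by apply: (measurableT_comp (@measurable_invr R)); exact: measurable_dot_design.
  by apply: measurable_funM; exact: measurable_design.
exact: (measurableT_comp m1 measurable_fst).
Qed.

Let dot_L1 a i : L1 P (fun w => dot a (x (u0 w) i)).
Proof. by apply: L1_sum => k; exact: L1Z. Qed.

Let influence_term a i := noise_product (measurable_dot_design a i) (me0 i) (dot_L1 a i) (e0_L1 i).

Lemma influence_L1 a : L1 P (influence a \o V 0%N).
Proof. by apply: L1_sum => i; exact: (influence_term a i).1. Qed.

Lemma influence_Ex a : Ex P (influence a \o V 0%N) = 0.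
Proof.
rewrite /influence /comp Ex_sum; last by move=> i; exact: (influence_term a i).1.
apply: big1 => i _; apply: etrans (influence_term a i).2 _.
by rewrite e0_Ex mul0r.
Qed.

Let information_term i k l :=
  noise_product (F := fun u => (dot hstar (x u i))^-1 * (x u i k 0 * x u i l 0)) (G := fun e => e i 0).

Let mfisher i k l : measurable_fun setT (fun u => (dot hstar (x u i))^-1 * (x u i k 0 * x u i l 0)).
Proof.
apply: measurable_funM.
  by apply: (measurableT_comp (@measurable_invr R)); exact: measurable_dot_design.
by apply: measurable_funM; exact: measurable_design.
Qed.

Let e0d_L1 i : L1 P (fun w => e0 w i 0).
Proof. by rewrite e0E. Qed.

Let information_termP i k l :=
  information_term (mfisher i k l) (measurable_coord i 0) (fisher_L1 i k l) (e0d_L1 i).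

Lemma information_L1 k l : L1 P (information k l \o V 0%N).
Proof. by apply: L1_sum => i; exact: (information_termP i k l).1. Qed.

Lemma information_Ex k l : Ex P (information k l \o V 0%N) = fisher k l.
Proof.
rewrite /information /comp Ex_sum; last by move=> i; exact: (information_termP i k l).1.
rewrite mxE; apply: eq_bigr => i _; apply: etrans (information_termP i k l).2 _.
by rewrite e0E delta_Ex mul1r.
Qed.

Section finite_variance.
Hypothesis delta_var : (0 < 'V_P[delta ord0 0%N] < +oo)%E.

Definition noise_variance := Ex P (fun w => (1 - delta ord0 0%N w) ^+ 2).

Let varE : ('V_P[delta ord0 0%N] = 'E_P[fun w => ((1 - delta ord0 0%N w) ^+ 2)%R])%E.
Proof.
rewrite /variance covariance.unlock delta_mean/=; congr ('E_P[_])%E.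
by apply/funext => w /=; rewrite expr2 -[in RHS]mulrNN !opprB.
Qed.

Let msq : measurable_fun setT (fun y : R => (1 - y) ^+ 2).
Proof. by apply: measurable_funX; exact: measurable_funB. Qed.

Let var_L1 : L1 P ((fun y : R => (1 - y) ^+ 2) \o delta ord0 0%N).
Proof.
apply: L1_expectation_fin.
- exact: measurableT_comp.
- by move=> w; exact: sqr_ge0.
- by move: delta_var; rewrite varE => /andP[].
Qed.

Lemma noise_variance_gt0 : 0 < noise_variance.
Proof.
move: delta_var; rewrite varE (expectation_Ex var_L1) => /andP[+ _].
by rewrite lte_fin.
Qed.

Let sym i : identically_distributed (delta ord0 0%N) (delta i 0%N).
Proof. by move=> A mA; rewrite delta_ident. Qed.

Let e0_sqr_L1 i : L1 P (fun w => (1 - e0 w i 0) ^+ 2).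
Proof.
have := L1_identically_distributed (sym i) msq var_L1.
by apply: eq_integrable => // w _; rewrite /= /e0 mxE.
Qed.

Let e0_sqr_Ex i : Ex P (fun w => (1 - e0 w i 0) ^+ 2) = noise_variance.
Proof.
rewrite /noise_variance; apply: etrans (esym (Ex_identically_distributed (sym i) msq var_L1)).
by congr Ex; apply/funext => w; rewrite /= /e0 mxE.
Qed.

Let e0M_L1 i l : L1 P (fun w => (1 - e0 w i 0) * (1 - e0 w l 0)).
Proof. by apply: L1M_square => //; exact: L1_measurable (e0_L1 _). Qed.

Let e0M_Ex i l : i != l -> Ex P (fun w => (1 - e0 w i 0) * (1 - e0 w l 0)) = 0.
Proof.
move=> il; have [A B mA mB|_ ->] := independent_product (e0_L1 i) (e0_L1 l); last first.
  by rewrite e0_Ex mul0r.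
have m1 k : measurable_fun (setT : set (joint U (fun p : 'I_N.+1 * nat => delta p.1 p.2)
    set0 [set (k, 0%N)])) (fun w => 1 - e0 w k 0).
  apply: measurable_funB => //; rewrite e0E.
  exact: (@measurable_jointr _ _ _ _ _ _ _ P _ _ U (fun p : 'I_N.+1 * nat => delta p.1 p.2) _ _ (k, 0%N)).
apply: (joint_independent U_indep delta_indep U_delta_indep _ _ (m1 i) (m1 l)) => //.
  exact: set0I.
apply/seteqP; split => // -[k j]/= [[-> _] [ik _]].
by rewrite ik eqxx in il.
Qed.

Let influence2_term a i l :=
  noise_product (F := fun u => dot a (x u i) * dot a (x u l))
    (G := fun e => (1 - e i 0) * (1 - e l 0)).

Let dotM_L1 a i l : L1 P (fun w => dot a (x (u0 w) i) * dot a (x (u0 w) l)).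
Proof.
have dot2 i' : L1 P (fun w => dot a (x (u0 w) i') ^+ 2).
  have := @moment_L1 (fun _ _ => 1) _ a a i'; under eq_fun do rewrite mul1r -expr2; apply.
  by move=> i1 k1 l1; under eq_fun do rewrite mul1r.
by apply: L1M_square => //; exact: mu0 (measurable_dot_design _ _).
Qed.

Let influence2_termP a i l := influence2_term
  (measurable_funM (measurable_dot_design a i) (measurable_dot_design a l))
  (measurable_funM (me0 i) (me0 l)) (dotM_L1 a i l) (e0M_L1 i l).

Let influence2E a : (fun w => influence a (V 0%N w) ^+ 2) =
  (fun w => \sum_i \sum_l ((1 - e0 w i 0) * (1 - e0 w l 0)) *
     (dot a (x (u0 w) i) * dot a (x (u0 w) l))).
Proof.
apply/funext => w; rewrite /influence expr2 mulr_suml; apply: eq_bigr => i _.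
by rewrite mulr_sumr; apply: eq_bigr => l _; rewrite mulrACA.
Qed.

Lemma influence2_L1 a : L1 P (fun w => influence a (V 0%N w) ^+ 2).
Proof.
rewrite influence2E; apply: L1_sum => i; apply: L1_sum => l.
exact: (influence2_termP a i l).1.
Qed.

(** Products over two different rows have mean zero, the noise being centred and independent across
    rows; the diagonal terms give the variance times the unweighted moment matrix. *)
Lemma influence2_Ex a : Ex P (fun w => influence a (V 0%N w) ^+ 2) =
  noise_variance * qform gram a a.
Proof.
rewrite influence2E Ex_sum; last first.
  by move=> i; apply: L1_sum => l; exact: (influence2_termP a i l).1.
rewrite /gram moment_qform; last by move=> i k l; under eq_fun do rewrite mul1r.
rewrite mulr_sumr; apply: eq_bigr => i _.
rewrite Ex_sum; last by move=> l; exact: (influence2_termP a i l).1.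
rewrite (bigD1 i)//= big1 ?addr0 => [|l li].
  rewrite (influence2_termP a i i).2; congr (_ * _); first by rewrite -(e0_sqr_Ex i).
  by congr Ex; apply/funext => w; rewrite mul1r.
by rewrite (influence2_termP a i l).2 e0M_Ex 1?eq_sym// mul0r.
Qed.

End finite_variance.

End model.

(** * The estimator *)

Section estimator.
Context d (T : measurableType d) (R : realType) (P : probability T R) (q N : nat).
Variables (hstar : 'cV[R]_q.+1) (kappa : R).
Variables (U : nat -> {RV P >-> 'cV[R]_N.+1}) (delta : 'I_N.+1 -> nat -> {RV P >-> R}).
Hypotheses (qN : (q <= N)%N) (kappa_gt0 : 0 < kappa)
  (hstar_kappa : forall k, kappa <= hstar k 0)
  (U_ge0 : forall j w, nonneg_orthant (U j w))
  (U_indep : mutually_independent U)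
  (U_ident : forall j, identically_distributed (U j) (U 0%N))
  (delta_ge0 : forall i j w, 0 <= delta i j w)
  (delta_indep : mutually_independent (fun p : 'I_N.+1 * nat => delta p.1 p.2))
  (delta_ident : forall i j, identically_distributed (delta i j) (delta ord0 0%N))
  (U_delta_indep : independent_families U (fun p : 'I_N.+1 * nat => delta p.1 p.2))
  (delta_mean : forall i j, ('E_P[delta i j] = 1)%E)
  (U_pos : (0 < P [set w | (0 < U 0%N w ord0 0)%R])%E)
  (U_sqr : forall i, ('E_P[fun w => (U 0%N w i 0 ^+ 2)%R] < +oo)%E)
  (Y : nat -> T -> 'cV[R]_N.+1)
  (Y_def : forall j w i, Y j w i 0 = (toeplitz N hstar *m U j w) i 0 * delta i j w)
  (hhat : nat -> {RV P >-> 'cV[R]_q.+1})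
  (hhat_min : forall m w,
    minimizer_on (@nonneg_orthant R q.+1)
      (idiv_objective m (fun j => Y j w) (fun j => U j w)) (hhat m w)).

Let V := sample_rv U delta.
Let V_id := sample_identically_distributed U_indep U_ident delta_indep delta_ident U_delta_indep.

Let V_past m (f g : 'cV[R]_N.+1 * 'cV[R]_N.+1 -> R) :
  measurable_fun setT f -> measurable_fun setT g ->
  forall A B : set R, measurable A -> measurable B ->
  P ((fun w => \sum_(j < m) f (V j w)) @^-1` A `&` (g \o V m) @^-1` B) =
  (P ((fun w => (\sum_(j < m) f (V j w))%R) @^-1` A) * P ((g \o V m) @^-1` B))%E.
Proof.
move=> mf mg; apply: (joint_independent U_indep delta_indep U_delta_indep
  (S1 := [set j | (j < m)%N]) (S1' := [set m])
  (S2 := [set p | (p.2 < m)%N]) (S2' := [set p | p.2 = m])).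
- by apply/seteqP; split => // j /= [+ jm]; rewrite jm ltnn.
- by apply/seteqP; split => // p /= [+ jm]; rewrite jm ltnn.
- apply: measurable_sumr => j; apply: (measurableT_comp mf).
  by apply: (measurable_sample_point_joint (U := U) (delta := delta)) => [|i] /=.
- apply: (measurableT_comp mg).
  by apply: (measurable_sample_point_joint (U := U) (delta := delta)) => [|i] /=.
Qed.

Let V_pair j k (f g : 'cV[R]_N.+1 * 'cV[R]_N.+1 -> R) : j != k ->
  measurable_fun setT f -> measurable_fun setT g ->
  forall A B : set R, measurable A -> measurable B ->
  P ((f \o V j) @^-1` A `&` (g \o V k) @^-1` B) =
  (P ((f \o V j) @^-1` A) * P ((g \o V k) @^-1` B))%E.
Proof.
move=> jk mf mg; apply: (joint_independent U_indep delta_indep U_delta_indep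
  (S1 := [set j]) (S1' := [set k])
  (S2 := [set p | p.2 = j]) (S2' := [set p | p.2 = k])).
- by apply/seteqP; split => // i /= [-> ij]; rewrite ij eqxx in jk.
- by apply/seteqP; split => // i /= [-> ij]; rewrite ij eqxx in jk.
- apply: (measurableT_comp mf).
  by apply: (measurable_sample_point_joint (U := U) (delta := delta)) => [|i] /=.
- apply: (measurableT_comp mg).
  by apply: (measurable_sample_point_joint (U := U) (delta := delta)) => [|i] /=.
Qed.

Let J : 'M[R]_q.+1 := fisher hstar U.
Let K : 'M[R]_q.+1 := gram q U.
Let Jpd : positive_definite J := fisher_positive_definite qN kappa_gt0 hstar_kappa U_ge0 U_pos U_sqr.
Let Kpd : positive_definite K := gram_positive_definite qN kappa_gt0 hstar_kappa U_ge0 U_pos U_sqr.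

Let total m w : 'cV[R]_q.+1 :=
  \sum_(j < m) \sum_i (1 - delta i j w) *: design q (U j w) i.

(** Taken with the deterministic limit [J], so that every linear functional of it is an average of
    i.i.d. influences and both limit theorems apply directly. *)
Definition newton_step m w : 'cV[R]_q.+1 := - (invmx J *m (m%:R^-1 *: total m w)).

Definition mean_information m w : 'M[R]_q.+1 :=
  \matrix_(k, l) ((\sum_(j < m) information hstar k l (V j w)) / m%:R).

Let dot_total a m w : dot a (total m w) = \sum_(j < m) influence a (V j w).
Proof.
rewrite dot_sumr; apply: eq_bigr => j _; rewrite dot_sumr; apply: eq_bigr => i _.
by rewrite dotZr /= mxE.
Qed.

Let newton_stepE a m w : dot a (newton_step m w) =
  m%:R^-1 * \sum_(j < m) influence (- (invmx J *m a)) (V j w).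
Proof.
rewrite -dot_total dotNr dotNl mulrN; congr (- _).
rewrite -[LHS]/(qform (invmx J) a (m%:R^-1 *: total m w)) qformZr qform_sym.
  by rewrite /qform dotC.
by rewrite trmx_inv Jpd.1.
Qed.

Let coordE (y : 'cV[R]_q.+1) k : y k 0 = dot (delta_mx k 0) y.
Proof. by rewrite -[delta_mx k 0]scale1r dot_deltal mul1r. Qed.

Let measurable_newton_step m k : measurable_fun setT (fun w => newton_step m w k 0).
Proof.
under eq_fun do rewrite coordE newton_stepE.
apply: measurable_funM => //; apply: measurable_sumr => j.
exact: (measurableT_comp (measurable_influence _)).
Qed.

Let measurable_mean_information m k l :
  measurable_fun setT (fun w => mean_information m w k l).
Proof.
under eq_fun do rewrite mxE; apply: measurable_funM => //; apply: measurable_sumr => j.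
exact: (measurableT_comp (measurable_information _ _ _)).
Qed.

Let inf_L1 (a : 'cV[R]_q.+1) := influence_L1 U_indep delta_ge0 delta_indep U_delta_indep delta_mean U_sqr a.
Let inf_Ex (a : 'cV[R]_q.+1) := influence_Ex U_indep delta_ge0 delta_indep U_delta_indep delta_mean U_sqr a.

Let newton_step_cvg (e : R) : 0 < e ->
  vanishing P (fun m => [set w | e <= `|newton_step m w|]).
Proof.
move=> e0; apply: vanishing_mx_coord => [m i j|i j].
  by rewrite ord1; exact: measurable_newton_step.
rewrite ord1; set b : 'cV[R]_q.+1 := - (invmx J *m delta_mx i 0).
have E m w : newton_step m w i 0 = (\sum_(j < m) influence b (V j w)) / m%:R.
  by rewrite coordE newton_stepE mulrC.
apply: vanishing_markov => // [m|].
  under eq_fun do rewrite E mulrC; apply: L1Z; apply: L1_sum => k.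
  by apply: (iid_L1 V_id); [exact: measurable_influence|exact: inf_L1].
have := weak_lln V_id V_pair (measurable_influence b) (inf_L1 b).
rewrite inf_Ex; apply: cvg_trans; apply: near_eq_cvg; apply: nearW => m; congr Ex.
by apply/funext => w; rewrite subr0 E.
Qed.

Let info_L1 k l := information_L1 kappa_gt0 hstar_kappa U_ge0 U_indep delta_ge0 delta_indep
  U_delta_indep delta_mean U_sqr k l.
Let info_Ex k l := information_Ex kappa_gt0 hstar_kappa U_ge0 U_indep delta_ge0 delta_indep
  U_delta_indep delta_mean U_sqr k l.

Let mean_information_cvg (e : R) : 0 < e ->
  vanishing P (fun m => [set w | e <= `|mean_information m w - J|]).
Proof.
move=> e0; apply: vanishing_mx_coord => [m k l|k l].
  rewrite (_ : (fun w => _) = (fun w => mean_information m w k l - J k l)).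
    exact: measurable_funB.
  by apply/funext => w; rewrite !mxE.
have E m w : (mean_information m w - J) k l =
    (\sum_(j < m) information hstar k l (V j w)) / m%:R - J k l.
  by rewrite !mxE.
apply: vanishing_markov => // [m|].
  under eq_fun do rewrite E mulrC; apply: (L1B _ (L1_cst P (J k l))).
  apply: L1Z; apply: L1_sum => j.
  by apply: (iid_L1 V_id); [exact: measurable_information|exact: info_L1].
have := weak_lln V_id V_pair (measurable_information hstar k l) (info_L1 k l).
rewrite info_Ex; apply: cvg_trans; apply: near_eq_cvg; apply: nearW => m; congr Ex.
by apply/funext => w; rewrite E.
Qed.

Let l_ex := positive_definite_lower Jpd.

(** At a fixed outcome the pairs of a sample and a row form one finite index set, to which the
    deterministic localization applies with Hessian [m] times [mean_information]. *)
Let newton (l : R) : (forall s, l * `|s| ^+ 2 <= qform J s s) ->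
  forall m w (eta rho A : R), (0 < m)%N ->
  `|mean_information m w - J| <= eta -> `|newton_step m w| <= A -> 0 < rho ->
  A + rho <= kappa / 2 ->
  q.+1%:R ^+ 2 * eta * (A + rho) ^+ 2 +
    4 / kappa * (q.+1%:R ^+ 2 * (`|J| + eta) * (A + rho) ^+ 3) < l * rho ^+ 2 / 2 ->
  `|hhat m w - (hstar + newton_step m w)| <= rho.
Proof.
move=> lJ m w eta rho A m0 Jeta tA rho0 Ark small.
have mR : 0 < m%:R :> R by rewrite ltr0n.
pose dd (p : 'I_m * 'I_N.+1) := delta p.2 p.1 w.
pose xx (p : 'I_m * 'I_N.+1) := design q (U p.1 w) p.2.
have dd0 p : 0 <= dd p by exact: delta_ge0.
have xx0 p k : 0 <= xx p k 0 by apply: design_ge0; exact: U_ge0.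
have objE h : idiv_objective m (fun j => Y j w) (fun j => U j w) h =
    (\sum_p idiv_term (dd p * dot hstar (xx p)) (dot h (xx p)))%E.
  rewrite /idiv_objective /idiv pair_big/=; apply: eq_bigr => -[j i] _ /=.
  by rewrite Y_def !toeplitz_dot mulrC.
have hstar_ge0 : nonneg_orthant hstar.
  by move=> k; apply: le_trans (hstar_kappa k); exact: ltW.
have adm0 : admissible (fun p => dd p * dot hstar (xx p)) xx hstar.
  have := @admissible_near R q _ dd xx hstar kappa xx0 kappa_gt0 hstar_kappa 0.
  by rewrite addr0 normr0; apply; rewrite divr_ge0// ltW.
have [h_ge0 hmin] := hhat_min m w.
(* The objective is finite at [hstar], hence also at its minimizer, which is therefore
   admissible. *)
have hadm : admissible (fun p => dd p * dot hstar (xx p)) xx (hhat m w).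
  apply: eobjective_admissible; rewrite -objE; apply: le_lt_trans (hmin _ hstar_ge0) _.
  by rewrite objE eobjective_fin// ltry.
apply: (@minimizer_near_newton_step R q _ dd xx hstar kappa dd0 xx0 kappa_gt0 hstar_kappa
  m%:R J (mean_information m w) l eta rho A) => //.
- exact: Jpd.1.
- move=> s; rewrite /curvature qform_sum -(pair_bigA _ (fun (j : 'I_m) (i : 'I_N.+1) =>
    delta i j w * (dot s (design q (U j w) i) * dot s (design q (U j w) i)) /
    dot hstar (design q (U j w) i)))/=.
  rewrite mulr_sumr; under [RHS]eq_bigr do rewrite mulr_sumr.
  transitivity (\sum_(k < q.+1) \sum_(l < q.+1) \sum_(j < m) s k 0 * information hstar k l (V j w) * s l 0); last first.
    apply: eq_bigr => k _; apply: eq_bigr => l' _; rewrite mxE.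
    rewrite -mulr_suml -mulr_sumr; field; exact: lt0r_neq0.
  under [RHS]eq_bigr do rewrite exchange_big/=; rewrite [RHS]exchange_big/=.
  apply: eq_bigr => j _; rewrite /information.
  transitivity (\sum_(k < q.+1) \sum_(l < q.+1) \sum_i
     delta i j w * (s k 0 * design q (U j w) i k 0 * (s l 0 * design q (U j w) i l 0)) /
     dot hstar (design q (U j w) i)); last first.
    apply: eq_bigr => k _; apply: eq_bigr => l' _.
    rewrite mulr_sumr mulr_suml; apply: eq_bigr => i _.
    have -> : (V j w).2 i 0 = delta i j w by rewrite mxE.
    rewrite /=; ring.
  under [RHS]eq_bigr do rewrite exchange_big/=; rewrite [RHS]exchange_big/=.
  apply: eq_bigr => i _; rewrite {1}/dot mulr_suml mulr_sumr mulr_suml; apply: eq_bigr => k _.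
  by rewrite /dot !(mulr_sumr, mulr_suml).
- move=> s; have -> : score dd xx = total m w.
    by rewrite /score /total (pair_bigA _ (fun (j : 'I_m) i => (1 - delta i j w) *: design q (U j w) i)).
  rewrite /qform /newton_step mulmxN dotNr mulrN opprK mulKVmx ?positive_definite_unitmx//.
  by rewrite dotZr mulVKf ?gt_eqF.
- move=> h' h'0 h'adm; rewrite -lee_fin -!eobjective_fin// -!objE; exact: hmin.
Qed.

Let measurable_hhat m k : measurable_fun setT (fun w => hhat m w k 0).
Proof. by apply: measurable_mx_coord. Qed.

Lemma estimator_consistent : cvg_in_probability P (fun m w => hhat m w) hstar.
Proof.
have [l l0 lJ] := l_ex.
exact: (newton_consistent measurable_hhat measurable_newton_step measurable_mean_information
  kappa_gt0 l0 (sqr_ge0 _) (newton lJ) mean_information_cvg newton_step_cvg).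
Qed.

Section asymptotic_normality.
Hypothesis delta_var : (0 < 'V_P[delta ord0 0%N] < +oo)%E.

Let inf2_L1 (a : 'cV[R]_q.+1) := influence2_L1 U_indep delta_ge0 delta_indep delta_ident U_delta_indep
  delta_mean U_sqr delta_var a.
Let inf2_Ex (a : 'cV[R]_q.+1) := influence2_Ex U_indep delta_ge0 delta_indep delta_ident U_delta_indep
  delta_mean U_sqr delta_var a.

Let scaled m w : 'cV[R]_q.+1 := Num.sqrt m%:R *: newton_step m w.

Let scaledE a m w : (0 < m)%N -> dot a (scaled m w) =
  (Num.sqrt m%:R)^-1 * \sum_(j < m) influence (- (invmx J *m a)) (V j w).
Proof.
move=> m0; rewrite dotZr newton_stepE mulrA; congr (_ * _).
have s0 : 0 < Num.sqrt m%:R :> R by rewrite sqrtr_gt0 ltr0n.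
rewrite -{2}[m%:R](sqr_sqrtr (ler0n _ m)) expr2.
by field; rewrite gt_eqF.
Qed.

Let measurable_scaled m k : measurable_fun setT (fun w => scaled m w k 0).
Proof. by under eq_fun do rewrite mxE; exact: measurable_funM. Qed.

(** The second moments of the coordinates of the scaled step do not depend on [m > 0], so one
    Chebyshev bound serves for all these [m]; the 1 added to [C] keeps the threshold positive. *)
Let scaled_tight (e : R) : 0 < e -> exists2 L : R, 0 < L &
  \forall m \near \oo, fine (P [set w | L < `|scaled m w|]) <= e.
Proof.
move=> e0.
pose b k : 'cV[R]_q.+1 := - (invmx J *m delta_mx k 0).
pose C := \sum_k Ex P (fun w => influence (b k) (V 0%N w) ^+ 2).
have C0 : 0 <= C by apply: sumr_ge0 => k _; apply: Ex_ge0 => w; exact: sqr_ge0.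
have Ce : 0 < (C + 1) / e by rewrite divr_gt0// ltr_wpDl.
exists (Num.sqrt ((C + 1) / e)); first by rewrite sqrtr_gt0.
near=> m; have m0 : (0 < m)%N by near: m; exists 1%N.
have mR : 0 < m%:R :> R by rewrite ltr0n.
pose X w := \sum_k scaled m w k 0 ^+ 2.
have sqE k : (fun w => scaled m w k 0 ^+ 2) =
    (fun w => m%:R^-1 * (\sum_(j < m) influence (b k) (V j w)) ^+ 2).
  by apply/funext => w; rewrite coordE scaledE// exprMn exprVn sqr_sqrtr.
have sm k := iid_second_moment V_id V_pair m (measurable_influence (b k)) (inf_L1 _) (inf2_L1 _) (inf_Ex _).
have iX k : L1 P (fun w => scaled m w k 0 ^+ 2) by rewrite sqE; apply: L1Z; exact: (sm k).1.
have EX : Ex P X = C.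
  rewrite Ex_sum//; apply: eq_bigr => k _; rewrite sqE ExZ; last exact: (sm k).1.
  by rewrite (sm k).2 mulKf ?gt_eqF.
have X0 w : 0 <= X w by apply: sumr_ge0 => k _; exact: sqr_ge0.
have iXX : L1 P X by apply: L1_sum.
have mX : measurable [set w | (C + 1) / e <= `|X w|].
  by apply: measurable_ge; apply: measurableT_comp => //; exact: L1_measurable iXX.
have mS : measurable [set w | Num.sqrt ((C + 1) / e) < `|scaled m w|].
  by apply: measurable_gt; exact: measurable_cV_norm.
have sub : [set w | Num.sqrt ((C + 1) / e) < `|scaled m w|] `<=` [set w | (C + 1) / e <= `|X w|].
  move=> w /= H; have [k [j Sk]] := mx_norm_coord (scaled m w).
  rewrite ord1 in Sk; rewrite ger0_norm// -[leLHS]sqr_sqrtr ?(ltW Ce)//.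
  apply: (@le_trans _ _ (scaled m w k 0 ^+ 2)); last first.
    by rewrite /X (bigD1 k)//= lerDl sumr_ge0// => i _; exact: sqr_ge0.
  rewrite -[leRHS]real_normK ?num_real// -Sk lerXn2r ?nnegrE ?sqrtr_ge0//.
  exact: ltW.
apply: le_trans (fine_probability_le P mS mX sub) _.
rewrite -lee_fin -probability_fine//; apply: le_trans (markov_L1 Ce iXX) _.
have -> : Ex P (fun w => `|X w|) = C by rewrite -EX; congr Ex; apply/funext => w; rewrite ger0_norm.
rewrite lee_fin ler_pdivrMr// mulrC divfK ?gt_eqF// lerDl//.
Unshelve. all: by end_near. Qed.

Lemma estimator_asymptotically_normal : exists Sigma : 'M[R]_q.+1, positive_definite Sigma /\
  exists (d' : measure_display) (T' : measurableType d') (Q : probability T' R)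
    (Z : {RV Q >-> 'cV[R]_q.+1}), multivariate_normal Z 0 Sigma /\
    cvg_in_distribution P Q (fun m w => Num.sqrt m%:R *: (hhat m w - hstar)) Z.
Proof.
have [l l0 lJ] := l_ex.
have v0 := noise_variance_gt0 delta_mean delta_var.
have [Spd SE] := positive_definite_sandwich v0 Jpd Kpd.
set Sigma := _ *: _ in Spd SE; exists Sigma; split => //.
have [vs vsE] := psd_sum_squares (positive_definite_psd Spd).
have [d' [T' [Q [Z [Zn Zc]]]]] := @multivariate_normal_exists R q.+1 vs Sigma
  (fun a => etrans (qformE _ _ _) (vsE a)).
exists d', T', Q, Z; split => //.
have mX m k : measurable_fun setT (fun w => (Num.sqrt m%:R *: (hhat m w - hstar)) k 0).
  rewrite (_ : (fun w => _) = (fun w => Num.sqrt m%:R * (hhat m w k 0 - hstar k 0))).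
    by apply: measurable_funM => //; exact: measurable_funB.
  by apply/funext => w; rewrite !mxE.
have lin := newton_linearization measurable_hhat measurable_newton_step measurable_mean_information
  kappa_gt0 l0 (sqr_ge0 _) (newton lJ) mean_information_cvg scaled_tight.
apply: cvg_in_distribution_trig => //.
- by move=> k; apply: measurable_mx_coord.
- move=> a b; rewrite Zc -vsE SE.
  (* The scaled error and the scaled Newton step differ by a term vanishing in probability, so the
     limit has to be computed only for the i.i.d. sum. *)
  apply: (slutsky_charfun mX measurable_scaled lin).
  have := iid_clt (b := b) V_id V_past (measurable_influence (- (invmx J *m a)))
    (inf_L1 _) (inf2_L1 _) (inf_Ex _).
  rewrite inf2_Ex -/K.
  have -> : qform K (- (invmx J *m a)) (- (invmx J *m a)) = qform K (invmx J *m a) (invmx J *m a).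
    by rewrite /qform mulmxN dotNl dotNr opprK.
  apply: cvg_trans; apply: near_eq_cvg; near=> m.
  have m0 : (0 < m)%N by near: m; exists 1%N.
  by congr Ex; apply/funext => w; rewrite scaledE.
- exact: (slutsky_tight mX measurable_scaled lin scaled_tight).
Unshelve. all: by end_near. Qed.

End asymptotic_normality.

End estimator.
Theorem proposition4p4
  (R : realType) (d : measure_display) (T : measurableType d)
  (P : probability T R) (q N : nat) (hqN : (q <= N)%N)
  (hstar : 'cV[R]_q.+1)
  (hstar_int : interior (@nonneg_orthant R q.+1) hstar)
  (U : nat -> {RV P >-> 'cV[R]_N.+1})
  (U_ge0 : forall j w, nonneg_orthant (U j w))
  (U_indep : mutually_independent U)
  (U_ident : forall j, identically_distributed (U j) (U 0%N))
  (delta : 'I_N.+1 -> nat -> {RV P >-> R})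
  (delta_ge0 : forall i j w, 0 <= delta i j w)
  (delta_indep :
    mutually_independent (fun p : 'I_N.+1 * nat => delta p.1 p.2))
  (delta_ident : forall i j, identically_distributed (delta i j) (delta ord0 0%N))
  (U_delta_indep :
    independent_families U (fun p : 'I_N.+1 * nat => delta p.1 p.2))
  (delta_mean : forall i j, ('E_P[delta i j] = 1)%E)
  (Y : nat -> T -> 'cV[R]_N.+1)
  (Y_def : forall j w i,
    Y j w i 0 = (toeplitz N hstar *m U j w) i 0 * delta i j w)
  (U_pos : forall j, (0 < P [set w | (0 < U j w ord0 0)%R])%E)
  (U_sqr : forall i j, ('E_P[fun w => (U j w i 0 ^+ 2)%R] < +oo)%E)
  (hhat : nat -> {RV P >-> 'cV[R]_q.+1})
  (hhat_min : forall m w,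
    minimizer_on (@nonneg_orthant R q.+1)
      (idiv_objective m (fun j => Y j w) (fun j => U j w))
      (hhat m w)) :
  cvg_in_probability P (fun m w => hhat m w) hstar /\
  (* No normal limit with definite covariance exists in general for noise of
     zero or infinite variance. *)
  ((0 < 'V_P[delta ord0 0%N] < +oo)%E ->
   exists Sigma : 'M[R]_q.+1, positive_definite Sigma /\
     exists (d' : measure_display) (T' : measurableType d')
       (Q : probability T' R) (Z : {RV Q >-> 'cV[R]_q.+1}),
       multivariate_normal Z 0 Sigma /\
       cvg_in_distribution P Q
         (fun m w => Num.sqrt m%:R *: (hhat m w - hstar)) Z).

Proof.
(* Moving by half the radius of a ball around [hstar] against the [k]-th axis stays in the orthant,
   so the entry is at least that half radius. *)
have hstar_gt0 k : 0 < hstar k 0.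
  have /nbhs_ballP[e /= e0 He] := hstar_int.
  have := He (hstar - (e / 2) *: delta_mx k 0) _; rewrite /nonneg_orthant/=.
  move=> H; have := H _ k; rewrite !mxE !eqxx/= mulr1 subr_ge0 => H2.
  apply: lt_le_trans (H2 _); first by rewrite divr_gt0.
  rewrite mx_norm_ball /ball_/= opprB addrC subrK normrZ.
  have [i [j ->]] := mx_norm_coord (delta_mx k 0 : 'cV[R]_q.+1).
  rewrite mxE (@ger0_norm _ (e / 2)) ?divr_ge0 ?(ltW e0)//.
  apply: (@le_lt_trans _ _ (e / 2 * 1)); last by rewrite mulr1 ltr_pdivrMr// ltr_pMr// ltr1n.
  by rewrite ler_wpM2l ?divr_ge0 ?(ltW e0)//; case: (_ && _); rewrite ?normr0 ?normr1.
(* Only a positive common lower bound matters; 1 is the starting value of the minimum. *)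
pose kappa := \big[Num.min/1]_k hstar k 0.
have kappa_gt0 : 0 < kappa by rewrite /kappa; elim/big_ind: _ => // a b a0 b0; rewrite lt_min a0.
have hstar_kappa k : kappa <= hstar k 0 by exact: bigmin_le.
split.
  exact: (estimator_consistent hqN kappa_gt0 hstar_kappa U_ge0 U_indep U_ident delta_ge0
    delta_indep delta_ident U_delta_indep delta_mean (U_pos 0%N) (U_sqr^~ 0%N) Y_def hhat_min).
exact: (estimator_asymptotically_normal hqN kappa_gt0 hstar_kappa U_ge0 U_indep U_ident delta_ge0
    delta_indep delta_ident U_delta_indep delta_mean (U_pos 0%N) (U_sqr^~ 0%N) Y_def hhat_min).
Qed.
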